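(* Let $f:(0,\infty)\to(0,\infty)$ be a continuous function. Then the following statements are equivalent: \begin{enumerate} \item[(I1)] $f$ is operator monotone (increasing); \item[(I2)] $f(A \,\triangledown\, B) \ge f(A)\,\triangledown\, f(B)$ for all $A,B>0$; \item[(I3)] $f(A \,\triangledown_t\, B) \ge f(A)\,\triangledown_t\, f(B)$ for all $A,B>0$ and for all $t\in[0,1]$; \item[(I4)] $f(A \,!\, B) \le f(A)\,\#\, f(B)$ for all $A,B>0$; \item[(I5)] $f(A \,!_t\, B) \le f(A)\,\#_t\, f(B)$ for all $A,B>0$ and for all $t\in[0,1]$; \item[(I6)] $f(A \,!\, B) \le f(A)\,!\, f(B)$ for all $A,B>0$; \item[(I7)] $f(A \,!_t\, B) \le f(A)\,!_t\, f(B)$ for all $A,B>0$ and for all $t\in[0,1]$; \item[(I8)] $f(A \,!\, B) \le f(A)\,\sigma\, f(B)$ for all $A,B>0$ and for all symmetric means $\sigma$; \item[(I9)] $f(A \,!\, B) \le f(A)\,\sigma\, f(B)$ for all $A,B>0$ and for some symmetric mean $\sigma\neq\triangledown$. \end{enumerate}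
   Context: $B(\mathcal{H})$ denotes the algebra of bounded linear operators on a complex Hilbert space $\mathcal{H}$, and $B(\mathcal{H})^+$ the cone of positive (i.e. positive semidefinite) operators on $\mathcal{H}$. For selfadjoint $A,B\in B(\mathcal{H})$, $A\le B$ means $B-A\in B(\mathcal{H})^+$, and $A<B$ means that $B-A$ is an invertible positive operator; thus $A>0$ means that $A$ is an invertible positive operator. $f(A)$ is defined by continuous functional calculus. A continuous function $f:I\to\mathbb{R}$ on an interval $I\subseteq\mathbb{R}$ is operator monotone (increasing) if $A\le B$ implies $f(A)\le f(B)$ for all operators $A,B\in B(\mathcal{H})$ whose spectra are contained in $I$ and for all Hilbert spaces $\mathcal{H}$. For $A,B>0$ and $t\in[0,1]$: $A\,\triangledown_t\,B=(1-t)A+tB$, $A\,!_t\,B=[(1-t)A^{-1}+tB^{-1}]^{-1}$, $A\,\#_t\,B=A^{1/2}(A^{-1/2}BA^{-1/2})^tA^{1/2}$. Write $\triangledown=\triangledown_{1/2}$, $!=\,!_{1/2}$, $\#=\#_{1/2}$. These are extended to all $A,B\ge 0$ as strong-operator limits, replacing $A,B$ by $A+\epsilon I,B+\epsilon I$ and letting $\epsilon\downarrow0$. An operator connection is a binary operation $\sigma$ on $B(\mathcal{H})^+$ such that for all positive operators $A,B,C,D$: (M1) $A\le C$, $B\le D$ imply $A\,\sigma\,B\le C\,\sigma\,D$; (M2) $C(A\,\sigma\,B)C\le (CAC)\,\sigma\,(CBC)$; (M3) for $A_n,B_n\in B(\mathcal{H})^+$, if $A_n\downarrow A$ and $B_n\downarrow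 B$ then $A_n\,\sigma\,B_n\downarrow A\,\sigma\,B$, where $X_n\downarrow X$ means that $(X_n)$ is a decreasing sequence converging strongly to $X$. An operator mean is an operator connection with $A\,\sigma\,A=A$ for all $A\ge0$. A symmetric mean is an operator mean $\sigma$ with $A\,\sigma\,B=B\,\sigma\,A$ for all $A,B\ge0$.
   Formalization: The Hilbert space H carrying A, B and σ in (I2)–(I9) is assumed infinite-dimensional; for finite-dimensional H the equivalence is false (for H = ℂ, f = min(x,1) satisfies (I2) but not (I1), and min is a symmetric mean lying below !). *)

(* Defs.v *)
From HB Require Import structures.
From mathcomp Require Import all_boot all_order all_algebra sesquilinear.
From mathcomp Require Import all_classical all_reals all_analysis.
From mathcomp.real_closed Require Import complex.

Set Implicit Arguments.
Unset Strict Implicit.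
Unset Printing Implicit Defensive.

Import Order.TTheory GRing.Theory Num.Theory.
Import numFieldNormedType.Exports.

Local Open Scope classical_set_scope.
Local Open Scope complex_scope.
Local Open Scope ring_scope.

(* The form is linear in the first argument and conjugate-linear in the
   second.  As everywhere over [R[i]], the norm takes values in [R[i]], where
   [0 <= z] means that z is a nonnegative real number. *)
Record hilbertType (R : realType) := HilbertType {
  hilbert_sort :> completeNormedModType R[i];
  inner : {dot hilbert_sort for (Num.conj : R[i] -> R[i])};
  inner_norm : forall x : hilbert_sort, inner x x = `|x| ^+ 2
}.

(* The Kubo-Ando axioms characterize operator means only on an
   infinite-dimensional space: on B(C)^+ = [0, +oo[ the operation min satisfies
   all the axioms of a symmetric mean but lies below the harmonic mean. *)
Definition infinite_dimensional (R : realType) (H : hilbertType R) : Prop :=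
  ~ exists (n : nat) (e : 'I_n -> H),
      forall x, exists c : 'I_n -> R[i], x = \sum_(i < n) c i *: e i.

Section Operators.
Context {R : realType} {H : hilbertType R}.

(* Operators are plain functions [H -> H], with the pointwise linear structure
   of the library; B(H) is cut out by the predicate [bounded_operator]. *)
Implicit Types A B C X : H -> H.

Definition bounded_operator A : Prop :=
  linear A /\ exists M : R, forall x, `|A x| <= M%:C * `|x|.

Definition selfadjoint A : Prop :=
  bounded_operator A /\ forall x y, inner H (A x) y = inner H x (A y).

(* On a complex Hilbert space nonnegativity of the quadratic form forces
   selfadjointness. *)
Definition positive A : Prop :=
  bounded_operator A /\ forall x, 0 <= inner H (A x) x.

Definition op_le A B : Prop := positive (B - A).

Definition is_inverse A B : Prop :=
  [/\ bounded_operator B, A \o B = id & B \o A = id].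

Definition invertible A : Prop := exists B, is_inverse A B.

Definition op_inv A : H -> H := xget 0 [set B | is_inverse A B].

Definition strictly_positive A : Prop := positive A /\ invertible A.

Definition spectrum A : set R[i] :=
  [set z | ~ invertible (A - (fun x => z *: x))].

Definition poly_op (p : {poly R}) A : H -> H :=
  fun x => \sum_(i < size p) (p`_i)%:C *: iter i A x.

(* [B = f(A)], for A selfadjoint and f continuous on the spectrum of A: the
   continuous functional calculus is the isometric extension to C(sp(A)) of
   p |-> p(A), so f(A) is the norm limit of the p(A) along real polynomials p
   converging to f uniformly on the spectrum. *)
Definition is_cfc (f : R -> R) A B : Prop :=
  bounded_operator B /\
  forall e : R, 0 < e -> exists p : {poly R},
    (forall t : R, spectrum A t%:C -> `|p.[t] - f t| <= e) /\
    (forall x, `|poly_op p A x - B x| <= e%:C * `|x|).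

Definition cfc (f : R -> R) A : H -> H := xget 0 [set B | is_cfc f A B].

Definition op_pow A (s : R) : H -> H := cfc (fun x => x `^ s) A.

Definition arith_mean (t : R) A B : H -> H := (1 - t)%:C *: A + t%:C *: B.

Definition harm_mean (t : R) A B : H -> H :=
  op_inv ((1 - t)%:C *: op_inv A + t%:C *: op_inv B).

Definition geom_mean (t : R) A B : H -> H :=
  op_pow A 2^-1
    \o op_pow (op_pow A (- 2^-1) \o B \o op_pow A (- 2^-1)) t
    \o op_pow A 2^-1.

Definition op_decreases_to (X : nat -> H -> H) A : Prop :=
  (forall n, op_le (X n.+1) (X n)) /\
  (forall x, (fun n => X n x) @ \oo --> A x).

(* A binary operation on B(H)^+ is represented by a binary function on all of
   [H -> H] preserving positivity; its other values are irrelevant. *)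
Record operator_connection (sigma : (H -> H) -> (H -> H) -> (H -> H)) : Prop := {
  connection_pos : forall A B, positive A -> positive B -> positive (sigma A B);
  connection_mono : forall A B C D,
    positive A -> positive B -> positive C -> positive D ->
    op_le A C -> op_le B D -> op_le (sigma A B) (sigma C D);
  connection_transformer : forall A B C,
    positive A -> positive B -> positive C ->
    op_le (C \o sigma A B \o C) (sigma (C \o A \o C) (C \o B \o C));
  connection_cont : forall (X Y : nat -> H -> H) A B,
    (forall n, positive (X n)) -> (forall n, positive (Y n)) ->
    positive A -> positive B ->
    op_decreases_to X A -> op_decreases_to Y B ->
    op_decreases_to (fun n => sigma (X n) (Y n)) (sigma A B)
}.

Definition operator_mean sigma : Prop :=
  operator_connection sigma /\ forall A, positive A -> sigma A A = A.

Definition symmetric_mean sigma : Prop :=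
  operator_mean sigma /\
  forall A B, positive A -> positive B -> sigma A B = sigma B A.

Definition differs_from_arith sigma : Prop :=
  exists A B, [/\ positive A, positive B & sigma A B <> arith_mean 2^-1 A B].

End Operators.

Definition operator_monotone (R : realType) (I : set R) (f : R -> R) : Prop :=
  forall (H : hilbertType R) (A B : H -> H),
    selfadjoint A -> selfadjoint B ->
    spectrum A `<=` (fun t : R => t%:C) @` I ->
    spectrum B `<=` (fun t : R => t%:C) @` I ->
    op_le A B -> op_le (cfc f A) (cfc f B).

(* Main.v *)
Require Import Defs.
From HB Require Import structures.
From mathcomp Require Import all_boot all_order all_algebra sesquilinear.
From mathcomp Require Import all_classical all_reals all_analysis.
From mathcomp.real_closed Require Import complex.
From mathcomp Require Import ring lra.
Import Order.TTheory GRing.Theory Num.Theory.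
Import numFieldNormedType.Exports.

(** The pivot is monotonicity of f on the given space H, [monotone_on H f].

    On the positive side, a positive operator monotone function is operator
    concave ([monotone_concave]): a rotation of diag(A, B) has the weighted
    arithmetic mean as a diagonal block and lies below a block diagonal operator
    whose blocks are that mean, slightly enlarged, and a large scalar.  Since
    the conjugate 1 / f(1 / t) is monotone too, its concavity read through
    inversion is the harmonic inequality f(A ! B) <= f(A) ! f(B).  The harmonic mean
    lies below the geometric mean ([harm_le_geom]) and below every symmetric
    mean ([harm_le_mean]), which gives all the other inequalities.

    Conversely, a positive concave function is monotone: A + D is the midpoint of A
    and A + 2 D, and iterating concavity towards infinity leaves
    f(A) <= f(A + D) because f >= 0 there ([midconcave_monotone]).  For the
    inequalities f(A ! B) <= f(A) tau f(B) put g(t) = f(1 / t), so that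
    g at the arithmetic mean is at most g(A) tau g(B).  As tau lies below the
    arithmetic mean, g is operator convex at midpoints, and the same iteration
    shows that g is antitone, provided that g is bounded at infinity.  Convexity
    alone does not bound g; one uses that tau differs from the arithmetic mean.
    On two operators of rank one up to scalars, with one large eigenvalue G in
    slightly different directions, tau has slope r < 1 in G however close
    the directions are ([damped]), whereas their arithmetic mean has an eigenvalue
    close to G.  So g(a + mu l) <= r g(a + l) + C for all mu < 1, which with
    the moderate growth of convex functions bounds g ([growth_bounded],
    [mean_inequality_bounded]).

    The geometric mean is damped by an explicit estimate ([geom_damped]).  For a
    symmetric mean sigma ([mean_damped]) everything is read off the axioms:
    sigma acts on common eigenvectors through a mean of nonnegative numbers, and
    the transformer inequality gives
    sigma(A, B) >= phi0 (A + B), with phi0 the number 1 sigma 0; so phi0 < 1 / 2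
    unless sigma is the arithmetic mean, and phi0 governs the slope in G.

    A symmetric mean other than the arithmetic one exists: the harmonic mean,
    extended to all positive operators by the variational formula of the
    parallel sum ([harmonic_mean_symmetric]).

    Functional calculus is developed from polynomials: the infimum of the form
    of p(A) belongs to its spectrum, so p >= 0 on the spectrum of A implies
    p(A) >= 0, and Weierstrass approximation does the rest. *)

Set Implicit Arguments.
Unset Strict Implicit.
Unset Printing Implicit Defensive.
Local Open Scope classical_set_scope.
Local Open Scope complex_scope.
Local Open Scope ring_scope.
Local Notation Re := complex.Re.
Local Notation Im := complex.Im.

(** * The real inner product and bounded operators *)

(** Order, norm and selfadjointness are governed by the real part of the inner
    product; it is a symmetric real bilinear form, so that statements about
    operators become polynomial inequalities between real numbers. *)
Definition dotr (R : realType) (H : hilbertType R) (x y : H) : R :=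
  Re (inner H x y).
Definition nrm (R : realType) (H : hilbertType R) (x : H) : R :=
  Num.sqrt (dotr x x).
Local Notation "''[' x , y ]" := (dotr x y) (format "''[' x ,  y ]").

Section Hilbert.
Context {R : realType} {H : hilbertType R}.
Implicit Types (x y z : H) (r s : R) (c : R[i]).

Lemma innerDl x y z : inner H (x + y) z = inner H x z + inner H y z.
Proof. exact: linearDl. Qed.
Lemma innerDr x y z : inner H x (y + z) = inner H x y + inner H x z.
Proof. exact: linearDr. Qed.
Lemma innerZl c x y : inner H (c *: x) y = c * inner H x y.
Proof. exact: linearZl_LR. Qed.
Lemma innerZr c x y : inner H x (c *: y) = Num.conj c * inner H x y.
Proof. exact: linearZr_LR. Qed.
Lemma innerC x y : inner H x y = Num.conj (inner H y x).
Proof. by rewrite hermC expr0 mul1r. Qed.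

Lemma rec_add (a b : R[i]) : Re (a + b) = Re a + Re b.
Proof. by case: a; case: b. Qed.
Lemma rec_scale r (a : R[i]) : Re (r%:C * a) = r * Re a.
Proof. by case: a => a b /=; rewrite mul0r subr0. Qed.
Lemma rec_conj (a : R[i]) : Re (Num.conj a) = Re a.
Proof. by case: a. Qed.
Lemma imc_conj (a : R[i]) : Im (Num.conj a) = - Im a.
Proof. by case: a. Qed.
Lemma conj_real r : Num.conj (r%:C) = r%:C :> R[i].
Proof. exact: conjc_real. Qed.

Lemma dotC x y : '[x, y] = '[y, x].
Proof. by rewrite /dotr innerC rec_conj. Qed.
Lemma dotDl x y z : '[x + y, z] = '[x, z] + '[y, z].
Proof. by rewrite /dotr innerDl rec_add. Qed.
Lemma dotDr x y z : '[x, y + z] = '[x, y] + '[x, z].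
Proof. by rewrite /dotr innerDr rec_add. Qed.
Lemma dotZl r x y : '[r%:C *: x, y] = r * '[x, y].
Proof. by rewrite /dotr innerZl rec_scale. Qed.
Lemma dotZr r x y : '[x, r%:C *: y] = r * '[x, y].
Proof. by rewrite dotC dotZl dotC. Qed.
Lemma dotNl x y : '[- x, y] = - '[x, y].
Proof. by rewrite -scaleN1r (_ : -1 = (-1)%:C) ?dotZl ?mulN1r // rmorphN1. Qed.
Lemma dotNr x y : '[x, - y] = - '[x, y].
Proof. by rewrite dotC dotNl dotC. Qed.
Lemma dotBl x y z : '[x - y, z] = '[x, z] - '[y, z].
Proof. by rewrite dotDl dotNl. Qed.
Lemma dotBr x y z : '[x, y - z] = '[x, y] - '[x, z].
Proof. by rewrite dotDr dotNr. Qed.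
Lemma dot0l y : '[0, y] = 0.
Proof. by rewrite -(subrr y) dotBl subrr. Qed.
Lemma dot0r y : '[y, 0] = 0.
Proof. by rewrite dotC dot0l. Qed.

Lemma inner_dotr x : inner H x x = '[x, x]%:C.
Proof.
by rewrite RRe_real // inner_norm ger0_real // exprn_ge0.
Qed.
Lemma dot_ge0 x : 0 <= '[x, x].
Proof. by rewrite -(@lecR R) -inner_dotr inner_norm exprn_ge0. Qed.
Lemma norm_nrm x : `|x| = (nrm x)%:C.
Proof.
have n0 := normr_ge0 x.
apply: (@pexpIrn _ 2) => //; rewrite ?nnegrE ?ler0c ?sqrtr_ge0 //.
rewrite -inner_norm inner_dotr -[RHS]rmorphXn /= sqr_sqrtr //.
exact: dot_ge0.
Qed.
Lemma nrm_ge0 x : 0 <= nrm x. Proof. exact: sqrtr_ge0. Qed.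
Lemma nrm_sqr x : nrm x ^+ 2 = '[x, x].
Proof. by rewrite sqr_sqrtr // dot_ge0. Qed.
Lemma nrm_eq0 x : nrm x = 0 -> x = 0.
Proof. by move=> n0; apply/normr0_eq0; rewrite norm_nrm n0. Qed.
Lemma dot_eq0 x : '[x, x] = 0 -> x = 0.
Proof. by move=> d0; apply: nrm_eq0; rewrite /nrm d0 sqrtr0. Qed.
Lemma dot_gt0 x : x != 0 -> 0 < '[x, x].
Proof.
move=> x0; rewrite lt_neqAle dot_ge0 andbT eq_sym.
by apply: contra x0 => /eqP /dot_eq0 ->.
Qed.
Lemma nrm0 : nrm (0 : H) = 0. Proof. by rewrite /nrm dot0l sqrtr0. Qed.
Lemma nrm_le x r : 0 <= r -> (nrm x <= r) = ('[x, x] <= r ^+ 2).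
Proof.
by move=> r0; rewrite -nrm_sqr ler_pXn2r // nnegrE nrm_ge0.
Qed.
Lemma nrmD x y : nrm (x + y) <= nrm x + nrm y.
Proof.
by have := ler_normD x y; rewrite !norm_nrm -rmorphD lecR.
Qed.
Lemma nrmN x : nrm (- x) = nrm x.
Proof. by rewrite /nrm dotNl dotNr opprK. Qed.
Lemma nrmB x y : nrm (x - y) = nrm (y - x).
Proof. by rewrite -nrmN opprB. Qed.
Lemma nrmZ r x : 0 <= r -> nrm (r%:C *: x) = r * nrm x.
Proof.
move=> r0; rewrite /nrm dotZl dotZr mulrA -expr2 sqrtrM ?sqr_ge0 //.
by rewrite sqrtr_sqr ger0_norm.
Qed.
Lemma eq_dot x y : (forall z, '[x, z] = '[y, z]) -> x = y.
Proof.
move=> e; apply/eqP; rewrite -subr_eq0; apply/eqP/dot_eq0.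
by rewrite dotBl e subrr.
Qed.

Lemma quad_disc (a b c : R) : 0 <= a ->
  (forall t : R, 0 <= a * t ^+ 2 + 2 * b * t + c) -> b ^+ 2 <= a * c.
Proof.
move=> a0 h; have [a_eq|ane] := eqVneq a 0.
  have [->|bne] := eqVneq b 0; first by rewrite a_eq expr0n /= mul0r.
  have := h (- (c + 1) / (2 * b)).
  rewrite a_eq mul0r add0r (_ : _ + c = -1); last by field.
  by rewrite ler0N1.
have ap : 0 < a by rewrite lt_neqAle eq_sym ane.
have := h (- b / a).
rewrite (_ : _ + c = (a * c - b ^+ 2) / a); last by field.
by rewrite pmulr_lge0 ?invr_gt0 // subr_ge0.
Qed.

Lemma dot_CS x y : '[x, y] ^+ 2 <= '[x, x] * '[y, y].
Proof.
apply: quad_disc; first exact: dot_ge0.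
move=> t; have := dot_ge0 (t%:C *: x + y).
rewrite !(dotDl, dotDr, dotZl, dotZr) [dotr y x]dotC.
by congr (0 <= _); ring.
Qed.
Lemma dot_CSn x y : `|'[x, y]| <= nrm x * nrm y.
Proof.
rewrite -(@ler_pXn2r _ 2) ?nnegrE ?mulr_ge0 ?nrm_ge0 //.
by rewrite real_normK ?num_real // exprMn !nrm_sqr dot_CS.
Qed.

Section Linear.
Variables (K : hilbertType R) (A : H -> K).
Hypothesis hA : linear A.
Lemma linA_D x y : A (x + y) = A x + A y.
Proof. by rewrite -{1}(scale1r x) hA scale1r. Qed.
Lemma linA_0 : A 0 = 0.
Proof. by apply: (addrI (A 0)); rewrite -linA_D !addr0. Qed.
Lemma linA_Z c x : A (c *: x) = c *: A x.
Proof. by rewrite -{1}(addr0 (c *: x)) hA linA_0 addr0. Qed.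
Lemma linA_N x : A (- x) = - A x.
Proof. by rewrite -scaleN1r linA_Z scaleN1r. Qed.
Lemma linA_B x y : A (x - y) = A x - A y.
Proof. by rewrite linA_D linA_N. Qed.
Lemma linA_sum (I : Type) (s : seq I) (F : I -> H) :
  A (\sum_(i <- s) F i) = \sum_(i <- s) A (F i).
Proof.
elim: s => [|i s IH]; first by rewrite !big_nil linA_0.
by rewrite !big_cons linA_D IH.
Qed.
End Linear.

Lemma bopP (A : H -> H) : bounded_operator A <->
  linear A /\ exists2 K : R, 0 <= K & forall x, nrm (A x) <= K * nrm x.
Proof.
split=> -[lA [K hK]]; split=> //.
  exists (Num.max 0 K) => [|x]; first by rewrite le_max lexx.
  have := hK x; rewrite !norm_nrm -rmorphM lecR => /le_trans; apply.
  by rewrite ler_wpM2r ?nrm_ge0 // le_max lexx orbT.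
by exists K => x; rewrite !norm_nrm -rmorphM lecR.
Qed.

Lemma bop_lin (A : H -> H) : bounded_operator A -> linear A.
Proof. by case. Qed.

Lemma bop_comp (A B : H -> H) : bounded_operator A -> bounded_operator B ->
  bounded_operator (A \o B).
Proof.
move=> /bopP[lA [K K0 hK]] /bopP[lB [L L0 hL]]; apply/bopP; split.
  by move=> c x y /=; rewrite lB lA.
exists (K * L) => [|x /=]; first exact: mulr_ge0.
by apply: le_trans (hK _) _; rewrite -mulrA ler_wpM2l.
Qed.
Lemma bop_add (A B : H -> H) : bounded_operator A -> bounded_operator B ->
  bounded_operator (A + B).
Proof.
move=> /bopP[lA [K K0 hK]] /bopP[lB [L L0 hL]]; apply/bopP; split.
  by move=> c x y; rewrite !fctE lB lA scalerDr addrACA.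
exists (K + L) => [|x /=]; first exact: addr_ge0.
by apply: le_trans (nrmD _ _) _; rewrite mulrDl lerD.
Qed.
Lemma nrmZc c x : nrm (c *: x) = Re `|c| * nrm x.
Proof.
by have := normrZ c x; rewrite !norm_nrm => /(congr1 (@Re R)) /= ->; rewrite mul0r subr0.
Qed.
Lemma Renorm_ge0 c : 0 <= Re `|c|.
Proof. by rewrite -(@lecR R) RRe_real ?normr_ge0 // ger0_real. Qed.
Lemma bop_scale c (A : H -> H) : bounded_operator A -> bounded_operator (c *: A).
Proof.
move=> /bopP[lA [K K0 hK]]; apply/bopP; split.
  by move=> d x y; rewrite !fctE lA scalerDr !scalerA mulrC.
exists (Re `|c| * K) => [|x /=]; first by rewrite mulr_ge0 ?Renorm_ge0.
by rewrite nrmZc -mulrA ler_wpM2l ?Renorm_ge0.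
Qed.
Lemma bop_sub (A B : H -> H) : bounded_operator A -> bounded_operator B ->
  bounded_operator (A - B).
Proof.
move=> hA hB; have -> : A - B = A + (-1) *: B by rewrite scaleN1r.
exact/bop_add/bop_scale.
Qed.
Lemma bop_id : bounded_operator (@idfun H).
Proof.
by apply/bopP; split=> //; exists 1 => // x; rewrite mul1r.
Qed.
Lemma bop_0 : bounded_operator (0 : H -> H).
Proof.
apply/bopP; split; first by move=> c x y; rewrite [RHS](_ : _ = c *: 0 + 0) ?scaler0 ?addr0.
by exists 0 => // x; rewrite mul0r [X in nrm X](_ : _ = 0) ?nrm0.
Qed.

Lemma dot_i x y : '['i *: x, y] = - Im (inner H x y).
Proof.
by rewrite /dotr innerZl; case: (inner H x y) => a b /=; ring.
Qed.

(** The imaginary part of an inner product is the real part of another one,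
    taken at i x. *)
Lemma saP (A : H -> H) : bounded_operator A ->
  (forall x y, '[A x, y] = '[x, A y]) -> selfadjoint A.
Proof.
move=> bA h; split=> // x y; apply/eqP; rewrite eq_complex; apply/andP; split.
  exact/eqP/h.
rewrite -eqr_opp -!dot_i; apply/eqP.
by rewrite -(linA_Z (bop_lin bA)) h.
Qed.
Lemma sa_dot (A : H -> H) x y : selfadjoint A -> '[A x, y] = '[x, A y].
Proof. by case=> _ h; rewrite /dotr h. Qed.
Lemma sa_bop (A : H -> H) : selfadjoint A -> bounded_operator A.
Proof. by case. Qed.
Lemma sa_lin (A : H -> H) : selfadjoint A -> linear A.
Proof. by case=> -[]. Qed.

Lemma selfadjoint_sub (A B : H -> H) :
  selfadjoint A -> selfadjoint B -> selfadjoint (A - B).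
Proof.
move=> sA sB; apply: saP => [|x y]; first exact/bop_sub/sa_bop/sB/sa_bop/sA.
by rewrite !fctE dotBl dotBr !sa_dot.
Qed.
Lemma selfadjoint_add (A B : H -> H) :
  selfadjoint A -> selfadjoint B -> selfadjoint (A + B).
Proof.
move=> sA sB; apply: saP => [|x y]; first exact/bop_add/sa_bop/sB/sa_bop/sA.
by rewrite !fctE dotDl dotDr !sa_dot.
Qed.
Lemma selfadjoint_scale r (A : H -> H) : selfadjoint A -> selfadjoint (r%:C *: A).
Proof.
move=> sA; apply: saP => [|x y]; first exact/bop_scale/sa_bop/sA.
by rewrite !fctE dotZl dotZr !sa_dot.
Qed.
Lemma selfadjoint_id : selfadjoint (@idfun H).
Proof. by apply: saP => //; exact: bop_id. Qed.
Lemma selfadjoint_conj (A C : H -> H) :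
  selfadjoint A -> selfadjoint C -> selfadjoint (C \o A \o C).
Proof.
move=> sA sC; apply: saP => [|x y].
  exact/bop_comp/sa_bop/sC/bop_comp/sa_bop/sA/sa_bop/sC.
by rewrite /= !sa_dot.
Qed.
Definition scal (r : R) : H -> H := fun x => r%:C *: x.
Lemma selfadjoint_scal r : selfadjoint (scal r).
Proof. exact: (selfadjoint_scale r selfadjoint_id). Qed.

(** The form of a positive operator has no imaginary part; polarizing this
    at x + i y gives the symmetry of the real form. *)
Lemma positiveP (A : H -> H) : positive A <-> selfadjoint A /\ forall x, 0 <= '[A x, x].
Proof.
split=> [[bA pA]|[[bA sA] pA]]; last first.
  split=> // x; rewrite lecE /= pA andbT; apply/eqP.
  have := congr1 (@Im R) (sA x x); rewrite [in RHS]innerC imc_conj => h.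
  by lra.
split=> [|x]; last by have := pA x; rewrite lecE => /andP[].
have lA := bop_lin bA.
apply: saP => // x y.
have im0 (z : H) : '['i *: A z, z] = 0.
  by rewrite dot_i; have := pA z; rewrite lecE => /andP[/eqP -> _]; rewrite oppr0.
have dotii (u v : H) : '['i *: u, 'i *: v] = '[u, v].
  rewrite /dotr innerZl innerZr.
  by case: (inner H u v) => a b /=; ring.
have dotin (u v : H) : '['i *: ('i *: u), v] = - '[u, v].
  by rewrite scalerA -expr2 sqr_i scaleN1r dotNl.
have := im0 (x + 'i *: y); rewrite !(linA_D lA, linA_Z lA).
rewrite scalerDr !(dotDl, dotDr) im0 dotii dotin.
have -> : '['i *: ('i *: A y), 'i *: y] = 0 by rewrite dotii im0.
by rewrite [dotr (A y) x]dotC => h; lra.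
Qed.
Lemma pos_sa (A : H -> H) : positive A -> selfadjoint A.
Proof. by case/positiveP. Qed.
Lemma pos_ge0 (A : H -> H) x : positive A -> 0 <= '[A x, x].
Proof. by case/positiveP. Qed.

Lemma positive_scale (r : R) (A : H -> H) : 0 <= r -> positive A -> positive (r%:C *: A).
Proof.
move=> r0 /positiveP[sA pA]; apply/positiveP; split=> [|x]; first exact: selfadjoint_scale.
by rewrite [(_ *: A) x](_ : _ = r%:C *: A x) // dotZl mulr_ge0.
Qed.
Lemma positive_add (A B : H -> H) : positive A -> positive B -> positive (A + B).
Proof.
move=> /positiveP[sA pA] /positiveP[sB pB]; apply/positiveP.
split=> [|x]; first exact: selfadjoint_add.
by rewrite [(A + B) x](_ : _ = A x + B x) // dotDl addr_ge0.
Qed.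
Lemma pos_id : positive (@idfun H).
Proof. by apply/positiveP; split=> [|x]; [exact: selfadjoint_id|exact: dot_ge0]. Qed.
Lemma positive_scal (r : R) : 0 <= r -> positive (scal r).
Proof. by move=> r0; apply: (positive_scale r0 pos_id). Qed.
Lemma positive_conj (A C : H -> H) : positive A -> selfadjoint C -> positive (C \o A \o C).
Proof.
move=> /positiveP[sA pA] sC; apply/positiveP; split=> [|x]; first exact: selfadjoint_conj.
by rewrite /= (sa_dot _ _ sC).
Qed.

Lemma op_leP (A B : H -> H) : selfadjoint A -> selfadjoint B ->
  (op_le A B <-> forall x, '[A x, x] <= '[B x, x]).
Proof.
move=> sA sB; split=> [/positiveP[_ h] x|h].
  by have := h x; rewrite !fctE dotBl subr_ge0.
apply/positiveP; split; first exact: selfadjoint_sub.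
by move=> x; rewrite !fctE dotBl subr_ge0.
Qed.

Lemma inner_form (A : H -> H) x : selfadjoint A -> inner H (A x) x = ('[A x, x])%:C.
Proof.
move=> sA; apply/eqP; rewrite eq_complex /= eqxx /=.
have := congr1 (@Im R) (sA.2 x x); rewrite [in RHS]innerC imc_conj => h.
by apply/eqP; lra.
Qed.
Lemma inner_unit (v : H) : inner H v v = 1 -> '[v, v] = 1. Proof. by rewrite /dotr => ->. Qed.
Lemma unit_inner (v : H) : '[v, v] = 1 -> inner H v v = 1.
Proof. by move=> h; rewrite inner_dotr h. Qed.
Lemma normalize (v : H) : v != 0 -> exists2 u, inner H u u = 1 & v = (nrm v)%:C *: u.
Proof.
move=> v0; have n0 : nrm v != 0 by apply: contra v0 => /eqP/nrm_eq0/eqP.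
exists ((nrm v)^-1%:C *: v); last by rewrite scalerA -rmorphM mulfV // scale1r.
apply: unit_inner; rewrite dotZl dotZr -nrm_sqr mulrA -expr2 -exprMn mulVf // expr1n.
by [].
Qed.

Lemma unit_neq0 (v : H) : inner H v v = 1 -> v != 0.
Proof.
move=> v1; apply/eqP => v0; have := inner_unit v1; rewrite v0 dot0l => /eqP.
by rewrite eq_sym oner_eq0.
Qed.
Lemma nrmC_neq0 (v : H) : v != 0 -> (nrm v)%:C != 0 :> R[i].
Proof. by apply: contra; rewrite (_ : 0 = 0%:C) // => /eqP/complexI/nrm_eq0/eqP. Qed.
Lemma inner_orthonormal (e1 e2 : H) (a b a' b' : R) :
  inner H e1 e1 = 1 -> inner H e2 e2 = 1 -> inner H e1 e2 = 0 ->
  inner H (a%:C *: e1 + b%:C *: e2) (a'%:C *: e1 + b'%:C *: e2) = (a * a' + b * b')%:C.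
Proof.
move=> e11 e22 e12; rewrite !(innerDl, innerDr, innerZl, innerZr, conj_real) (innerC e2 e1).
by rewrite e11 e22 e12 rmorph0 !mulr0 addr0 add0r !mulr1 -!rmorphM -rmorphD.
Qed.

Lemma sa_eq (A B : H -> H) : selfadjoint A -> selfadjoint B ->
  (forall x, '[A x, x] = '[B x, x]) -> A = B.
Proof.
move=> sA sB h; apply/funext => x; apply: eq_dot => y.
have := h (x + y); rewrite !(linA_D (sa_lin sA), linA_D (sa_lin sB)).
rewrite !(dotDl, dotDr) !h (sa_dot y x sA) (sa_dot y x sB) !(dotC y) => e.
lra.
Qed.

Lemma pos_CS (A : H -> H) x y : positive A ->
  '[A x, y] ^+ 2 <= '[A x, x] * '[A y, y].
Proof.
case/positiveP=> sA pA; apply: quad_disc; first exact: pA.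
move=> t; have := pA (t%:C *: x + y).
rewrite (linA_D (sa_lin sA)) (linA_Z (sa_lin sA)).
rewrite !(dotDl, dotDr, dotZl, dotZr) (sa_dot y x sA) (dotC y).
by congr (0 <= _); ring.
Qed.
Lemma pos_kernel (A : H -> H) x : positive A -> '[A x, x] = 0 -> A x = 0.
Proof.
move=> pA h; apply: dot_eq0; have := pos_CS x (A x) pA.
rewrite h mul0r => h2; apply/eqP; rewrite -sqrf_eq0.
by rewrite eq_le h2 sqr_ge0.
Qed.
(** A^2 <= K A as soon as 0 <= A <= K, by Cauchy-Schwarz for the form of A between
    x and A x.  This is how bounds on forms become bounds on norms. *)
Lemma pos_sqr_le (A : H -> H) (K : R) x : positive A ->
  (forall y, '[A y, y] <= K * '[y, y]) -> '[A x, A x] <= K * '[A x, x].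
Proof.
move=> pA hK; have [-> | Ax0] := eqVneq (A x) 0; first by rewrite !dot0l mulr0.
have p := dot_gt0 Ax0; rewrite -(ler_pM2r p) -expr2.
apply: le_trans (pos_CS x (A x) pA) _.
by rewrite [K * _]mulrC -mulrA ler_wpM2l ?pos_ge0.
Qed.

Lemma sa_bounds (A : H -> H) : selfadjoint A ->
  exists2 K : R, 0 < K & forall x, - K * '[x, x] <= '[A x, x] <= K * '[x, x].
Proof.
move=> sA; have /bopP[lA [K K0 hK]] := sa_bop sA.
exists (K + 1) => [|x]; first by rewrite ltr_wpDl.
rewrite mulNr -ler_norml; apply: le_trans (dot_CSn _ _) _.
rewrite -nrm_sqr expr2 mulrA ler_wpM2r ?nrm_ge0 //.
apply: le_trans (hK x) _; rewrite ler_wpM2r ?nrm_ge0 //; lra.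
Qed.

(** The norm of H has complex values, so that completeness and convergence are
    restated for the real norm. *)
Lemma hilbert_complete (u : nat -> H) :
  (forall e : R, 0 < e -> exists N, forall n m, (N <= n)%N -> (N <= m)%N ->
     nrm (u n - u m) <= e) ->
  exists l, forall e : R, 0 < e -> exists N, forall n, (N <= n)%N -> nrm (u n - l) <= e.
Proof.
move=> hu; have : cvg (u @ \oo).
  apply/cauchy_cvgP/cauchy_ballP => e e0.
  have e1 : 0 < Re e / 2.
    by rewrite divr_gt0 //; move: e0; rewrite ltcE => /andP[].
  have [N hN] := hu _ e1.
  exists (u @` [set n | (N <= n)%N], u @` [set n | (N <= n)%N]).
    by split; exists N => // n hn; exists n.
  move=> [_ _] [/= [n hn <-] [m hm <-]]; rewrite -ball_normE /= norm_nrm.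
  move: e0; rewrite !ltcE /= => /andP[-> e0] /=.
  by apply: le_lt_trans (hN _ _ hn hm) _; lra.
case/cvg_ex => l /cvgrPdist_le hl; exists l => e e0.
have : 0 < e%:C :> R[i] by rewrite ltcR.
move=> /hl[N _ hN]; exists N => n /hN /=.
by rewrite norm_nrm lecR nrmB.
Qed.

Lemma hilbert_cvgP (u : nat -> H) l : (u @ \oo --> l) <->
  forall e : R, 0 < e -> exists N, forall n, (N <= n)%N -> nrm (u n - l) <= e.
Proof.
split=> [/cvgrPdist_le hl e e0|h].
  have : 0 < e%:C :> R[i] by rewrite ltcR.
  move=> /hl[N _ hN]; exists N => n /hN /=.
  by rewrite norm_nrm lecR nrmB.
apply/cvgrPdist_le => e; rewrite ltcE => /andP[/eqP i0 e0].
have [N hN] := h _ e0; exists N => // n /= hn.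
by rewrite norm_nrm lecE /= i0 eqxx /= nrmB hN.
Qed.
End Hilbert.

(** [vec] proves an identity between real linear combinations of vectors by
    pairing both sides with an arbitrary vector. *)
Ltac vec := apply: eq_dot => ?; rewrite ?(dotDl, dotBl, dotNl, dotZl, dot0l); ring.
Ltac dots := rewrite ?(dotDl, dotDr, dotNl, dotNr, dotZl, dotZr, dot0l, dot0r).

(** * Limits and inverses *)

Section Real.
Context {R : realType}.
Implicit Types (a b c e k : R).

Lemma le0_eps a : (forall e, 0 < e -> a <= e) -> a <= 0.
Proof.
by move=> h; apply/ler_addgt0Pl => e e0; rewrite addr0 h.
Qed.
Lemma le_eps a b K : (forall e, 0 < e -> a <= b + K * e) -> a <= b.
Proof.
move=> h; rewrite -subr_le0; apply: le0_eps => e e0.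
have K1 : 0 < `|K| + 1 by rewrite ltr_wpDl.
have := h (e / (`|K| + 1)) (divr_gt0 e0 K1).
suff : K * (e / (`|K| + 1)) <= e by move=> h1 h2; lra.
rewrite mulrA ler_pdivrMr // mulrC ler_pM2l //.
by have := ler_norm K; lra.
Qed.
Lemma expr_small k e : 0 <= k -> k < 1 -> 0 < e ->
  exists N, forall n, (N <= n)%N -> k ^+ n <= e.
Proof.
move=> k0 k1 e0.
have /cvgrPdist_le/(_ _ e0)[N _ hN] : (fun n => k ^+ n) @ \oo --> (0 : R).
  by apply: cvg_expr; rewrite ger0_norm.
exists N => n /hN /=; rewrite sub0r normrN ger0_norm ?exprn_ge0 //.
Qed.
Lemma inv_small c e : 0 < e -> exists N, forall n, (N <= n)%N -> n.+1%:R^-1 * c <= e.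
Proof.
move=> e0; have c0 : 0 <= `|c| / e by rewrite divr_ge0 // ltW.
exists (Num.bound (`|c| / e)) => n hn.
rewrite mulrC ler_pdivrMr // mulrC -ler_pdivrMr //.
apply: (@le_trans _ _ (`|c| / e)); first by rewrite ler_pM2r ?invr_gt0 // ler_norm.
by apply: le_trans (ltW (archi_boundP c0)) _; rewrite ler_nat (leq_trans hn).
Qed.
End Real.

Section StrongLimits.
Context {R : realType} {H : hilbertType R}.
Implicit Types (T : H -> H) (X : nat -> H -> H) (x y : H).

Lemma vec_eps x y (K : R) : (forall e : R, 0 < e -> nrm (x - y) <= K * e) -> x = y.
Proof.
move=> h; apply/eqP; rewrite -subr_eq0; apply/eqP/nrm_eq0/eqP.
rewrite eq_le nrm_ge0 andbT; apply: (@le_eps _ _ _ K) => e e0; rewrite add0r; exact: h.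
Qed.

Lemma dot_limit (u : nat -> H) l y : (u @ \oo --> l) -> (fun n => '[u n, y]) @ \oo --> '[l, y].
Proof.
move=> /hilbert_cvgP hu; apply/cvgrPdist_le => e e0.
have n1 : 0 < nrm y + 1 by rewrite ltr_wpDl // nrm_ge0.
have [N hN] := hu _ (divr_gt0 e0 n1); exists N => // n /= Nn.
rewrite -dotBl; apply: le_trans (dot_CSn _ _) _; rewrite nrmB.
apply: le_trans (ler_wpM2r (nrm_ge0 y) (hN n Nn)) _.
rewrite mulrAC ler_pdivrMr // ler_pM2l //; lra.
Qed.
Arguments dot_limit [u l] y _.

(** A uniform bound is required of the X n because it is what bounds T: the
    limit is only pointwise. *)
Lemma selfadjoint_limit X T (K : R) : 0 <= K -> (forall n, selfadjoint (X n)) ->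
  (forall n x, nrm (X n x) <= K * nrm x) -> (forall x, (fun n => X n x) @ \oo --> T x) ->
  selfadjoint T.
Proof.
move=> K0 sX hK lim; apply: saP => [|x y].
  apply/bopP; split.
    move=> c x y; apply: (cvg_unique (@norm_hausdorff _ H) (lim (c *: x + y))).
    rewrite (_ : (fun n => _) = (fun n => c *: X n x + X n y)); last first.
      by apply/funext => n; rewrite (sa_lin (sX n)).
    by apply: cvgD (lim y); apply: cvgZr; exact: lim.
  exists K => // x; apply: (@le_eps _ _ _ 1) => e e0.
  have /hilbert_cvgP/(_ _ e0)[N hN] := lim x; rewrite mul1r.
  rewrite (_ : T x = X N x - (X N x - T x)); last by vec.
  by apply: le_trans (nrmD _ _) _; rewrite nrmN lerD ?hN.
rewrite [RHS]dotC -(cvg_lim (@Rhausdorff R) (dot_limit y (lim x))).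
rewrite -(cvg_lim (@Rhausdorff R) (dot_limit x (lim y))); congr (limn _).
by apply/funext => n; rewrite [RHS]dotC (sa_dot _ _ (sX n)).
Qed.
End StrongLimits.
Arguments dot_limit {R H} [u l] y _.

Section Inverse.
Context {R : realType} {H : hilbertType R}.
Implicit Types (x y z : H) (A B T : H -> H) (m M : R).

(** m 1 <= A <= M 1: for a selfadjoint operator this places the spectrum in
    [m, M], and it is the form in which spectral hypotheses are carried. *)
Definition bd m M A : Prop := selfadjoint A /\
  forall x, m * '[x, x] <= '[A x, x] <= M * '[x, x].

Lemma bd_sa m M A : bd m M A -> selfadjoint A. Proof. by case. Qed.
Lemma bd_pos m M A : bd m M A -> 0 <= m -> positive A.
Proof.
case=> sA h m0; apply/positiveP; split=> // x; have /andP[+ _] := h x.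
by apply: le_trans; rewrite mulr_ge0 ?dot_ge0.
Qed.
Lemma bd_weaken m M m' M' A : bd m M A -> m' <= m -> M <= M' -> bd m' M' A.
Proof.
case=> sA h hm hM; split=> // x; have /andP[h1 h2] := h x; apply/andP; split.
  by apply: le_trans h1; rewrite ler_wpM2r ?dot_ge0.
by apply: le_trans h2 _; rewrite ler_wpM2r ?dot_ge0.
Qed.
Lemma bd_upper m A : selfadjoint A -> (forall x, m * '[x, x] <= '[A x, x]) ->
  exists2 M, Num.max 1 m <= M & bd m M A.
Proof.
move=> sA h; have [K K0 hK] := sa_bounds sA.
have h1 : K <= Num.max (Num.max 1 m) K by rewrite le_max lexx orbT.
exists (Num.max (Num.max 1 m) K); first by rewrite le_max lexx.
split=> // x; rewrite h /=; have /andP[_ h2] := hK x.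
by apply: le_trans h2 _; rewrite ler_wpM2r ?dot_ge0.
Qed.

(** Banach iteration for x |-> T x + y, that is, the Neumann series of 1 - T. *)
Lemma contraction_solve T k y : linear T -> 0 <= k -> k < 1 ->
  (forall x, nrm (T x) <= k * nrm x) -> exists x, x = T x + y.
Proof.
move=> lT k0 k1 hT.
pose u n := iter n (fun x => T x + y) 0.
have uS n : u n.+1 = T (u n) + y by [].
have ub n : nrm (u n) <= nrm y / (1 - k).
  elim: n => [|n IH]; first by rewrite nrm0 divr_ge0 ?nrm_ge0 // subr_ge0 ltW.
  rewrite uS; apply: le_trans (nrmD _ _) _.
  have k2 : 1 - k != 0 by lra.
  rewrite [leRHS](_ : _ = k * (nrm y / (1 - k)) + nrm y); last by field.
  by rewrite lerD2r; apply: le_trans (hT _) _; rewrite ler_wpM2l.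
have du n p : nrm (u (n + p)%N - u n) <= k ^+ n * (nrm y / (1 - k)).
  elim: n => [|n IH]; first by rewrite subr0 expr0 mul1r.
  rewrite addSn !uS opprD addrACA subrr addr0 -(linA_B lT).
  by apply: le_trans (hT _) _; rewrite exprS -mulrA ler_wpM2l.
set c := nrm y / (1 - k) in du *.
have c0 : 0 <= c by rewrite divr_ge0 ?nrm_ge0 // subr_ge0 ltW.
have [] := @hilbert_complete _ H u.
  move=> e e0; have [N hN] := expr_small k0 k1 (divr_gt0 e0 (ltr_wpDl c0 ltr01)).
  have aux n p : (N <= n)%N -> (n <= p)%N -> nrm (u p - u n) <= e.
    move=> hn /subnKC <-; apply: le_trans (du _ _) _.
    apply: le_trans (ler_wpM2r c0 (hN _ hn)) _.
    rewrite mulrAC ler_pdivrMr ?ltr_wpDl // ler_pM2l //; lra.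
  exists N => n m hn hm; have [nm|/ltnW mn] := leqP n m; last exact: aux.
  by rewrite nrmB aux.
move=> l hl; exists l; apply/eqP; rewrite -subr_eq0; apply/eqP/nrm_eq0.
apply/eqP; rewrite eq_le nrm_ge0 andbT; apply: (@le_eps _ _ _ 2) => e e0.
have [N hN] := hl _ e0.
rewrite (_ : l - _ = (l - u N.+1) + T (u N - l)); last first.
  by rewrite uS (linA_B lT); vec.
apply: le_trans (nrmD _ _) _; rewrite nrmB.
have h1 := hN _ (leqnSn N); have h2 := hN _ (leqnn N).
have h3 : nrm (T (u N - l)) <= e.
  apply: le_trans (hT _) _; apply: le_trans h2.
  by rewrite ler_piMl ?nrm_ge0 // ltW.
lra.
Qed.

Lemma coercive_lower m M A x : bd m M A -> m * nrm x <= nrm (A x).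
Proof.
case=> sA h; have [->|x0] := eqVneq x 0; first by rewrite nrm0 mulr0 nrm_ge0.
have n0 : 0 < nrm x by rewrite sqrtr_gt0 dot_gt0.
rewrite -(ler_pM2r n0) -mulrA -expr2 nrm_sqr.
have /andP[h1 _] := h x; apply: le_trans h1 _.
exact: le_trans (ler_norm _) (dot_CSn _ _).
Qed.

(** For K large, 1 - A / K is a positive operator bounded by 1 - m / K < 1,
    hence a strict contraction, and A is K times 1 minus it. *)
Lemma coercive_inverse m M A : bd m M A -> 0 < m -> exists B, is_inverse A B.
Proof.
move=> hA m0; have [sA h] := hA; have lA := sa_lin sA.
pose K := Num.max M 0 + m; have MK : Num.max M 0 <= K by rewrite /K; lra.
have K0 : 0 < K by rewrite ltr_wpDl // le_max lexx orbT.
have mK : m <= K by rewrite lerDr le_max lexx orbT.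
pose T := @idfun H - (K^-1)%:C *: A.
have sT : selfadjoint T.
  exact/(selfadjoint_sub selfadjoint_id)/selfadjoint_scale.
have TE x : T x = x - (K^-1)%:C *: A x by [].
have qT x : '[T x, x] = '[x, x] - '[A x, x] / K by rewrite TE dotBl dotZl mulrC.
have T1 x : '[T x, x] <= (1 - m / K) * '[x, x].
  rewrite qT; have /andP[h1 _] := h x.
  suff : m * '[x, x] / K <= '[A x, x] / K by lra.
  by rewrite ler_pM2r ?invr_gt0.
have pT : positive T.
  apply/positiveP; split=> // x; rewrite qT; have /andP[_ h1] := h x.
  rewrite subr_ge0 ler_pdivrMr // mulrC; apply: le_trans h1 _.
  by rewrite ler_wpM2r ?dot_ge0 //; apply: le_trans MK; rewrite le_max lexx.
have k0 : 0 <= 1 - m / K by rewrite subr_ge0 ler_pdivrMr ?mul1r.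
have k1 : 1 - m / K < 1 by rewrite ltrBlDr ltrDl divr_gt0.
have hT x : nrm (T x) <= (1 - m / K) * nrm x.
  rewrite nrm_le ?mulr_ge0 ?nrm_ge0 // exprMn nrm_sqr.
  apply: le_trans (pos_sqr_le x pT T1) _.
  by rewrite expr2 -mulrA ler_wpM2l.
have surj y : exists x, A x = y.
  have [x hx] := contraction_solve ((K^-1)%:C *: y) (sa_lin sT) k0 k1 hT.
  exists x; move: hx; rewrite TE -addrA => /esym/eqP.
  rewrite -subr_eq0 addrAC subrr add0r addrC subr_eq0 => /eqP /(congr1 (fun v => K%:C *: v)).
  by rewrite !scalerA -rmorphM mulfV ?gt_eqF // !scale1r.
have inj x y : A x = A y -> x = y.
  move=> e; apply/eqP; rewrite -subr_eq0; apply/eqP/nrm_eq0.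
  have := coercive_lower (x - y) hA; rewrite (linA_B lA) e subrr nrm0.
  rewrite pmulr_rle0 // => h1; apply/eqP; rewrite eq_le h1 nrm_ge0 //.
have [B hB] := choice surj.
exists B; split; last 1 first.
- by apply/funext => x; apply: inj => /=; rewrite hB.
- apply/bopP; split=> [c x y|]; first by apply: inj; rewrite lA !hB.
  exists m^-1 => [|x]; first by rewrite invr_ge0 ltW.
  rewrite ler_pdivlMl //; have := coercive_lower (B x) hA; by rewrite hB.
- exact/funext/hB.
Qed.

Lemma inverse_unique A B B' : is_inverse A B -> is_inverse A B' -> B = B'.
Proof.
case=> _ _ h1 [_ h2 _].
by rewrite -[B]/(B \o idfun) (_ : idfun = id) // -h2 compA h1.
Qed.
Lemma op_inv_spec A : invertible A -> is_inverse A (op_inv A).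
Proof. by case=> B hB; rewrite /op_inv; case: xgetP => [_ -> //|/(_ B)]. Qed.
Lemma op_inv_eq A B : is_inverse A B -> op_inv A = B.
Proof. by move=> h; apply: (@inverse_unique A) => //; apply: op_inv_spec; exists B. Qed.

Lemma inverse_sa A B : selfadjoint A -> is_inverse A B -> selfadjoint B.
Proof.
move=> sA [bB h1 h2]; apply: saP => // x y.
have e z : A (B z) = z := congr1 (@^~ z) h1.
by rewrite -{1}(e y) -(sa_dot _ _ sA) e.
Qed.

Lemma bd_inv m M A : bd m M A -> 0 < m -> 0 < M ->
  bd M^-1 m^-1 (op_inv A) /\ (forall x, A (op_inv A x) = x) /\
  (forall x, op_inv A (A x) = x).
Proof.
move=> hA m0 M0; have [sA h] := hA.
have hi := op_inv_spec (coercive_inverse hA m0).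
have sB := inverse_sa sA hi; case: hi => _ h1 h2; set B := op_inv A in sB h1 h2 *.
have AB x : A (B x) = x := congr1 (@^~ x) h1.
split; last by split=> // x; exact: (congr1 (@^~ x) h2).
have pA := bd_pos hA (ltW m0).
have q x : '[B x, x] = '[A (B x), B x] by rewrite AB dotC.
split=> // x; apply/andP; split.
  rewrite mulrC ler_pdivrMr // mulrC q -{1 2}(AB x).
  by apply: pos_sqr_le => // y; have /andP[] := h y.
have hB : m * '[B x, B x] <= '[B x, x].
  by rewrite q; have /andP[] := h (B x).
have hCS := dot_CS (B x) x.
have [x0|x0] := eqVneq x 0; first by rewrite x0 !dot0r mulr0.
have x1 := dot_gt0 x0.
have b0 : 0 <= '[B x, x] by rewrite q pos_ge0.
rewrite ler_pdivlMl //.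
have [->|bn] := eqVneq '[B x, x] 0; first by rewrite mulr0 ltW.
have bp : 0 < '[B x, x] by rewrite lt_neqAle eq_sym bn.
rewrite -(ler_pM2l bp) mulrCA -expr2.
apply: le_trans (ler_wpM2l (ltW m0) hCS) _.
by rewrite mulrA ler_wpM2r // ltW.
Qed.

(** If L bounds the inverse of A and K bounds A, then
    |x|^2 <= L^2 |A x|^2 <= L^2 K <A x, x>, so an invertible positive operator is
    bounded below. *)
Lemma strictly_positiveP A :
  strictly_positive A <-> exists m M, [/\ 0 < m, m <= M & bd m M A].
Proof.
split=> [[pA iA]|[m [M [m0 _ hA]]]]; last first.
  split; first exact: bd_pos hA (ltW m0).
  exact: coercive_inverse hA m0.
have [bB h1 h2] := op_inv_spec iA; set B := op_inv A in bB h1 h2.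
have sA := pos_sa pA.
have [K K0 hK] := sa_bounds sA; have /bopP[_ [L L0 hL]] := bB.
pose m := (K * (L + 1) ^+ 2)^-1.
have m0 : 0 < m by rewrite invr_gt0 mulr_gt0 // exprn_gt0 // ltr_wpDl.
have low x : m * '[x, x] <= '[A x, x].
  have BA : B (A x) = x := congr1 (@^~ x) h2.
  rewrite ler_pdivrMl ?mulr_gt0 // ?exprn_gt0 ?ltr_wpDl //.
  have h3 : '[x, x] <= (L + 1) ^+ 2 * '[A x, A x].
    rewrite -!nrm_sqr -exprMn ler_pXn2r ?nnegrE ?mulr_ge0 ?addr_ge0 ?nrm_ge0 //.
    rewrite -{1}BA; apply: le_trans (hL _) _; rewrite ler_wpM2r ?nrm_ge0 //; lra.
  apply: le_trans h3 _; rewrite [K * _]mulrC -(mulrA _ K); apply: ler_wpM2l; first exact: sqr_ge0.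
  by apply: pos_sqr_le => // y; have /andP[] := hK y.
have [M hM bA] := bd_upper sA low.
by exists m, M; split=> //; apply: le_trans hM; rewrite le_max lexx orbT.
Qed.

(** The infimum c of the Rayleigh quotients is in the spectrum: A - c >= 0, and
    were it invertible it would exceed a positive multiple of the identity. *)
Lemma inf_spectrum A : selfadjoint A -> (exists x : H, x != 0) ->
  exists c : R, spectrum A c%:C /\ forall x, c * '[x, x] <= '[A x, x].
Proof.
move=> sA [x0 x0n]; have lA := sa_lin sA.
pose S := [set r : R | exists2 x : H, x != 0 & r = '[A x, x] / '[x, x]].
have [K K0 hK] := sa_bounds sA.
have Slb : lbound S (- K).
  move=> _ [x xn ->]; rewrite ler_pdivlMr ?dot_gt0 //.
  by have /andP[] := hK x.
have S0 : has_inf S by split; [exists ('[A x0, x0] / '[x0, x0]); exists x0|exists (- K)].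
pose c := inf S.
have hc x : c * '[x, x] <= '[A x, x].
  have [->|xn] := eqVneq x 0; first by rewrite !dot0r mulr0.
  rewrite -ler_pdivlMr ?dot_gt0 //; apply: inf_lbound; first by exists (- K).
  by exists x.
exists c; split=> // iT.
pose T := A - (fun x => c%:C *: x).
have sT : selfadjoint T by exact/selfadjoint_sub/selfadjoint_scal.
have qT x : '[T x, x] = '[A x, x] - c * '[x, x] by rewrite [T x](_ : _ = A x - c%:C *: x) ?dotBl ?dotZl.
have /strictly_positiveP[m [M [m0 _ [_ hT]]]] : strictly_positive T.
  by split=> //; apply/positiveP; split=> // x; rewrite qT subr_ge0.
have [_ [x xn ->]] := inf_adherent m0 S0.
rewrite -/c ltr_pdivrMr ?dot_gt0 // => h1.
by have /andP[+ _] := hT x; rewrite qT; lra.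
Qed.
End Inverse.

(** * Polynomials in a selfadjoint operator *)

Section PolyCalculus.
Context {R : realType} {H : hilbertType R}.
Implicit Types (x y : H) (A B : H -> H) (p q : {poly R}) (P Q : {poly R[i]}).

(** Complex coefficients are needed only to split real polynomials into linear
    factors. *)
Definition cpoly_op P A : H -> H :=
  fun x => \sum_(i < size P) P`_i *: iter i A x.

Lemma cpoly_op_wide n P A x : (size P <= n)%N ->
  cpoly_op P A x = \sum_(i < n) P`_i *: iter i A x.
Proof.
move=> hn; rewrite /cpoly_op (big_ord_widen n (fun i => P`_i *: iter i A x)) //.
rewrite big_mkcond /=; apply: eq_bigr => i _.
by case: ltnP => // h; rewrite nth_default // scale0r.
Qed.

Lemma cpoly_opD P Q A x : cpoly_op (P + Q) A x = cpoly_op P A x + cpoly_op Q A x.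
Proof.
pose n := maxn (size P) (size Q).
rewrite !(@cpoly_op_wide n) ?leq_maxl ?leq_maxr ?size_polyD //.
by rewrite -big_split; apply: eq_bigr => i _; rewrite coefD scalerDl.
Qed.
Lemma cpoly_opC c A x : cpoly_op c%:P A x = c *: x.
Proof.
rewrite (@cpoly_op_wide 1) ?size_polyC ?leq_b1 //.
by rewrite big_ord1 coefC.
Qed.
Lemma cpoly_opMX P A x : cpoly_op (P * 'X) A x = cpoly_op P A (A x).
Proof.
rewrite (@cpoly_op_wide (size P).+1); last first.
  by apply: leq_trans (size_polyMleq _ _) _; rewrite size_polyX addn2.
rewrite big_ord_recl coefMX /= scale0r add0r.
by apply: eq_bigr => i _; rewrite coefMX /= -iterS iterSr.
Qed.
Lemma cpoly_opX A x : cpoly_op 'X A x = A x.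
Proof. by rewrite -(mul1r 'X) cpoly_opMX cpoly_opC scale1r. Qed.

Lemma cpoly_op_lin P A : linear A -> linear (cpoly_op P A).
Proof.
move=> lA c x y; elim/poly_ind: P x y => [|P d IH] x y.
  by rewrite -polyC0 !cpoly_opC !scale0r scaler0 addr0.
rewrite !cpoly_opD !cpoly_opMX !cpoly_opC lA IH scalerDr [c *: (_ + _)]scalerDr !scalerA.
by rewrite (mulrC d) -!addrA; congr (_ + _); rewrite addrCA.
Qed.
Lemma cpoly_op_comm P A x : linear A -> cpoly_op P A (A x) = A (cpoly_op P A x).
Proof.
move=> lA; elim/poly_ind: P x => [|P d IH] x.
  by rewrite -polyC0 !cpoly_opC !scale0r linA_0.
by rewrite !cpoly_opD !cpoly_opMX !cpoly_opC (linA_D lA) (linA_Z lA) IH.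
Qed.
Lemma cpoly_opM P Q A x : linear A ->
  cpoly_op (P * Q) A x = cpoly_op P A (cpoly_op Q A x).
Proof.
move=> lA; elim/poly_ind: P x => [|P d IH] x.
  by rewrite mul0r -polyC0 !cpoly_opC !scale0r.
rewrite mulrDl -mulrA (mulrC 'X) mulrA !cpoly_opD !cpoly_opMX IH.
rewrite (cpoly_op_comm _ _ lA) cpoly_opC; congr (_ + _).
have lQ := cpoly_op_lin Q lA.
elim/poly_ind: {IH lQ} Q x => [|Q e IH] x.
  by rewrite mulr0 -polyC0 !cpoly_opC !scale0r scaler0.
rewrite mulrDr mulrA -polyCM !cpoly_opD !cpoly_opMX !cpoly_opC IH scalerDr.
by rewrite scalerA.
Qed.

Local Notation toC := (map_poly (real_complex R)).

Lemma poly_opE p A x : poly_op p A x = cpoly_op (toC p) A x.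
Proof.
by rewrite /cpoly_op size_map_poly; apply: eq_bigr => i _; rewrite coef_map.
Qed.
Lemma poly_opD p q A x : poly_op (p + q) A x = poly_op p A x + poly_op q A x.
Proof. by rewrite !poly_opE rmorphD cpoly_opD. Qed.
Lemma poly_opC (c : R) A x : poly_op c%:P A x = c%:C *: x.
Proof. by rewrite !poly_opE /= map_polyC cpoly_opC. Qed.
Lemma poly_opX A x : poly_op 'X A x = A x.
Proof. by rewrite !poly_opE /= map_polyX cpoly_opX. Qed.
Lemma poly_opM p q A x : linear A ->
  poly_op (p * q) A x = poly_op p A (poly_op q A x).
Proof. by move=> lA; rewrite !poly_opE rmorphM cpoly_opM. Qed.
Lemma poly_opB p q A x : linear A ->
  poly_op (p - q) A x = poly_op p A x - poly_op q A x.
Proof.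
move=> lA; rewrite poly_opD; congr (_ + _).
by rewrite -mulN1r -polyCN poly_opM // poly_opC rmorphN scaleNr scale1r.
Qed.
Lemma poly_op_comm p A x : linear A -> poly_op p A (A x) = A (poly_op p A x).
Proof. by move=> lA; rewrite !poly_opE cpoly_op_comm. Qed.

Lemma poly_op_sa p A : selfadjoint A -> selfadjoint (poly_op p A).
Proof.
move=> sA; have lA := sa_lin sA.
elim/poly_ind: p => [|p c IH].
  suff -> : poly_op 0 A = scal 0 by exact: selfadjoint_scal.
  by apply/funext => x; rewrite -polyC0 poly_opC.
have -> : poly_op (p * 'X + c%:P) A = (poly_op p A \o A) + scal c.
  by apply/funext => x; rewrite poly_opD poly_opM // poly_opC poly_opX.
apply: selfadjoint_add; last exact: selfadjoint_scal.
apply: saP => [|x y /=]; first exact/bop_comp/sa_bop/sA/sa_bop.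
by rewrite (sa_dot _ _ IH) (sa_dot _ _ sA) poly_op_comm.
Qed.

Lemma compK A B : A \o B = id -> forall x, A (B x) = x.
Proof. by move=> h x; exact: (congr1 (@^~ x) h). Qed.

Lemma invertible_comp A B : invertible A -> invertible B -> invertible (A \o B).
Proof.
move=> [A' [bA' h1 h2]] [B' [bB' h3 h4]]; exists (B' \o A'); split.
- exact: bop_comp.
- by apply/funext => x /=; rewrite (compK h3) (compK h1).
- by apply/funext => x /=; rewrite (compK h2) (compK h4).
Qed.

(** For z = a + i b with b <> 0, the product of A - z and its conjugate factor is
    (A - a)^2 + b^2, which is bounded below by b^2 > 0 and so invertible. *)
Lemma spectrum_real A z : selfadjoint A -> spectrum A z -> Im z = 0.
Proof.
move=> sA; apply: contra_notP => /eqP b0; case: z b0 => a b /= b0.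
have lA := sa_lin sA.
pose z := a +i* b; pose zc := a -i* b.
pose N := poly_op (('X - a%:P) ^+ 2 + (b ^+ 2)%:P) A.
have sN : selfadjoint N by exact: poly_op_sa.
have b1 : 0 < b ^+ 2 by rewrite exprn_even_gt0.
have lowN x : b ^+ 2 * '[x, x] <= '[N x, x].
  have sB := poly_op_sa ('X - a%:P) sA.
  rewrite /N poly_opD poly_opC expr2 poly_opM // dotDl dotZl lerDr.
  by rewrite (sa_dot _ _ sB) dot_ge0.
have [M _ bN] := bd_upper sN lowN.
have [S [bS h1 h2]] := coercive_inverse bN b1.
have e1 : toC (('X - a%:P) ^+ 2 + (b ^+ 2)%:P) = ('X - z%:P) * ('X - zc%:P).
  rewrite rmorphD rmorphXn rmorphB /= map_polyX !map_polyC /=.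
  have -> : z = a%:C + 'i * b%:C by rewrite /z [LHS]complexE.
  have -> : zc = a%:C - 'i * b%:C.
    by apply/eqP; rewrite eq_complex /= !(mul0r, mul1r, mulr0, subr0, addr0, add0r, oppr0) !eqxx.
  rewrite !polyCD polyCN.
  have -> : (b ^+ 2)%:C%:P = - (('i * b%:C)%:P) ^+ 2 :> {poly R[i]}.
    by rewrite -polyC_exp exprMn sqr_i mulN1r polyCN opprK rmorphXn.
  ring.
have opE w x : cpoly_op ('X - w%:P) A x = A x - w *: x.
  by rewrite cpoly_opD cpoly_opX -polyCN cpoly_opC scaleNr.
have NE1 x : N x = (A (A x - zc *: x)) - z *: (A x - zc *: x).
  by rewrite /N poly_opE e1 cpoly_opM // !opE.
have NE2 x : N x = (A (A x - z *: x)) - zc *: (A x - z *: x).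
  by rewrite /N poly_opE e1 mulrC cpoly_opM // !opE.
pose D w : H -> H := A - (fun x => w *: x).
have bD w : bounded_operator (D w).
  exact/bop_sub/(bop_scale w bop_id)/sa_bop.
have r1 x : D z (D zc (S x)) = x by rewrite -[RHS](compK h1) NE1.
have l1 x : S (D zc (D z x)) = x by rewrite -[RHS](compK h2) NE2.
exists (D zc \o S); split; first exact: bop_comp.
  by apply/funext => x; exact: r1.
apply/funext => x; rewrite -[RHS]l1 /= -[in LHS](l1 (D zc _)).
by congr (S (D zc _)); rewrite r1.
Qed.

Lemma invertible_scal A c : bounded_operator A -> c != 0 -> invertible A ->
  invertible (c *: A).
Proof.
move=> bA c0 [B [bB h1 h2]]; exists (c^-1 *: B); split; first exact: bop_scale.
  apply/funext => x; rewrite /= -[RHS](compK h1).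
  rewrite !fctE (linA_Z (bop_lin bA)) scalerA mulfV // scale1r //.
apply/funext => x; rewrite /= -[RHS](compK h2).
by rewrite !fctE (linA_Z (bop_lin bB)) scalerA mulVf // scale1r.
Qed.

(** Half of the spectral mapping theorem: p(A) - c is a product of factors A - z,
    one of which must fail to be invertible, and such a z is real. *)
Lemma spectrum_poly A p c : selfadjoint A -> (exists x : H, x != 0) ->
  spectrum (poly_op p A) c%:C -> exists2 t : R, spectrum A t%:C & p.[t] = c.
Proof.
move=> sA Hn; have lA := sa_lin sA => hc.
pose Q := toC (p - c%:P).
have [p0|p0] := eqVneq (p - c%:P) 0.
  have [t [ht _]] := inf_spectrum sA Hn; exists t => //.
  by move/eqP: p0; rewrite subr_eq0 => /eqP ->; rewrite hornerC.
have Q0 : Q != 0 by rewrite map_poly_eq0.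
have [r hr] := closed_field_poly_normal Q.
apply: contrapT => hnt; apply: hc.
have -> : poly_op p A - (fun x => c%:C *: x) = cpoly_op Q A.
  apply/funext => x; rewrite -poly_opE poly_opB // poly_opC //.
have hz z : z \in r -> invertible (cpoly_op ('X - z%:P) A).
  move=> zr; apply: contrapT => hni; apply: hnt.
  have sz : spectrum A z.
    move=> iz; apply: hni; suff -> : cpoly_op ('X - z%:P) A = A - (fun x => z *: x) by [].
    by apply/funext => x; rewrite cpoly_opD cpoly_opX -polyCN cpoly_opC scaleNr.
  have zi := spectrum_real sA sz.
  have zE : z = (Re z)%:C by case: (z) zi => a b /= ->.
  exists (Re z); first by rewrite -zE.
  have : root Q z.
    rewrite hr rootZ ?lead_coef_eq0 // root_prod_XsubC //.
  rewrite zE /root horner_map /= hornerD hornerN hornerC.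
  by rewrite (_ : 0 = 0%:C) // => /eqP/complexI/eqP; rewrite subr_eq0 => /eqP.
have bc (P : {poly R[i]}) : bounded_operator (cpoly_op P A).
  elim/poly_ind: P => [|P d IH].
    suff -> : cpoly_op 0 A = 0 by exact: bop_0.
    by apply/funext => x; rewrite -polyC0 cpoly_opC scale0r.
  suff -> : cpoly_op (P * 'X + d%:P) A = (cpoly_op P A \o A) + (d *: @idfun H).
    exact/bop_add/bop_scale/bop_id/bop_comp/sa_bop.
  by apply/funext => x; rewrite cpoly_opD cpoly_opMX cpoly_opC.
rewrite hr.
suff : invertible (cpoly_op (\prod_(z <- r) ('X - z%:P)) A).
  move=> /(invertible_scal (bc _) (c := lead_coef Q)); rewrite lead_coef_eq0 => /(_ Q0).
  suff -> : cpoly_op (lead_coef Q *: \prod_(z <- r) ('X - z%:P)) A =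
    lead_coef Q *: cpoly_op (\prod_(z <- r) ('X - z%:P)) A by [].
  by apply/funext => x; rewrite -mul_polyC cpoly_opM // cpoly_opC.
elim: r hz {hr} => [|z r IH] hz.
  rewrite big_nil -polyC1; exists idfun; split; first exact: bop_id.
    by apply/funext => x /=; rewrite cpoly_opC scale1r.
  by apply/funext => x /=; rewrite cpoly_opC scale1r.
rewrite big_cons.
have -> : cpoly_op (('X - z%:P) * \prod_(j <- r) ('X - j%:P)) A =
  cpoly_op ('X - z%:P) A \o cpoly_op (\prod_(j <- r) ('X - j%:P)) A.
  by apply/funext => x; rewrite cpoly_opM.
apply: invertible_comp; first by apply: hz; rewrite mem_head.
by apply: IH => w wr; apply: hz; rewrite inE wr orbT.
Qed.

(** The infimum of the form of p(A) belongs to the spectrum of p(A), hence is a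
    value of p on the spectrum of A. *)
Lemma poly_op_ge0 A p x : selfadjoint A ->
  (forall t : R, spectrum A t%:C -> 0 <= p.[t]) -> 0 <= '[poly_op p A x, x].
Proof.
move=> sA hp; have [->|xn] := eqVneq x 0; first by rewrite dot0r.
have [c [sc hc]] := inf_spectrum (poly_op_sa p sA) (ex_intro _ x xn).
have [t ht tc] := spectrum_poly sA (ex_intro _ x xn) sc.
by apply: le_trans (hc x); rewrite mulr_ge0 ?dot_ge0 // -tc hp.
Qed.

(** Positivity applied to e^2 - p^2. *)
Lemma poly_op_norm A p (e : R) x : selfadjoint A -> 0 <= e ->
  (forall t : R, spectrum A t%:C -> `|p.[t]| <= e) ->
  nrm (poly_op p A x) <= e * nrm x.
Proof.
move=> sA e0 hp; rewrite nrm_le ?mulr_ge0 ?nrm_ge0 // exprMn nrm_sqr.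
have := @poly_op_ge0 A ((e ^+ 2)%:P - p * p) x sA.
rewrite poly_opB ?poly_opC ?poly_opM; try exact: sa_lin.
rewrite dotBl dotZl (sa_dot _ _ (poly_op_sa p sA)) subr_ge0; apply => t /hp.
rewrite hornerD hornerN hornerC hornerM -expr2 subr_ge0 => h.
by rewrite -[p.[t] ^+ 2]real_normK ?num_real // ler_pXn2r ?nnegrE.
Qed.

Lemma spectrum_bd m M A t : bd m M A -> spectrum A t%:C -> m <= t <= M.
Proof.
case=> sA h st; have sS (a : R) := selfadjoint_sub sA (selfadjoint_scal a).
apply/andP; split; rewrite leNgt; apply/negP => ht; apply: st.
  have low x : (m - t) * '[x, x] <= '[(A - scal t) x, x].
    rewrite (_ : (A - scal t) x = A x - t%:C *: x) // dotBl dotZl mulrBl.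
    by rewrite lerB //; have /andP[] := h x.
  have [M' _ bA] := bd_upper (sS t) low.
  by apply: coercive_inverse bA _; rewrite subr_gt0.
have low x : (t - M) * '[x, x] <= '[(scal t - A) x, x].
  rewrite (_ : (scal t - A) x = t%:C *: x - A x) // dotBl dotZl mulrBl.
  by rewrite lerB //; have /andP[] := h x.
have sT := selfadjoint_sub (selfadjoint_scal t) sA.
have [M' _ bA] := bd_upper sT low.
have := coercive_inverse bA; rewrite subr_gt0 => /(_ ht) iT.
have n1 : -1 != 0 :> R[i] by rewrite oppr_eq0 oner_eq0.
have := invertible_scal (sa_bop sT) n1 iT.
suff -> : -1 *: (scal t - A) = A - (fun x => t%:C *: x) by [].
by rewrite scaleN1r opprB.
Qed.
End PolyCalculus.

(** * Weierstrass approximation *)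

Section Weierstrass.
Context {R : realType}.
Implicit Types (f g : R -> R) (x y e : R) (n : nat).

Definition cont_at f x := forall e, 0 < e ->
  exists2 d : R, 0 < d & forall y, `|y - x| <= d -> `|f y - f x| <= e.

Lemma interval_unif f (m M e : R) : (forall x, m <= x <= M -> cont_at f x) -> 0 < e ->
  exists2 d : R, 0 < d &
    forall x y, m <= x <= M -> `|y - x| <= d -> `|f y - f x| <= e.
Proof.
move=> hf e0; have /compact_near_coveringP hc := @segment_compact R m M.
have [|d /= hd d0] := hc _ (0^'+) (fun d x => forall y, `|y - x| <= d -> `|f y - f x| <= e) _ _.
  move=> x0; rewrite /= in_itv /= => /hf /(_ _ (divr_gt0 e0 (ltr0Sn _ 1)))[d d0 hd].
  have d2 : 0 < d / 2 by rewrite divr_gt0.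
  exists ([set x | `|x0 - x| <= d / 2], [set x | x <= d / 2]) => [|[x c] [/= h1 h2] y h3].
    split; last by apply: nbhs_right_le.
    by exists (d / 2) => // x /=; apply: ltW.
  have a1 : `|f x - f x0| <= e / 2 by apply: hd; rewrite distrC; apply: le_trans h1 _; lra.
  have a2 : `|f y - f x0| <= e / 2.
    apply: hd; rewrite (_ : y - x0 = (y - x) - (x0 - x)); last by ring.
    by apply: le_trans (ler_normB _ _) _; lra.
  rewrite (_ : f y - f x = (f y - f x0) - (f x - f x0)); last by ring.
  by apply: le_trans (ler_normB _ _) _; lra.
have [c c0 hcc] : exists2 c : R, 0 < c & forall x : R, m <= x <= M -> forall y, `|y - x| <= c -> `|f y - f x| <= e.
  exists (d / 2); first by rewrite divr_gt0.
  move=> x hx; apply: (d0 (d / 2)) => //=; rewrite ?divr_gt0 //.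
  by rewrite sub0r normrN ger0_norm; lra.
by exists c => // x y hx; exact: hcc.
Qed.

Lemma interval_bounded f (m M : R) : (forall x, m <= x <= M -> cont_at f x) ->
  exists2 B : R, 0 < B & forall x, m <= x <= M -> `|f x| <= B.
Proof.
move=> hf; have /compact_near_coveringP hc := @segment_compact R m M.
have [|B [_ hB]] := hc _ (pinfty_nbhs R) (fun B x => `|f x| <= B) _ _.
  move=> x0; rewrite /= in_itv /= => /hf /(_ _ ltr01)[d d0 hd].
  exists ([set x | `|x0 - x| <= d], [set B | `|f x0| + 1 < B]) => [|[x c] [/= h1 h2]].
    split; first by exists d => // x /=; apply: ltW.
    by exists (`|f x0| + 1); split=> //; rewrite num_real.
  rewrite (_ : f x = (f x - f x0) + f x0); last by ring.
  apply: le_trans (ler_normD _ _) _; rewrite distrC in h1.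
  by have := hd _ h1; lra.
exists (Num.max B 0 + 1) => [|x hx]; first by rewrite ltr_wpDl // le_max lexx orbT.
apply: (hB (Num.max B 0 + 1)); last by rewrite /= in_itv.
by rewrite ltr_pwDr // le_max lexx.
Qed.

(** A modulus of continuity in terms of (y - x)^2 is what Bernstein operators can
    integrate exactly. *)
Lemma quadratic_modulus f (m M e : R) :
  (forall x, m <= x <= M -> cont_at f x) -> 0 < e ->
  exists2 K : R, 0 <= K & forall x y, m <= x <= M -> m <= y <= M ->
    `|f y - f x| <= e + K * (y - x) ^+ 2.
Proof.
move=> hf e0; have [d d0 hd] := interval_unif hf e0.
have [B B0 hB] := interval_bounded hf.
exists (2 * B / d ^+ 2) => [|x y hx hy].
  by rewrite divr_ge0 ?sqr_ge0 // mulr_ge0 // ltW.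
have [le|gt] := leP `|y - x| d.
  apply: le_trans (hd _ _ hx le) _; rewrite lerDl mulr_ge0 ?sqr_ge0 //.
  by rewrite divr_ge0 ?sqr_ge0 // mulr_ge0 // ltW.
apply: (@le_trans _ _ (2 * B)).
  by apply: le_trans (ler_normB _ _) _; have := hB _ hx; have := hB _ hy; lra.
apply: (@le_trans _ _ (2 * B / d ^+ 2 * (y - x) ^+ 2)); last by rewrite lerDr ltW.
rewrite -[leLHS]mulr1 -[leRHS]mulrA; apply: ler_wpM2l; first by rewrite mulr_ge0 // ltW.
rewrite mulrC ler_pdivlMr ?exprn_gt0 // mul1r.
by rewrite -[leRHS]real_normK ?num_real // ler_pXn2r ?nnegrE ?normr_ge0 ?(ltW d0) ?(ltW gt).
Qed.

(** The value at x is the expectation of g at the number of successes in n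
    independent trials of probability x; the recursion conditions on one
    trial, and makes positivity and moments immediate. *)
Fixpoint bernstein n (g : nat -> R) : {poly R} :=
  if n is n'.+1 then
    'X * bernstein n' (fun k => g k.+1) + (1 - 'X) * bernstein n' g
  else (g 0%N)%:P.

Lemma bernstein_le n (g h : nat -> R) x : 0 <= x <= 1 ->
  (forall k, (k <= n)%N -> g k <= h k) -> (bernstein n g).[x] <= (bernstein n h).[x].
Proof.
move=> /andP[x0 x1]; elim: n g h => [|n IH] g h hgh /=; first by rewrite !hornerC hgh.
rewrite !hornerE; apply: lerD; apply: ler_wpM2l; rewrite ?subr_ge0 //.
  by apply: IH => k hk; apply: hgh.
by apply: IH => k hk; apply: hgh; apply: leqW.
Qed.
(** Mean and variance of the binomial law. *)
Lemma bernstein_quad n x (a b c : R) :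
  (bernstein n (fun k => a + b * (k%:R - c) ^+ 2)).[x] =
  a + b * ((n%:R * x - c) ^+ 2 + n%:R * x * (1 - x)).
Proof.
elim: n c => [|n IH] c /=; first by rewrite hornerC mul0r !mul0r addr0.
rewrite !hornerE.
under [X in bernstein n X]eq_fun => k.
  rewrite (_ : k.+1%:R - c = k%:R - (c - 1)); last by rewrite -natr1; ring.
  over.
by rewrite !IH -natr1; ring.
Qed.
Lemma bernsteinN n (g : nat -> R) : bernstein n (fun k => - g k) = - bernstein n g.
Proof.
elim: n g => [|n IH] g /=; first by rewrite polyCN.
by rewrite (IH (fun k => g k.+1)) IH; ring.
Qed.

(** Bernstein operators preserve inequalities, so the quadratic modulus bounds the
    error by e / 2 plus K times the variance of the mean of n trials. *)
Lemma weierstrass01 f e : (forall x, 0 <= x <= 1 -> cont_at f x) -> 0 < e ->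
  exists p : {poly R}, forall x, 0 <= x <= 1 -> `|p.[x] - f x| <= e.
Proof.
move=> hf e0; have e2 : 0 < e / 2 by rewrite divr_gt0.
have [K K0 hK] := quadratic_modulus hf e2.
have [n hn] : exists n, K <= e / 2 * n.+1%:R.
  exists (Num.bound (K / (e / 2))); have := archi_boundP (divr_ge0 K0 (ltW e2)).
  rewrite ltr_pdivrMr // mulrC => /ltW /le_trans; apply.
  by rewrite ler_pM2l // ler_nat.
have n0 : 0 < n.+1%:R :> R by rewrite ltr0n.
have n1 : n.+1%:R != 0 :> R by rewrite gt_eqF.
exists (bernstein n.+1 (fun k => f (k%:R / n.+1%:R))) => x hx.
have x01 := hx; case/andP: x01 => x0 x1.
have [c [var key]] : exists c, c * (n.+1%:R * x * (1 - x)) <= e / 2 /\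
    forall k, (k <= n.+1)%N -> `|f (k%:R / n.+1%:R) - f x| <=
      e / 2 + c * (k%:R - n.+1%:R * x) ^+ 2.
  exists (K / n.+1%:R ^+ 2); split=> [|k hk].
    rewrite (_ : _ * _ = (K / n.+1%:R) * (x * (1 - x))); last by field.
    apply: (@le_trans _ _ (K / n.+1%:R * 1)).
      apply: ler_wpM2l; first by rewrite divr_ge0 // ltW.
      by nra.
    by rewrite mulr1 ler_pdivrMr.
  have kin : 0 <= (k%:R / n.+1%:R : R) <= 1.
    by rewrite divr_ge0 //= ler_pdivrMr // mul1r ler_nat.
  apply: le_trans (hK _ _ hx kin) _.
  rewrite lerD2l (_ : k%:R / n.+1%:R - x = (k%:R - n.+1%:R * x) / n.+1%:R); last by field.
  by rewrite expr_div_n mulrA mulrAC.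
set N := n.+1 in var key *; pose g k := f (k%:R / N%:R); rewrite -/g.
rewrite ler_norml; apply/andP; split.
  have : (bernstein N (fun k => - g k)).[x] <= - f x + e.
    apply: le_trans (bernstein_le hx (h := fun k => (- f x + e / 2) + c * (k%:R - N%:R * x) ^+ 2) _) _.
      by move=> k /key; rewrite -/(g k) ler_norml => /andP[h1 _]; lra.
    by rewrite bernstein_quad subrr expr0n /= add0r; lra.
  by rewrite bernsteinN hornerN; lra.
suff : (bernstein N g).[x] <= f x + e by lra.
apply: le_trans (bernstein_le hx (h := fun k => (f x + e / 2) + c * (k%:R - N%:R * x) ^+ 2) _) _.
  by move=> k /key; rewrite -/(g k) ler_norml => /andP[_ h1]; lra.
by rewrite bernstein_quad subrr expr0n /= add0r; lra.
Qed.

Lemma weierstrass f (m M e : R) : m < M -> (forall x, m <= x <= M -> cont_at f x) ->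
  0 < e -> exists p : {poly R}, forall x, m <= x <= M -> `|p.[x] - f x| <= e.
Proof.
move=> mM hf e0; have d0 : 0 < M - m by rewrite subr_gt0.
have [x /andP[x0 x1]|p hp] := @weierstrass01 (fun s => f (m + (M - m) * s)) e _ e0.
  move=> r r0; have [|d dp hd] := hf (m + (M - m) * x) _ r r0; first by nra.
  exists (d / (M - m)) => [|y hy]; first by rewrite divr_gt0.
  apply: hd; rewrite (_ : _ - _ = (M - m) * (y - x)); last by ring.
  by rewrite normrM (ger0_norm (ltW d0)) mulrC -ler_pdivlMr.
exists (p \Po ((M - m)^-1 *: ('X - m%:P))) => x /andP[x0 x1].
rewrite horner_comp !hornerE.
have := hp ((M - m)^-1 * (x - m)).
rewrite (_ : m + (M - m) * _ = x); last by field; lra.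
apply; rewrite [X in 0 <= X <= _]mulrC divr_ge0 ?subr_ge0 ?(ltW mM) //=.
by rewrite ler_pdivrMr //; lra.
Qed.
End Weierstrass.

(** * Continuous functional calculus *)

Section Continuity.
Context {R : realType}.
Implicit Types (f g h : R -> R) (x : R).

Lemma cont_atP f x : cont_at f x <-> f @ x --> f x.
Proof.
split=> [hf|/cvgrPdist_le hf e e0].
  apply/cvgrPdist_le => e e0; have [d d0 hd] := hf _ e0.
  by exists d => // y /= hy; rewrite distrC hd // distrC ltW.
have [d d0 hd] := hf _ e0; exists (d / 2) => [|y hy]; first by rewrite divr_gt0.
rewrite distrC; apply: hd => /=; rewrite distrC; apply: le_lt_trans hy _.
by rewrite ltr_pdivrMr // ltr_pMr // ltr1n.
Qed.
Lemma cont_within f : {within `]0, +oo[, continuous f} -> forall x, 0 < x -> cont_at f x.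
Proof.
move=> hf x x0; apply/cont_atP.
move: hf; rewrite continuous_open_subspace; last exact: interval_open.
by apply; rewrite inE /= in_itv /= x0.
Qed.
Lemma cont_cst c x : cont_at (fun=> c) x.
Proof. by apply/cont_atP; exact: cvg_cst. Qed.
Lemma cont_id x : cont_at id x.
Proof. by apply/cont_atP; exact: cvg_id. Qed.
Lemma cont_add f g x : cont_at f x -> cont_at g x -> cont_at (fun t => f t + g t) x.
Proof. by move=> /cont_atP hf /cont_atP hg; apply/cont_atP; exact: cvgD. Qed.
Lemma cont_mul f g x : cont_at f x -> cont_at g x -> cont_at (fun t => f t * g t) x.
Proof. by move=> /cont_atP hf /cont_atP hg; apply/cont_atP; exact: cvgM. Qed.
Lemma cont_inv f x : f x != 0 -> cont_at f x -> cont_at (fun t => (f t)^-1) x.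
Proof. by move=> f0 /cont_atP hf; apply/cont_atP; exact: cvgV. Qed.
Lemma cont_comp f h x : cont_at h x -> cont_at f (h x) -> cont_at (fun t => f (h t)) x.
Proof.
move=> /cont_atP hh /cont_atP hf; apply/cont_atP.
exact: (@continuous_comp _ _ _ h f x hh hf).
Qed.
Lemma cont_horner (p : {poly R}) x : cont_at (fun t => p.[t]) x.
Proof. by apply/cont_atP; exact: continuous_horner. Qed.
Lemma cont_powR (a : R) x : 0 < x -> cont_at (fun t => t `^ a) x.
Proof.
move=> x0; apply/cont_atP.
have hl : (fun t => expR (a * ln t)) @ x --> expR (a * ln x).
  have h1 : (fun t => a * ln t) @ x --> a * ln x.
    by apply: cvgM; [exact: cvg_cst|exact: continuous_ln].
  exact: (cvg_comp _ _ h1 (@continuous_expR R (a * ln x))).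
rewrite {2}/powR gt_eqF //; apply: cvg_trans hl; apply: near_eq_cvg.
exists x => // t /= xt; rewrite /powR gt_eqF //.
by move: xt; rewrite ltr_distlC => /andP[]; rewrite subrr.
Qed.
End Continuity.

Section FunctionalCalculus.
Context {R : realType} {H : hilbertType R}.
Implicit Types (x y : H) (A B : H -> H) (f g h : R -> R) (p q : {poly R}) (m M e t : R).

(** Two polynomials close to f on the spectrum are close to each other there, and
    polynomials small on the spectrum give small operators. *)
Lemma is_cfc_unique f A B B' : selfadjoint A -> is_cfc f A B -> is_cfc f A B' -> B = B'.
Proof.
move=> sA [_ hB] [_ hB']; apply/funext => x; apply: (vec_eps (K := 4 * nrm x)) => e e0.
have [p [hp1 /(_ x)]] := hB e e0; have [q [hq1 /(_ x)]] := hB' e e0.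
rewrite !norm_nrm -!rmorphM !lecR => hq2 hp2.
have h : nrm (poly_op p A x - poly_op q A x) <= 2 * e * nrm x.
  rewrite -poly_opB; last exact: sa_lin.
  apply: poly_op_norm => // [|t st]; first by rewrite mulr_ge0 // ltW.
  rewrite hornerD hornerN (_ : _ - _ = (p.[t] - f t) - (q.[t] - f t)); last by ring.
  by apply: le_trans (ler_normB _ _) _; have := hp1 _ st; have := hq1 _ st; lra.
rewrite (_ : B x - B' x = (poly_op p A x - poly_op q A x) - (poly_op p A x - B x) + (poly_op q A x - B' x)); last by vec.
apply: le_trans (nrmD _ _) _; apply: le_trans (lerD (nrmD _ _) (lexx _)) _.
rewrite nrmN; lra.
Qed.

Section Fixed.
Variables (m M : R) (A : H -> H).
Hypothesis mM : m < M.
Hypothesis bA : bd m M A.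
Let sA : selfadjoint A := bd_sa bA.
Let lA : linear A := sa_lin sA.
Local Notation contI f := (forall t : R, m <= t <= M -> cont_at f t).

Lemma poly_dist p q e x : 0 <= e ->
  (forall t, m <= t <= M -> `|p.[t] - q.[t]| <= e) ->
  nrm (poly_op p A x - poly_op q A x) <= e * nrm x.
Proof.
move=> e0 hpq; rewrite -poly_opB //; apply: poly_op_norm => // t /(spectrum_bd bA).
by move/hpq; rewrite hornerD hornerN.
Qed.

(** The operators of a sequence of polynomials converging to f uniformly on [m, M]
    are Cauchy; the limit is then approximated by every polynomial close to f
    on [m, M], at the same rate. *)
Lemma cfc_exists f : contI f -> exists2 B, selfadjoint B &
  forall p e, 0 <= e -> (forall t, m <= t <= M -> `|p.[t] - f t| <= e) ->
    forall x, nrm (poly_op p A x - B x) <= e * nrm x.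
Proof.
move=> hf.
have hN (n : nat) : 0 < n.+1%:R^-1 :> R by rewrite invr_gt0.
have [p hp] := choice (fun n => weierstrass mM hf (hN n)).
have dist q e n x : 0 <= e -> (forall t, m <= t <= M -> `|q.[t] - f t| <= e) ->
    nrm (poly_op q A x - poly_op (p n) A x) <= (e + n.+1%:R^-1) * nrm x.
  move=> e0 hq; apply: poly_dist => [|t ht]; first by rewrite addr_ge0 // ltW.
  rewrite (_ : _ - _ = (q.[t] - f t) - ((p n).[t] - f t)); last by ring.
  by apply: le_trans (ler_normB _ _) _; rewrite lerD ?hq ?hp.
have lim x : exists l, forall e : R, 0 < e -> exists N, forall n, (N <= n)%N ->
    nrm (poly_op (p n) A x - l) <= e.
  apply: hilbert_complete => e e0.
  have [N1 hN1] := inv_small (nrm x) (divr_gt0 e0 (ltr0Sn _ 1)).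
  exists N1 => i j hi hj; apply: le_trans (dist _ _ _ _ (ltW (hN i)) (hp i)) _.
  by rewrite mulrDl [leRHS](splitr e); apply: lerD; exact: hN1.
have [B hB] := choice lim.
have est q e x : 0 <= e -> (forall t, m <= t <= M -> `|q.[t] - f t| <= e) ->
    nrm (poly_op q A x - B x) <= e * nrm x.
  move=> e0 hq; apply: (@le_eps _ _ _ 2) => d d0.
  have [N1 hN1] := inv_small (nrm x) d0; have [N2 hN2] := hB x d d0.
  have h1 := hN1 _ (leq_maxl N1 N2); have h2 := hN2 _ (leq_maxr N1 N2).
  move: h1 h2; set n := maxn N1 N2 => h1 h2.
  rewrite (_ : _ - B x = (poly_op q A x - poly_op (p n) A x) + (poly_op (p n) A x - B x)); last by vec.
  apply: le_trans (nrmD _ _) _; have := dist _ _ n x e0 hq.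
  rewrite mulrDl => h3; apply: le_trans (lerD h3 h2) _; rewrite -addrA lerD2l.
  apply: le_trans (lerD h1 (lexx d)) _; lra.
exists B => [|q e e0 hq x]; last exact: est.
have [F F0 hF] := interval_bounded hf.
apply: (selfadjoint_limit (X := fun n => poly_op (p n) A) (K := F + 1)) => [|n|n x|x].
- by rewrite addr_ge0 // ltW.
- exact: poly_op_sa.
- apply: poly_op_norm => [//||t /(spectrum_bd bA) ht]; first by rewrite addr_ge0 // ltW.
  rewrite (_ : (p n).[t] = f t + ((p n).[t] - f t)); last by ring.
  apply: le_trans (ler_normD _ _) _; apply: lerD; first exact: hF.
  by apply: le_trans (hp n t ht) _; rewrite invf_le1 ?ler1n.
- by apply/hilbert_cvgP; exact: hB.
Qed.

(** Approximation on [m, M] rather than on the spectrum: later arguments apply one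
    polynomial to several operators with the same bounds. *)
Lemma cfcP f : contI f -> selfadjoint (cfc f A) /\
  forall p e, 0 <= e -> (forall t, m <= t <= M -> `|p.[t] - f t| <= e) ->
    forall x, nrm (poly_op p A x - cfc f A x) <= e * nrm x.
Proof.
move=> hf; have [B sB hB] := cfc_exists hf.
have cB : is_cfc f A B.
  split=> [|e e0]; first exact: sa_bop.
  have [p hp] := weierstrass mM hf e0; exists p; split=> [t /(spectrum_bd bA)|x].
    exact: hp.
  by rewrite !norm_nrm -rmorphM lecR hB // ltW.
suff -> : cfc f A = B by [].
by apply: (is_cfc_unique sA _ cB); rewrite /cfc; case: xgetP => [_ -> //|/(_ B)].
Qed.
Lemma cfc_sa f : contI f -> selfadjoint (cfc f A).
Proof. by case/cfcP. Qed.

Lemma cfc_approx f e : contI f -> 0 < e -> exists2 p,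
  forall t, m <= t <= M -> `|p.[t] - f t| <= e &
  forall x, nrm (poly_op p A x - cfc f A x) <= e * nrm x.
Proof.
move=> hf e0; have [p hp] := weierstrass mM hf e0.
by exists p => //; have [_ h] := cfcP hf; apply: h; rewrite ?ltW.
Qed.

(** The rules of the calculus follow from this uniqueness: it is enough to exhibit
    polynomials converging to f whose operators converge pointwise to B. *)
Lemma cfc_char f B (K : R) (C : H -> R) : contI f -> 0 <= K ->
  (forall e, 0 < e -> e <= 1 -> exists2 p,
     forall t, m <= t <= M -> `|p.[t] - f t| <= K * e &
     forall x, nrm (poly_op p A x - B x) <= C x * e) ->
  cfc f A = B.
Proof.
move=> hf K0 h; have [_ hc] := cfcP hf; apply/funext => x; apply: (vec_eps (K := K * nrm x + `|C x|)) => e e0.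
pose d := Num.min e 1; have d0 : 0 < d by rewrite lt_min e0 ltr01.
have de : d <= e by rewrite ge_min lexx.
have [|p hp1 hp2] := h d d0; first by rewrite ge_min lexx orbT.
have h1 := hc p (K * d) (mulr_ge0 K0 (ltW d0)) hp1 x.
rewrite (_ : _ - B x = (poly_op p A x - B x) - (poly_op p A x - cfc f A x)); last by vec.
apply: le_trans (nrmD _ _) _; rewrite nrmN.
apply: (@le_trans _ _ ((K * nrm x + `|C x|) * d)).
  have := hp2 x; have : C x * d <= `|C x| * d by rewrite ler_pM2r // ler_norm.
  by rewrite mulrDl mulrAC in h1 *; lra.
by rewrite ler_wpM2l // addr_ge0 // mulr_ge0 ?nrm_ge0.
Qed.

Lemma cfc_poly p : cfc (fun t => p.[t]) A = poly_op p A.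
Proof.
apply: (@cfc_char _ _ 0 (fun=> 0)) => // [x _|e e0 _]; first exact: cont_horner.
by exists p => [t _|x]; rewrite subrr ?normr0 ?nrm0 mul0r.
Qed.
Lemma cfc_ext f g : contI f -> (forall t, m <= t <= M -> f t = g t) -> contI g -> cfc f A = cfc g A.
Proof.
move=> hf fg hg; apply: (@cfc_char _ _ 1 (fun x => nrm x)) => // e e0 _.
have [p hp1 hp2] := cfc_approx hg e0; exists p => [t ht|x]; last by rewrite mulrC.
by rewrite mul1r fg ?hp1.
Qed.
Lemma cfc_cst c : cfc (fun=> c) A = scal c.
Proof.
rewrite (_ : (fun=> c) = fun t => (c%:P).[t]) ?cfc_poly.
  by apply/funext => x; rewrite poly_opC.
by apply/funext => t; rewrite hornerC.
Qed.
Lemma cfc_id : cfc id A = A.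
Proof.
rewrite (_ : id = fun t => ('X : {poly R}).[t]) ?cfc_poly.
  by apply/funext => x; rewrite poly_opX.
by apply/funext => t; rewrite hornerX.
Qed.
Lemma cfc_add f g : contI f -> contI g ->
  cfc (fun t => f t + g t) A = cfc f A + cfc g A.
Proof.
move=> hf hg; apply: (@cfc_char _ _ 2 (fun x => 2 * nrm x)) => // [x hx|e e0 _].
  by apply: cont_add; [apply: hf|apply: hg].
have [p hp1 hp2] := cfc_approx hf e0; have [q hq1 hq2] := cfc_approx hg e0.
exists (p + q) => [t ht|x].
  rewrite hornerD opprD addrACA; apply: le_trans (ler_normD _ _) _.
  by have := hp1 t ht; have := hq1 t ht; lra.
rewrite poly_opD opprD addrACA; apply: le_trans (nrmD _ _) _.
by have := hp2 x; have := hq2 x; lra.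
Qed.
Lemma cfc_mul f g : contI f -> contI g ->
  cfc (fun t => f t * g t) A = cfc f A \o cfc g A.
Proof.
move=> hf hg; have [F F0 hF] := interval_bounded hf; have [G G0 hG] := interval_bounded hg.
apply: (@cfc_char _ _ (F + 1 + G) (fun x => (F + 1) * nrm x + nrm (cfc g A x))) => [x hx||e e0 e1].
- by apply: cont_mul; [apply: hf|apply: hg].
- by rewrite !addr_ge0 // ltW.
have [p hp1 hp2] := cfc_approx hf e0; have [q hq1 hq2] := cfc_approx hg e0.
have pF t : m <= t <= M -> `|p.[t]| <= F + 1.
  move=> ht; rewrite (_ : p.[t] = f t + (p.[t] - f t)); last by ring.
  apply: le_trans (ler_normD _ _) _; apply: lerD; first exact: hF.
  exact: le_trans (hp1 _ ht) e1.
have F1 : 0 <= F + 1 by rewrite addr_ge0 // ltW.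
exists (p * q) => [t ht|x].
  rewrite hornerM (_ : _ - _ = p.[t] * (q.[t] - g t) + (p.[t] - f t) * g t); last by ring.
  apply: le_trans (ler_normD _ _) _; rewrite !normrM mulrDl [G * e]mulrC.
  by apply: lerD; apply: ler_pM => //; [exact: pF|exact: hq1|exact: hp1|exact: hG].
rewrite poly_opM //= (_ : _ - _ = poly_op p A (poly_op q A x - cfc g A x) + (poly_op p A (cfc g A x) - cfc f A (cfc g A x))); last first.
  by rewrite (linA_B (sa_lin (poly_op_sa p sA))); vec.
apply: le_trans (nrmD _ _) _; rewrite mulrDl; apply: lerD; last by rewrite mulrC.
have pn y : nrm (poly_op p A y) <= (F + 1) * nrm y.
  by apply: poly_op_norm => // t /(spectrum_bd bA); exact: pF.
by apply: le_trans (pn _) _; rewrite -mulrA ler_wpM2l // mulrC.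
Qed.

Lemma cfc_le f g x : contI f -> contI g -> (forall t, m <= t <= M -> f t <= g t) ->
  '[cfc f A x, x] <= '[cfc g A x, x].
Proof.
move=> hf hg fg; apply: (@le_eps _ _ _ (4 * '[x, x])) => e e0.
have [p hp1 hp2] := cfc_approx hf e0; have [q hq1 hq2] := cfc_approx hg e0.
have est r k : (forall x, nrm (poly_op r A x - cfc k A x) <= e * nrm x) ->
    `|'[poly_op r A x, x] - '[cfc k A x, x]| <= e * '[x, x].
  move=> h; rewrite -dotBl; apply: le_trans (dot_CSn _ _) _.
  by rewrite -nrm_sqr expr2 mulrA ler_wpM2r ?nrm_ge0.
have := @poly_op_ge0 _ _ A (q - p + (2 * e)%:P) x sA.
rewrite poly_opD poly_opB // poly_opC dotDl dotBl dotZl.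
have := est _ _ hp2; have := est _ _ hq2; rewrite !ler_norml.
move=> /andP[h1 h2] /andP[h3 h4] h.
have {}h : 0 <= '[poly_op q A x, x] - '[poly_op p A x, x] + 2 * e * '[x, x].
  apply: h => t /(spectrum_bd bA) ht; rewrite !hornerE.
  have := hp1 _ ht; have := hq1 _ ht; rewrite !ler_norml => /andP[a1 a2] /andP[a3 a4].
  by have := fg _ ht; lra.
lra.
Qed.
Lemma cfc_bd f a b : contI f -> (forall t, m <= t <= M -> a <= f t <= b) -> bd a b (cfc f A).
Proof.
move=> hf hab; split=> [|x]; first exact: cfc_sa.
rewrite -!dotZl -![_%:C *: x]/(scal _ x) -!cfc_cst.
by rewrite !cfc_le // => t /hab /andP[]// *; exact: cont_cst.
Qed.
Lemma cfc_eigen f a x : contI f -> A x = a%:C *: x -> x != 0 -> cfc f A x = (f a)%:C *: x.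
Proof.
move=> hf ax x0.
have ha : m <= a <= M.
  have [_ /(_ x)] := bA; rewrite ax dotZl !ler_pM2r ?dot_gt0 //.
have pa p : poly_op p A x = (p.[a])%:C *: x.
  elim/poly_ind: p => [|p c IH]; first by rewrite -polyC0 poly_opC hornerC.
  rewrite poly_opD poly_opM // poly_opX ax poly_opC.
  rewrite (linA_Z (sa_lin (poly_op_sa p sA))) IH scalerA -rmorphM -scalerDl -rmorphD.
  by rewrite !hornerE mulrC.
apply: (vec_eps (K := 2 * nrm x)) => e e0.
have [p hp1 hp2] := cfc_approx hf e0; have := hp2 x; rewrite pa => h.
rewrite (_ : _ - _ = - ((p.[a])%:C *: x - cfc f A x) + (p.[a] - f a)%:C *: x); last by vec.
apply: le_trans (nrmD _ _) _; rewrite nrmN.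
have : nrm ((p.[a] - f a)%:C *: x) <= e * nrm x.
  rewrite nrmZc ler_wpM2r ?nrm_ge0 // normc_def /= expr0n addr0 sqrtr_sqr.
  exact: hp1.
by move: h; lra.
Qed.
Lemma cfc_dist f g e x : contI f -> contI g -> 0 < e -> (forall t, m <= t <= M -> `|f t - g t| <= e) ->
  nrm (cfc f A x - cfc g A x) <= e * nrm x.
Proof.
move=> hf hg e0 fg; apply: (@le_eps _ _ _ (2 * nrm x)) => d d0.
have [p hp1 hp2] := cfc_approx hf d0; have [_ hc] := cfcP hg.
have h : nrm (poly_op p A x - cfc g A x) <= (e + d) * nrm x.
  apply: hc => [|t ht]; first by rewrite addr_ge0 // ltW.
  rewrite (_ : _ - _ = (f t - g t) + (p.[t] - f t)); last by ring.
  by apply: le_trans (ler_normD _ _) _; rewrite lerD ?hp1 ?fg.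
rewrite (_ : _ - _ = (poly_op p A x - cfc g A x) - (poly_op p A x - cfc f A x)); last by vec.
by apply: le_trans (nrmD _ _) _; rewrite nrmN; have := hp2 x; move: h; lra.
Qed.
Lemma cfc_inverse f a b : contI f -> 0 < a -> (forall t, m <= t <= M -> a <= f t <= b) ->
  is_inverse (cfc f A) (cfc (fun t => (f t)^-1) A).
Proof.
move=> hf a0 hab.
have f0 t : m <= t <= M -> f t != 0.
  by move=> /hab/andP[h _]; rewrite gt_eqF // (lt_le_trans a0).
have hi : contI (fun t => (f t)^-1) by move=> t ht; apply: cont_inv; [exact: f0|exact: hf].
have one : cfc (fun=> 1) A = id.
  by rewrite cfc_cst; apply/funext => x; rewrite /scal scale1r.
split; first exact/sa_bop/cfc_sa.
  rewrite -cfc_mul // -one; apply: cfc_ext => [t ht|t ht|t _].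
  - by apply: cont_mul; [apply: hf|apply: hi].
  - by rewrite mulfV // f0.
  - exact: cont_cst.
rewrite -cfc_mul // -one; apply: cfc_ext => [t ht|t ht|t _].
- by apply: cont_mul; [apply: hi|apply: hf].
- by rewrite mulVf // f0.
- exact: cont_cst.
Qed.
End Fixed.

(** For polynomial f this is the multiplicativity of the calculus; the general
    case is a uniform limit. *)
Lemma cfc_comp m M m' M' A f h : m < M -> bd m M A -> m' < M' ->
  (forall t, m <= t <= M -> cont_at h t) -> (forall t, m <= t <= M -> m' <= h t <= M') ->
  (forall t, m' <= t <= M' -> cont_at f t) ->
  cfc f (cfc h A) = cfc (fun t => f (h t)) A.
Proof.
move=> mM bA mM' hh hr hf; have bB := cfc_bd mM bA hh hr.
have hfh t : m <= t <= M -> cont_at (fun t => f (h t)) t.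
  by move=> ht; apply: cont_comp; [exact: hh|exact/hf/hr].
have hph (r : {poly R}) t : m <= t <= M -> cont_at (fun t => r.[h t]) t.
  by move=> ht; apply: cont_comp; [exact: hh|exact: cont_horner].
have pol (r : {poly R}) : poly_op r (cfc h A) = cfc (fun t => r.[h t]) A.
  elim/poly_ind: r => [|r c IH].
    rewrite -polyC0 (_ : (fun t => _) = fun=> 0) ?(cfc_cst mM bA).
      by apply/funext => x; rewrite poly_opC.
    by apply/funext => t; rewrite hornerC.
  rewrite (_ : (fun t => _) = fun t => r.[h t] * h t + c); last first.
    by apply/funext => t; rewrite !hornerE.
  have hm t : m <= t <= M -> cont_at (fun t => r.[h t] * h t) t.
    by move=> ht; apply: cont_mul; [exact: hph|exact: hh].
  rewrite (cfc_add mM bA) // => [|t _]; last exact: cont_cst.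
  rewrite (cfc_mul mM bA) // => [|t ht]; last exact: hph.
  rewrite (cfc_cst mM bA) -IH.
  apply/funext => x; rewrite poly_opD poly_opM ?poly_opX ?poly_opC //.
  exact/sa_lin/bd_sa/bB.
apply/funext => x; apply: (vec_eps (K := 2 * nrm x)) => e e0.
have [r hr1 hr2] := cfc_approx mM' bB hf e0; have := hr2 x; rewrite pol => h1.
have h2 : nrm (cfc (fun t => r.[h t]) A x - cfc (fun t => f (h t)) A x) <= e * nrm x.
  by apply: (cfc_dist mM bA) => // [t|t /hr/hr1//]; exact: hph.
rewrite (_ : _ - _ = (cfc (fun t => r.[h t]) A x - cfc (fun t => f (h t)) A x) - (cfc (fun t => r.[h t]) A x - cfc f (cfc h A) x)); last by vec.
by apply: le_trans (nrmD _ _) _; rewrite nrmN; lra.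
Qed.
End FunctionalCalculus.

(** * Finitely many vectors inside an infinite-dimensional space *)

Section Orthonormal.
Context {R : realType}.
Implicit Types (d : nat).

Definition orthonormal_upto (H : hilbertType R) d (u : nat -> H) :=
  forall i j, (i < d)%N -> (j < d)%N -> inner H (u i) (u j) = (i == j)%:R.
Definition proj (H : hilbertType R) d (u : nat -> H) (x : H) :=
  \sum_(i < d) inner H x (u i) *: u i.

Lemma inner_suml (H : hilbertType R) (I : Type) (r : seq I) (F : I -> H) (y : H) :
  inner H (\sum_(i <- r) F i) y = \sum_(i <- r) inner H (F i) y.
Proof.
elim: r => [|i r IH]; last by rewrite !big_cons innerDl IH.
by rewrite !big_nil -(scale0r (0 : H)) innerZl mul0r.
Qed.
Lemma inner_sumr (H : hilbertType R) (I : Type) (r : seq I) (F : I -> H) (y : H) :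
  inner H y (\sum_(i <- r) F i) = \sum_(i <- r) inner H y (F i).
Proof.
by rewrite innerC inner_suml rmorph_sum; apply: eq_bigr => i _; rewrite [RHS]innerC.
Qed.
Lemma sum_delta d (i : nat) (F : nat -> R[i]) : (i < d)%N ->
  \sum_(j < d) F j * (val j == i)%:R = F i.
Proof.
move=> hi; rewrite (bigD1 (Ordinal hi)) //= eqxx mulr1 big1 ?addr0 // => j.
by rewrite -val_eqE /= => /negbTE ->; rewrite mulr0.
Qed.
Lemma inner_comb (H : hilbertType R) d (u : nat -> H) (F : nat -> R[i]) i :
  orthonormal_upto d u -> (i < d)%N -> inner H (\sum_(j < d) F j *: u j) (u i) = F i.
Proof.
move=> hu hi; rewrite inner_suml -[RHS](sum_delta F hi).
by apply: eq_bigr => j _; rewrite innerZl hu.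
Qed.
Lemma inner_proj (H : hilbertType R) d (u : nat -> H) x i :
  orthonormal_upto d u -> (i < d)%N -> inner H (proj d u x) (u i) = inner H x (u i).
Proof. by move=> hu hi; rewrite (inner_comb (fun j => inner H x (u j))). Qed.
Lemma innerBl (H : hilbertType R) (x y z : H) : inner H (x - y) z = inner H x z - inner H y z.
Proof. exact: linearBl. Qed.

(** One Gram-Schmidt step; vectors in the old span are still fixed by the new
    projection. *)
Lemma orthonormal_extend (H : hilbertType R) d (u : nat -> H) (x : H) :
  orthonormal_upto d u -> x <> proj d u x ->
  exists u', orthonormal_upto d.+1 u' /\
    forall k, k = proj d u k \/ k = x -> k = proj d.+1 u' k.
Proof.
move=> hu hx; pose r := x - proj d u x.
have r0 : r != 0 by rewrite subr_eq0; apply/eqP.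
have nr0 : nrm r != 0 by apply: contra r0 => /eqP/nrm_eq0/eqP.
have ru i : (i < d)%N -> inner H r (u i) = 0 by move=> hi; rewrite innerBl inner_proj ?subrr.
pose w := ((nrm r)^-1)%:C *: r.
have wu i : (i < d)%N -> inner H w (u i) = 0 by move=> hi; rewrite innerZl ru ?mulr0.
have uw i : (i < d)%N -> inner H (u i) w = 0 by move=> hi; rewrite innerC wu // rmorph0.
have ww : inner H w w = 1.
  rewrite inner_dotr dotZl dotZr -nrm_sqr mulrA -expr2 -exprMn mulVf // expr1n.
  by [].
have pw y : inner H (proj d u y) w = 0.
  rewrite /proj inner_suml big1 // => i _; rewrite innerZl uw ?mulr0 //.
pose u' i := if (i < d)%N then u i else w.
have pE y : proj d.+1 u' y = proj d u y + inner H y w *: w.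
  rewrite /proj big_ord_recr /= /u' ltnn; congr (_ + _).
  by apply: eq_bigr => i _; rewrite ltn_ord.
exists u'; split=> [i j|k [hk|->]].
- rewrite !ltnS /u' => hi hj.
  case: ltnP => h1; case: ltnP => h2; first exact: hu.
  + by rewrite uw // ltn_eqF // (leq_trans h1).
  + by rewrite wu // gtn_eqF // (leq_trans h2).
  + by rewrite ww (_ : i = j) ?eqxx //; apply/eqP; rewrite eqn_leq (leq_trans hi h2) (leq_trans hj h1).
- by rewrite pE {3}hk pw scale0r addr0.
have xE : x = proj d u x + r by rewrite /r addrC subrK.
rewrite pE {3}xE innerDl pw add0r {1}xE; congr (_ + _).
have -> : inner H r w = (nrm r)%:C.
  rewrite innerZr conj_real inner_dotr -nrm_sqr expr2 -rmorphM.
  by rewrite mulrA mulVf // mul1r.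
by rewrite scalerA -rmorphM mulfV // scale1r.
Qed.

Lemma gram_schmidt (H : hilbertType R) (s : seq H) :
  exists d (u : nat -> H), orthonormal_upto d u /\ forall k, k \in s -> k = proj d u k.
Proof.
elim: s => [|x s [d [u [hu hs]]]].
  by exists 0%N, (fun=> 0); split=> // i j.
have [hx|hx] := pselect (x = proj d u x).
  by exists d, u; split=> // k; rewrite inE => /orP[/eqP ->|/hs].
have [u' [hu' h]] := orthonormal_extend hu hx.
exists d.+1, u'; split=> // k; rewrite inE => /orP[/eqP -> |/hs hk]; apply: h.
  by right.
by left.
Qed.

Lemma infinite_orthonormal (H : hilbertType R) d : infinite_dimensional H ->
  exists u : nat -> H, orthonormal_upto d u.
Proof.
move=> Hinf; elim: d => [|d [u hu]]; first by exists (fun=> 0) => i j.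
have [x hx] : exists x, x <> proj d u x.
  apply: contrapT => hn; apply: Hinf; exists d, (fun i => u (val i)) => x.
  exists (fun i => inner H x (u (val i))).
  by apply: contrapT => hx; apply: hn; exists x.
by have [u' [hu' _]] := orthonormal_extend hu hx; exists u'.
Qed.

Section Transport.
Variables (H K : hilbertType R) (d : nat).
(** The partial isometry that carries u_i to e_i. *)
Definition transport (u : nat -> H) (e : nat -> K) (h : H) : K :=
  \sum_(i < d) inner H h (u i) *: e i.
Lemma transport_linear u e : linear (transport u e).
Proof.
move=> c x y; rewrite /transport scaler_sumr -big_split /=; apply: eq_bigr => i _.
by rewrite innerDl innerZl scalerDl scalerA.
Qed.
End Transport.

Lemma transport_adj (H K : hilbertType R) d u e h k :
  inner K (@transport H K d u e h) k = inner H h (@transport K H d e u k).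
Proof.
rewrite /transport inner_suml inner_sumr; apply: eq_bigr => i _.
by rewrite innerZl innerZr -innerC mulrC.
Qed.
Lemma transportK (H K : hilbertType R) d (u : nat -> H) (e : nat -> K) k :
  orthonormal_upto d u -> transport d u e (transport d e u k) = proj d e k.
Proof.
move=> hu; apply: eq_bigr => i _; congr (_ *: _).
exact: (inner_comb (fun j => inner K k (e j)) hu).
Qed.
Lemma transport0 (H K : hilbertType R) d (u v : nat -> H) (e : nat -> K) k :
  (forall i j, (i < d)%N -> (j < d)%N -> inner H (v i) (u j) = 0) ->
  transport d u e (transport d e v k) = 0.
Proof.
move=> huv; rewrite {1}/transport big1 // => i _.
by rewrite /transport inner_suml big1 ?scale0r // => j _; rewrite innerZl huv ?mulr0.
Qed.

(** V1 and V2 embed the span of s isometrically onto two orthogonal subspaces of H,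
    and W1, W2 are their adjoints.  This replaces the direct sum K + K: an
    operator that has to be known only at finitely many vectors of K + K can be
    realized on H itself. *)
Lemma double_embedding (H K : hilbertType R) (s : seq K) : infinite_dimensional H ->
  exists (W1 W2 : H -> K) (V1 V2 : K -> H),
  [/\ [/\ linear W1, linear W2, linear V1 & linear V2],
      (forall h k, '[W1 h, k] = '[h, V1 k]) /\ (forall h k, '[W2 h, k] = '[h, V2 k]),
      (forall k, k \in s -> W1 (V1 k) = k /\ W2 (V2 k) = k),
      (forall k, W1 (V2 k) = 0 /\ W2 (V1 k) = 0) &
      forall h, '[W1 h, W1 h] + '[W2 h, W2 h] <= '[h, h]].
Proof.
move=> Hinf; have [d [e [he hs]]] := gram_schmidt s.
have [u hu] := infinite_orthonormal (d + d) Hinf.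
pose u2 i := u (d + i)%N.
have hu1 : orthonormal_upto d u.
  by move=> i j hi hj; apply: hu; apply: ltn_addr.
have hu2 : orthonormal_upto d u2.
  by move=> i j hi hj; rewrite /u2 hu ?ltn_add2l // eqn_add2l.
have h12 i j : (i < d)%N -> (j < d)%N -> inner H (u i) (u2 j) = 0.
  move=> hi hj; rewrite /u2 hu ?ltn_add2l ?ltn_addr //.
  by rewrite ltn_eqF // ltn_addr.
have h21 i j : (i < d)%N -> (j < d)%N -> inner H (u2 i) (u j) = 0.
  by move=> hi hj; rewrite innerC h12 // rmorph0.
exists (transport d u e), (transport d u2 e), (transport d e u), (transport d e u2).
have adj (v : nat -> H) (h : H) (k : K) : '[transport d v e h, k] = '[h, transport d e v k].
  by rewrite /dotr transport_adj.
have iso (v : nat -> H) (h : H) : orthonormal_upto d v -> transport d v e (transport d e v (transport d v e h)) = transport d v e h.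
  move=> hv; rewrite transportK //; apply: eq_bigr => i _; congr (_ *: _).
  exact: (inner_comb (fun j => inner H h (v j)) he).
split=> //.
- by split; exact: transport_linear.
- by move=> k /hs hk; rewrite !transportK.
- by move=> k; split; exact: transport0.
move=> h; set a := transport d u e h; set b := transport d u2 e h.
pose z := transport d e u a + transport d e u2 b.
have hz : '[h, z] = '[a, a] + '[b, b] by rewrite dotDr -!adj.
have zz : '[z, z] = '[a, a] + '[b, b].
  rewrite !(dotDl, dotDr) -!adj /a /b !iso // !transport0 //.
  by rewrite !dot0l addr0 add0r.
have := dot_ge0 (h - z); rewrite !(dotBl, dotBr) zz (dotC z) hz; lra.
Qed.
End Orthonormal.

(** * Operator monotonicity and concavity *)

Section Transfer.
Context {R : realType}.
Implicit Types (f : R -> R).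

(** The operator T has to imitate A only at the finitely many iterates that p(A) x
    involves. *)
Lemma poly_op_intertwine (H K : hilbertType R) (A : K -> K) (T : H -> H) (V : K -> H)
    (p : {poly R}) n (x : K) : linear V -> (size p <= n)%N ->
  (forall i, (i < n)%N -> T (V (iter i A x)) = V (iter i.+1 A x)) ->
  poly_op p T (V x) = V (poly_op p A x).
Proof.
move=> lV hn hT.
have it i : (i <= n)%N -> iter i T (V x) = V (iter i A x).
  by elim: i => //= i IH hi; rewrite IH ?hT // ltnW.
rewrite /poly_op (linA_sum lV).
by apply: eq_bigr => i _; rewrite (linA_Z lV) it // (leq_trans _ hn) // ltnW.
Qed.

Lemma form_approx (H : hilbertType R) (A B : H -> H) (e : R) x :
  nrm (A x - B x) <= e * nrm x -> `|'[A x, x] - '[B x, x]| <= e * '[x, x].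
Proof.
move=> h; rewrite -dotBl; apply: le_trans (dot_CSn _ _) _.
by rewrite -nrm_sqr expr2 mulrA ler_wpM2r ?nrm_ge0.
Qed.

(** Monotonicity on one fixed space, in terms of forms: the hub to which all the
    conditions are compared. *)
Definition monotone_on (H : hilbertType R) f := forall (m M : R) (A B : H -> H),
  0 < m -> m < M -> bd m M A -> bd m M B ->
  (forall x, '[A x, x] <= '[B x, x]) -> forall x, '[cfc f A x, x] <= '[cfc f B x, x].

Lemma selfadjoint_sandwich (H K : hilbertType R) (W : H -> K) (V : K -> H) (A : K -> K) :
  linear W -> linear V -> (forall h k, '[W h, k] = '[h, V k]) ->
  (forall h, '[W h, W h] <= '[h, h]) -> selfadjoint A -> selfadjoint (V \o A \o W).
Proof.
move=> lW lV adj con sA; have /bopP[lA [L L0 hL]] := sa_bop sA.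
have nW h : nrm (W h) <= nrm h by rewrite ler_sqrt ?dot_ge0.
have nV k : nrm (V k) <= nrm k.
  have [->|v0] := eqVneq (nrm (V k)) 0; first exact: nrm_ge0.
  have vp : 0 < nrm (V k) by rewrite lt_neqAle eq_sym v0 nrm_ge0.
  rewrite -(ler_pM2l vp) -expr2 nrm_sqr -adj.
  apply: le_trans (ler_norm _) _; apply: le_trans (dot_CSn _ _) _.
  by rewrite ler_wpM2r ?nrm_ge0.
apply: saP => [|x y /=]; last by rewrite -adj dotC -adj -(sa_dot _ _ sA) dotC.
apply/bopP; split=> [c x y /=|]; first by rewrite lW lA lV.
exists L => // x /=; apply: le_trans (nV _) _; apply: le_trans (hL _) _.
by rewrite ler_wpM2l.
Qed.

(** Approximate f by a polynomial p.  Then f(A) and f(B) are tested at x only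
    through finitely many vectors A^i x and B^i x, whose span embeds in H; on
    the orthogonal complement both operators are replaced by m, which keeps
    the bounds and the order. *)
Lemma monotone_transfer (H K : hilbertType R) f : infinite_dimensional H ->
  (forall x, 0 < x -> cont_at f x) -> monotone_on H f -> monotone_on K f.
Proof.
move=> Hinf hf hH m M A B m0 mM bA bB AB x.
have hc t : m <= t <= M -> cont_at f t.
  by case/andP=> h _; apply: hf; apply: lt_le_trans h.
apply: (@le_eps _ _ _ (4 * '[x, x])) => e e0.
have [p hp] := weierstrass mM hc e0; pose n := size p.
pose s := [seq iter i A x | i <- iota 0 n.+1] ++ [seq iter i B x | i <- iota 0 n.+1].
have [W [W2 [V [V2 [[lW _ lV _] [adj _] hs _ hcon]]]]] := double_embedding s Hinf.
have con h : '[W h, W h] <= '[h, h].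
  by apply: le_trans (hcon h); rewrite lerDl dot_ge0.
have hx : W (V x) = x.
  by case: (hs x) => //; rewrite mem_cat; apply/orP; left; apply/mapP; exists 0%N; rewrite ?mem_iota.
pose T (D : K -> K) := (V \o D \o W) + (scal m - m%:C *: (V \o @idfun K \o W)).
have sS D : selfadjoint D -> selfadjoint (V \o D \o W) by exact: selfadjoint_sandwich.
have sT D : selfadjoint D -> selfadjoint (T D).
  move=> sD; apply: selfadjoint_add; first exact: sS.
  apply: selfadjoint_sub; first exact: selfadjoint_scal.
  by apply/selfadjoint_scale/sS; exact: selfadjoint_id.
have TE D h : T D h = V (D (W h)) + (m%:C *: h - m%:C *: V (W h)) by [].
have qT D h : '[T D h, h] = '[D (W h), W h] + m * ('[h, h] - '[W h, W h]).
  by rewrite TE dotDl dotBl !dotZl !(dotC (V _)) -!adj !(dotC (W _)) mulrBr.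
have bT D : bd m M D -> bd m M (T D).
  case=> sD hD; split=> [|h]; first exact: sT.
  have := hD (W h); have := con h; rewrite qT => h1 /andP[h2 h3].
  have h4 : m * ('[h, h] - '[W h, W h]) <= M * ('[h, h] - '[W h, W h]).
    by apply: ler_wpM2r; [rewrite subr_ge0|exact: ltW].
  by apply/andP; split; lra.
have TV D : (forall i, (i <= n)%N -> W (V (iter i D x)) = iter i D x) ->
    poly_op p (T D) (V x) = V (poly_op p D x).
  move=> hD; apply: (poly_op_intertwine (n := n)) => // i hi.
  by rewrite TE hD ?subrr ?addr0 // ltnW.
have hA := TV A; have hB := TV B.
have {}hA : poly_op p (T A) (V x) = V (poly_op p A x).
  apply: hA => i hi; case: (hs (iter i A x)) => //.
  by rewrite mem_cat; apply/orP; left; apply/mapP; exists i; rewrite ?mem_iota.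
have {}hB : poly_op p (T B) (V x) = V (poly_op p B x).
  apply: hB => i hi; case: (hs (iter i B x)) => //.
  by rewrite mem_cat; apply/orP; right; apply/mapP; exists i; rewrite ?mem_iota.
have form D : poly_op p (T D) (V x) = V (poly_op p D x) ->
   '[poly_op p (T D) (V x), V x] = '[poly_op p D x, x].
  by move=> ->; rewrite dotC -adj hx dotC.
have nx : '[V x, V x] = '[x, x] by rewrite -adj hx.
have app (L : hilbertType R) (D : L -> L) y : bd m M D ->
    `|'[poly_op p D y, y] - '[cfc f D y, y]| <= e * '[y, y].
  by move=> bD; apply: form_approx; have [_] := cfcP mM bD hc; apply=> //; exact: ltW.
have ht := hH m M (T A) (T B) m0 mM (bT _ bA) (bT _ bB).
have {}ht : '[cfc f (T A) (V x), V x] <= '[cfc f (T B) (V x), V x].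
  by apply: ht => h; rewrite !qT lerD2r AB.
have := app _ _ x bA; have := app _ _ x bB.
have := app _ _ (V x) (bT _ bA); have := app _ _ (V x) (bT _ bB).
rewrite (form A hA) (form B hB) nx !ler_norml.
by move=> /andP[? ?] /andP[? ?] /andP[? ?] /andP[? ?]; lra.
Qed.

Lemma bd_sqr (H : hilbertType R) (M : R) (A : H -> H) x :
  bd 0 M A -> 0 <= M -> '[A x, A x] <= M ^+ 2 * '[x, x].
Proof.
move=> bA M0; have pA := bd_pos bA (lexx 0); have [_ hA] := bA.
apply: le_trans (pos_sqr_le x pA (K := M) _) _ => [y|]; first by have /andP[] := hA y.
by rewrite expr2 -mulrA ler_wpM2l //; have /andP[] := hA x.
Qed.

(** In a rotated orthonormal frame (y, z) the block diagonal operator diag(A, B)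
    has a weighted arithmetic mean of A and B as its first diagonal block; the
    off-diagonal terms are absorbed by the small scalar d on the first component
    and a large one on the second. *)
Lemma rotation_bound (H : hilbertType R) (M d c s : R) (A B : H -> H) (y z : H) :
  bd 0 M A -> bd 0 M B -> 0 <= M -> 0 < d -> c ^+ 2 + s ^+ 2 = 1 ->
  '[A (c%:C *: y - s%:C *: z), c%:C *: y - s%:C *: z] +
  '[B (s%:C *: y + c%:C *: z), s%:C *: y + c%:C *: z] <=
  c ^+ 2 * '[A y, y] + s ^+ 2 * '[B y, y] + d * '[y, y] + (M + 4 * M ^+ 2 / d) * '[z, z].
Proof.
move=> bA bB M0 d0 cs; have sA := bd_sa bA; have sB := bd_sa bB.
have [w wE] : exists w, w = B z - A z by exists (B z - A z).
have hw : '[w, w] <= 4 * M ^+ 2 * '[z, z].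
  have := dot_ge0 (A z + B z); rewrite wE; dots; rewrite (dotC (B z) (A z)).
  by have := bd_sqr z bA M0; have := bd_sqr z bB M0; lra.
have cs2 : (c * s) ^+ 2 <= 1.
  rewrite exprMn; have := sqr_ge0 c; have := sqr_ge0 s; nra.
have cross : 2 * (c * s) * '[w, y] <= d * '[y, y] + 4 * M ^+ 2 / d * '[z, z].
  rewrite -(ler_pM2l d0) (mulrDr d) [d * (_ / d * _)](_ : _ = 4 * M ^+ 2 * '[z, z]); last first.
    by field; rewrite gt_eqF.
  have := dot_ge0 (d%:C *: y - (c * s)%:C *: w); dots; rewrite (dotC y w).
  have : (c * s) ^+ 2 * '[w, w] <= '[w, w] by rewrite ler_piMl ?dot_ge0.
  by rewrite expr2; lra.
have [_ /(_ z)/andP[_ hAz]] := bA; have [_ /(_ z)/andP[_ hBz]] := bB.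
have hz : s ^+ 2 * '[A z, z] + c ^+ 2 * '[B z, z] <= M * '[z, z].
  have := ler_wpM2l (sqr_ge0 s) hAz; have := ler_wpM2l (sqr_ge0 c) hBz.
  by rewrite (_ : c ^+ 2 = 1 - s ^+ 2); [lra|rewrite -cs addrK].
rewrite !(linA_D (sa_lin sA)) !(linA_N (sa_lin sA)) !(linA_D (sa_lin sB)) !(linA_Z (sa_lin sA)) !(linA_Z (sa_lin sB)).
move: cross; rewrite wE; dots.
by rewrite (sa_dot z y sA) (sa_dot z y sB) (dotC z (A y)) (dotC z (B y)); lra.
Qed.

(** The classical rotation argument.  Let U be the rotation of H + H with
    cosine sqrt (1 - t) and sine sqrt t.  Then U^* diag(A, B) U has first
    diagonal block C0 = (1 - t) A + t B and is at most diag(C0 + d, lam) for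
    d > 0 and lam large.  Monotonicity gives
    U^* diag(f(A), f(B)) U <= diag(f(C0 + d), f(lam)), whose first block is the
    claim up to the continuity of f.  The direct sum is realized by a double
    embedding of the vectors A^i x, B^i x and C^i x, where C = C0 + d: T plays
    the role of diag(A, B), Q that of the upper bound, and both are equal to m on
    the orthogonal complement. *)
Lemma monotone_concave (H : hilbertType R) f (m M : R) (A B : H -> H) (t : R) x :
  infinite_dimensional H -> (forall x, 0 < x -> cont_at f x) ->
  monotone_on H f -> 0 < m -> m < M -> bd m M A -> bd m M B -> 0 <= t <= 1 ->
  (1 - t) * '[cfc f A x, x] + t * '[cfc f B x, x] <= '[cfc f (arith_mean t A B) x, x].
Proof.
move=> Hinf hf hH m0 mM bA bB /andP[t0 t1].
pose c := Num.sqrt (1 - t); pose s := Num.sqrt t.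
have c2 : c ^+ 2 = 1 - t by rewrite sqr_sqrtr // subr_ge0.
have s2 : s ^+ 2 = t by rewrite sqr_sqrtr.
pose C0 := arith_mean t A B.
have C0E h : C0 h = (1 - t)%:C *: A h + t%:C *: B h by [].
have bC0 : bd m M C0.
  split=> [|h].
    by apply: selfadjoint_add; apply: selfadjoint_scale; [exact: bd_sa bA|exact: bd_sa bB].
  rewrite C0E dotDl !dotZl; have [_ /(_ h)/andP[? ?]] := bA; have [_ /(_ h)/andP[? ?]] := bB.
  by apply/andP; split; nra.
apply: (@le_eps _ _ _ (5 * '[x, x])) => e e0.
have cpos (r1 : R) t0' : m <= t0' <= r1 -> cont_at f t0'.
  by case/andP=> h _; apply: hf; apply: lt_le_trans h.
(* By uniform continuity the shift by d changes f(C0) by at most e. *)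
have [d0 d00 hd0] := interval_unif (cpos M) e0.
pose d := Num.min d0 1; have dp : 0 < d by rewrite lt_min d00 ltr01.
have d1 : d <= 1 by rewrite ge_min lexx orbT.
have hd z : m <= z <= M -> f (z + d) <= f z + e.
  move=> hz; have := hd0 z (z + d) hz; rewrite addrAC subrr add0r gtr0_norm //.
  by rewrite ge_min lexx => /(_ isT); rewrite ler_norml => /andP[_]; lra.
pose C := C0 + scal d.
have CE h : C h = C0 h + d%:C *: h by [].
have qC h : '[C h, h] = '[C0 h, h] + d * '[h, h] by rewrite CE dotDl dotZl.
have sC : selfadjoint C by apply: selfadjoint_add; [exact: bd_sa bC0|exact: selfadjoint_scal].
have fC y : '[cfc f C y, y] <= '[cfc f C0 y, y] + e * '[y, y].
  have cC0 z : m <= z <= M -> cont_at f z := cpos M z.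
  have cd z : m <= z <= M -> cont_at (fun u => u + d) z.
    by move=> _; apply: cont_add; [exact: cont_id|exact: cont_cst].
  have CC : C = cfc (fun u => u + d) C0.
    rewrite (cfc_add mM bC0) => [|z _|z _]; [|exact: cont_id|exact: cont_cst].
    by rewrite (cfc_id mM bC0) (cfc_cst mM bC0).
  have rng z : m <= z <= M -> m <= z + d <= M + 1 by move=> /andP[? ?]; apply/andP; split; lra.
  have mM1 : m < M + 1 by lra.
  have cfd z : m <= z <= M -> cont_at (fun u => f (u + d)) z.
    by move=> hz; apply: (cont_comp (h := fun u => u + d)); [exact: cd|exact/cpos/rng].
  rewrite CC (cfc_comp mM bC0 mM1 cd rng (cpos (M + 1))).
  have cfe z : m <= z <= M -> cont_at (fun u => f u + e) z.
    by move=> hz; apply: cont_add; [exact: cC0|exact: cont_cst].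
  apply: le_trans (cfc_le mM bC0 y cfd cfe hd) _.
  rewrite (cfc_add mM bC0) // => [|z _]; last exact: cont_cst.
  by rewrite (cfc_cst mM bC0) [(_ + _) y](_ : _ = cfc f C0 y + e%:C *: y) // dotDl dotZl.
clearbody C.
have Mp : 0 < M by lra.
pose lam := M + 4 * M ^+ 2 / d.
have lamM : M <= lam by rewrite lerDl divr_ge0 ?mulr_ge0 ?sqr_ge0 // ltW.
pose L := lam + 1; have mL : m < L by rewrite /L; lra.
have ML : M <= L by rewrite /L; lra.
have MdL : M + d <= L by rewrite /L; lra.
have lamL : lam <= L by rewrite /L lerDl.
have [p hp] := weierstrass mL (cpos L) e0; pose n := size p.
pose s0 := [seq iter i A x | i <- iota 0 n.+1] ++ [seq iter i B x | i <- iota 0 n.+1]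
  ++ [seq iter i C x | i <- iota 0 n.+1].
have [W1 [W2 [V1 [V2 [[lW1 lW2 lV1 lV2] [adj1 adj2] hs hz hcon]]]]] := double_embedding s0 Hinf.
have inA i : (i <= n)%N -> iter i A x \in s0.
  by move=> hi; rewrite mem_cat; apply/orP; left; apply/mapP; exists i; rewrite ?mem_iota.
have inB i : (i <= n)%N -> iter i B x \in s0.
  by move=> hi; rewrite !mem_cat; apply/orP; right; apply/orP; left; apply/mapP; exists i; rewrite ?mem_iota.
have inC i : (i <= n)%N -> iter i C x \in s0.
  by move=> hi; rewrite !mem_cat; apply/orP; right; apply/orP; right; apply/mapP; exists i; rewrite ?mem_iota.
have con1 h : '[W1 h, W1 h] <= '[h, h].
  by apply: le_trans (hcon h); rewrite lerDl dot_ge0.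
have con2 h : '[W2 h, W2 h] <= '[h, h].
  by apply: le_trans (hcon h); rewrite lerDr dot_ge0.
have sA := bd_sa bA; have sB := bd_sa bB.
have sS1 D : selfadjoint D -> selfadjoint (V1 \o D \o W1) by exact: selfadjoint_sandwich.
have sS2 D : selfadjoint D -> selfadjoint (V2 \o D \o W2) by exact: selfadjoint_sandwich.
pose Y := (c%:C *: W1) + (s%:C *: W2); pose Z := (c%:C *: W2) - (s%:C *: W1).
pose VY := (c%:C *: V1) + (s%:C *: V2); pose VZ := (c%:C *: V2) - (s%:C *: V1).
have YE h : Y h = c%:C *: W1 h + s%:C *: W2 h by [].
have ZE h : Z h = c%:C *: W2 h - s%:C *: W1 h by [].
have VYE h : VY h = c%:C *: V1 h + s%:C *: V2 h by [].
have VZE h : VZ h = c%:C *: V2 h - s%:C *: V1 h by [].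
have linc (F G : H -> H) (a b : R[i]) : linear F -> linear G -> linear (a *: F + b *: G).
  move=> lF lG r u v; rewrite [LHS](_ : _ = a *: F (r *: u + v) + b *: G (r *: u + v)) //.
  rewrite lF lG [X in _ = _ *: X + _](_ : _ = a *: F u + b *: G u) //.
  rewrite !scalerDr !scalerA (mulrC r) (mulrC r b) !addrA; congr (_ + _).
  by rewrite -!addrA; congr (_ + _); rewrite addrC.
have lY : linear Y by exact: linc.
have lVY : linear VY by exact: linc.
have lZ : linear Z by rewrite /Z -scaleNr; exact: linc.
have lVZ : linear VZ by rewrite /VZ -scaleNr; exact: linc.
have adjY h k : '[Y h, k] = '[h, VY k].
  by rewrite YE VYE dotDl dotDr !dotZl !dotZr adj1 adj2.
have adjZ h k : '[Z h, k] = '[h, VZ k].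
  by rewrite ZE VZE dotBl dotBr !dotZl !dotZr adj1 adj2.
have cs1 : c ^+ 2 + s ^+ 2 = 1 by rewrite c2 s2 subrK.
have YZ h : '[Y h, Y h] + '[Z h, Z h] = '[W1 h, W1 h] + '[W2 h, W2 h].
  rewrite YE ZE; dots; rewrite (dotC (W2 h) (W1 h)).
  rewrite [LHS](_ : _ = (c ^+ 2 + s ^+ 2) * ('[W1 h, W1 h] + '[W2 h, W2 h])); last by ring.
  by rewrite cs1 mul1r.
clearbody Y Z VY VZ.
have conY h : '[Y h, Y h] <= '[h, h].
  by apply: le_trans (hcon h); rewrite -YZ lerDl dot_ge0.
have conZ h : '[Z h, Z h] <= '[h, h].
  by apply: le_trans (hcon h); rewrite -YZ lerDr dot_ge0.
pose Rm := scal m - m%:C *: (V1 \o @idfun H \o W1) - m%:C *: (V2 \o @idfun H \o W2).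
have RE h : Rm h = m%:C *: h - m%:C *: V1 (W1 h) - m%:C *: V2 (W2 h) by [].
have sR : selfadjoint Rm.
  apply: selfadjoint_sub; last exact/selfadjoint_scale/sS2/selfadjoint_id.
  apply: selfadjoint_sub; last exact/selfadjoint_scale/sS1/selfadjoint_id.
  exact: selfadjoint_scal.
have qR h : '[Rm h, h] = m * ('[h, h] - '[W1 h, W1 h] - '[W2 h, W2 h]).
  by rewrite RE !dotBl !dotZl !(dotC (V1 _)) !(dotC (V2 _)) -adj1 -adj2; ring.
clearbody Rm.
(* Y and Z are the two components of a vector in the rotated frame, and Rm is m
   times the projection onto the orthogonal complement. *)
pose T := (V1 \o A \o W1) + (V2 \o B \o W2) + Rm.
pose Q := (VY \o C \o Y) + (VZ \o scal lam \o Z) + Rm.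
have TE h : T h = V1 (A (W1 h)) + V2 (B (W2 h)) + Rm h by [].
have QE h : Q h = VY (C (Y h)) + VZ (scal lam (Z h)) + Rm h by [].
have sT : selfadjoint T.
  by apply: selfadjoint_add => //; apply: selfadjoint_add; [exact: sS1|exact: sS2].
have sQ : selfadjoint Q.
  apply: selfadjoint_add => //; apply: selfadjoint_add; apply: selfadjoint_sandwich => //.
  exact: selfadjoint_scal.
clearbody T Q.
have qT h : '[T h, h] = '[A (W1 h), W1 h] + '[B (W2 h), W2 h] + '[Rm h, h].
  by rewrite TE !dotDl !(dotC (V1 _)) !(dotC (V2 _)) -adj1 -adj2 !(dotC (W1 h)) !(dotC (W2 h)).
have qQ h : '[Q h, h] = '[C (Y h), Y h] + lam * '[Z h, Z h] + '[Rm h, h].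
  by rewrite QE !dotDl !(dotC (VY _)) !(dotC (VZ _)) -adjY -adjZ /scal dotZr (dotC (Y h) (C _)).
have TQ h : '[T h, h] <= '[Q h, h].
  rewrite qT qQ lerD2r.
  have aE : W1 h = c%:C *: Y h - s%:C *: Z h.
    rewrite YE ZE; apply: eq_dot => v; dots.
    rewrite [RHS](_ : _ = (c ^+ 2 + s ^+ 2) * '[W1 h, v]); last by ring.
    by rewrite cs1 mul1r.
  have bE : W2 h = s%:C *: Y h + c%:C *: Z h.
    rewrite YE ZE; apply: eq_dot => v; dots.
    rewrite [RHS](_ : _ = (c ^+ 2 + s ^+ 2) * '[W2 h, v]); last by ring.
    by rewrite cs1 mul1r.
  rewrite aE bE qC C0E dotDl !dotZl -c2 -s2.
  apply: rotation_bound => //; first exact: bd_weaken bA (ltW m0) (lexx _).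
    exact: bd_weaken bB (ltW m0) (lexx _).
  exact: ltW.
have hA z := (bA.2 z); have hB z := (bB.2 z); have hC0 z := bC0.2 z.
have qR0 h : 0 <= '[h, h] - '[W1 h, W1 h] - '[W2 h, W2 h] by have := hcon h; lra.
have lowT h : m * '[h, h] <= '[T h, h].
  rewrite qT qR; have /andP[? _] := hA (W1 h); have /andP[? _] := hB (W2 h).
  by rewrite !mulrBr; lra.
have bT : bd m L T.
  split=> // h; rewrite lowT /= qT qR.
  have /andP[_ ?] := hA (W1 h); have /andP[_ ?] := hB (W2 h).
  have h1 : m * ('[h, h] - '[W1 h, W1 h] - '[W2 h, W2 h]) <=
      M * ('[h, h] - '[W1 h, W1 h] - '[W2 h, W2 h]) by apply: ler_wpM2r => //; exact: ltW.
  have h2 : M * '[h, h] <= L * '[h, h] by rewrite ler_wpM2r ?dot_ge0.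
  by move: h1; rewrite !mulrBr; lra.
have bQ : bd m L Q.
  split=> // h; apply/andP; split; first exact: le_trans (lowT h) (TQ h).
  rewrite qQ qR qC; have /andP[_ h0] := hC0 (Y h).
  have h1 : m * ('[h, h] - '[W1 h, W1 h] - '[W2 h, W2 h]) <=
      L * ('[h, h] - '[W1 h, W1 h] - '[W2 h, W2 h]) by apply: ler_wpM2r => //; exact: ltW.
  have h2 : (M + d) * '[Y h, Y h] <= L * '[Y h, Y h].
    by rewrite ler_wpM2r ?dot_ge0.
  have h3 : lam * '[Z h, Z h] <= L * '[Z h, Z h].
    by rewrite ler_wpM2r ?dot_ge0.
  have h4 : L * '[Y h, Y h] + L * '[Z h, Z h] = L * '[W1 h, W1 h] + L * '[W2 h, W2 h].
    by rewrite -!mulrDr YZ.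
  by move: h1 h2 h3 h4; clearbody L lam; rewrite !mulrBr (mulrDl M d); lra.
have TV1 i : (i <= n)%N -> T (V1 (iter i A x)) = V1 (iter i.+1 A x).
  move=> hi; have [e1 _] := hs _ (inA i hi); have [_ e2] := hz (iter i A x).
  rewrite TE RE e1 e2 (linA_0 (sa_lin sB)) (linA_0 lV2) addr0.
  by rewrite scaler0 subr0 subrr addr0.
have TV2 i : (i <= n)%N -> T (V2 (iter i B x)) = V2 (iter i.+1 B x).
  move=> hi; have [_ e1] := hs _ (inB i hi); have [e2 _] := hz (iter i B x).
  rewrite TE RE e1 e2 (linA_0 (sa_lin sA)) (linA_0 lV1) add0r.
  by rewrite scaler0 subr0 subrr addr0.
have QVY i : (i <= n)%N -> Q (VY (iter i C x)) = VY (iter i.+1 C x).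
  move=> hi; have [e1 e2] := hs _ (inC i hi); have [e3 e4] := hz (iter i C x).
  set k := iter i C x in e1 e2 e3 e4 *.
  have w1 : W1 (VY k) = c%:C *: k.
    by rewrite VYE (linA_D lW1) !(linA_Z lW1) e1 e3 scaler0 addr0.
  have w2 : W2 (VY k) = s%:C *: k.
    by rewrite VYE (linA_D lW2) !(linA_Z lW2) e2 e4 scaler0 add0r.
  have y1 : Y (VY k) = k.
    by rewrite YE w1 w2 !scalerA -!rmorphM -scalerDl -rmorphD -!expr2 cs1 scale1r.
  have z1 : Z (VY k) = 0.
    by rewrite ZE w1 w2 !scalerA -!rmorphM mulrC subrr.
  rewrite QE RE y1 z1 w1 w2 /scal scaler0 (linA_0 lVZ) addr0 (linA_Z lV1) (linA_Z lV2).
  by rewrite -addrA -opprD -scalerDr -VYE subrr addr0.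
have hn : (size p <= n)%N by [].
have pT1 : poly_op p T (V1 x) = V1 (poly_op p A x).
  by apply: (poly_op_intertwine lV1 hn) => i /ltnW; exact: TV1.
have pT2 : poly_op p T (V2 x) = V2 (poly_op p B x).
  by apply: (poly_op_intertwine lV2 hn) => i /ltnW; exact: TV2.
have pQ : poly_op p Q (VY x) = VY (poly_op p C x).
  by apply: (poly_op_intertwine lVY hn) => i /ltnW; exact: QVY.
have [x1 x2] := hs _ (inA 0%N isT).
have v11 u : '[V1 u, V1 x] = '[u, x] by rewrite dotC -adj1 x1 dotC.
have v22 u : '[V2 u, V2 x] = '[u, x] by rewrite dotC -adj2 x2 dotC.
have v12 u : '[V1 u, V2 x] = 0 by rewrite -adj2 (hz u).2 dot0l.
have v21 u : '[V2 u, V1 x] = 0 by rewrite -adj1 (hz u).1 dot0l.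
have vyy u v : '[c%:C *: V1 u + s%:C *: V2 v, VY x] = (1 - t) * '[u, x] + t * '[v, x].
  by rewrite VYE; dots; rewrite v11 v12 v21 v22 -c2 -s2; ring.
have ny : '[VY x, VY x] = '[x, x] by rewrite {1}VYE vyy -mulrDl subrK mul1r.
have fT : '[poly_op p T (VY x), VY x] = (1 - t) * '[poly_op p A x, x] + t * '[poly_op p B x, x].
  have lp := sa_lin (poly_op_sa p sT).
  by rewrite -vyy VYE (linA_D lp) !(linA_Z lp) pT1 pT2.
have fQ : '[poly_op p Q (VY x), VY x] = '[poly_op p C x, x].
  by rewrite pQ {1}VYE vyy -mulrDl subrK mul1r.
have ht := hH m L T Q m0 mL bT bQ TQ (VY x).
have app (D : H -> H) y : bd m L D ->
    `|'[poly_op p D y, y] - '[cfc f D y, y]| <= e * '[y, y].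
  by move=> bD; apply: form_approx; have [_] := cfcP mL bD (cpos L); apply=> //; exact: ltW.
have bAL : bd m L A by exact: bd_weaken bA (lexx _) ML.
have bBL : bd m L B by exact: bd_weaken bB (lexx _) ML.
have bCL : bd m L C.
  split=> // h; rewrite qC; have /andP[g1 g2] := hC0 h.
  have h2 : (M + d) * '[h, h] <= L * '[h, h].
    by rewrite ler_wpM2r ?dot_ge0.
  have h3 : 0 <= d * '[h, h] by rewrite mulr_ge0 ?dot_ge0 // ltW.
  by apply/andP; split; [clear -g1 h3; lra|move: h2; rewrite (mulrDl M d); clear -g2; lra].
have := app _ (VY x) bT; have := app _ (VY x) bQ; have := app _ x bAL.
have := app _ x bBL; have := app _ x bCL; have := fC x.
rewrite fT fQ ny !ler_norml.
move=> g0 /andP[g1 g2] /andP[g3 g4] /andP[g5 g6] /andP[g7 g8] /andP[g9 g10].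
have g11 : (1 - t) * ('[cfc f A x, x] - '[poly_op p A x, x]) <= (1 - t) * (e * '[x, x]).
  by rewrite ler_wpM2l ?subr_ge0 //; clear -g5 g6; lra.
have g12 : t * ('[cfc f B x, x] - '[poly_op p B x, x]) <= t * (e * '[x, x]).
  by rewrite ler_wpM2l //; clear -g3 g4; lra.
rewrite -/C0; move: g11 g12; rewrite !mulrBr; clear -ht g0 g1 g2 g7 g8 g9 g10; lra.
Qed.
End Transfer.

(** * Order, inversion and midpoint inequalities *)

Section OrderLemmas.
Context {R : realType} {H : hilbertType R}.
Implicit Types (A B X Y : H -> H) (x y : H) (m M : R) (f g : R -> R).

Lemma op_le_form A B x : op_le A B -> '[A x, x] <= '[B x, x].
Proof. by move=> /positiveP[_ /(_ x)]; rewrite [(_ - _) x](_ : _ = B x - A x) // dotBl subr_ge0. Qed.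

Lemma spos_bd A : strictly_positive A -> exists m M, [/\ 0 < m, m < M & bd m M A].
Proof.
case/strictly_positiveP=> m [M [m0 mM bA]]; exists m, (M + 1); split=> //; first by lra.
by apply: bd_weaken bA _ _ => //; lra.
Qed.
Lemma bd_spos m M A : 0 < m -> bd m M A -> strictly_positive A.
Proof.
move=> m0 bA; apply/strictly_positiveP; exists m, (Num.max m M); split=> //.
  by rewrite le_max lexx.
by apply: bd_weaken bA _ _ => //; rewrite le_max lexx orbT.
Qed.
Lemma spos_bd2 A B : strictly_positive A -> strictly_positive B ->
  exists m M, [/\ 0 < m, m < M, bd m M A & bd m M B].
Proof.
move=> /spos_bd[m [M [m0 mM bA]]] /spos_bd[m' [M' [m0' mM' bB]]].
exists (Num.min m m'), (Num.max M M'); split.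
- by rewrite lt_min m0.
- by apply: le_lt_trans (_ : m < _); rewrite ?ge_min ?lexx // lt_max mM.
- by apply: bd_weaken bA _ _; rewrite ?ge_min ?le_max lexx.
- by apply: bd_weaken bB _ _; rewrite ?ge_min ?le_max lexx orbT.
Qed.

Lemma arith_meanE t A B x : arith_mean t A B x = (1 - t)%:C *: A x + t%:C *: B x.
Proof. by []. Qed.
Lemma arith_form t A B x : '[arith_mean t A B x, x] = (1 - t) * '[A x, x] + t * '[B x, x].
Proof. by rewrite arith_meanE dotDl !dotZl. Qed.
Lemma bd_arith t m M A B : 0 <= t <= 1 -> bd m M A -> bd m M B -> bd m M (arith_mean t A B).
Proof.
move=> /andP[t0 t1] [sA hA] [sB hB]; split=> [|h].
  by apply: selfadjoint_add; apply: selfadjoint_scale.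
rewrite arith_form; have /andP[? ?] := hA h; have /andP[? ?] := hB h.
by apply/andP; split; nra.
Qed.
Lemma selfadjoint_arith t A B : selfadjoint A -> selfadjoint B -> selfadjoint (arith_mean t A B).
Proof. by move=> sA sB; apply: selfadjoint_add; apply: selfadjoint_scale. Qed.

Lemma half01 : 0 <= (2^-1 : R) <= 1.
Proof. by rewrite invr_ge0 ler0n invf_le1 ?ler1n. Qed.
Lemma half_ge0 : 0 <= 2^-1 :> R. Proof. by case/andP: half01. Qed.
Lemma half_lt1 : 2^-1 < 1 :> R. Proof. by rewrite invf_lt1 ?ltr1n. Qed.
Lemma half_compl : 1 - 2^-1 = 2^-1 :> R. Proof. by lra. Qed.

Lemma arith_spos t A B : 0 <= t <= 1 -> strictly_positive A -> strictly_positive B ->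
  strictly_positive (arith_mean t A B).
Proof.
move=> t01 pA pB; have [m [M [m0 _ bA bB]]] := spos_bd2 pA pB.
exact: bd_spos m0 (bd_arith t01 bA bB).
Qed.

Lemma op_invK m M A : bd m M A -> 0 < m -> op_inv (op_inv A) = A.
Proof.
move=> bA m0; have [bB h1 h2] := op_inv_spec (coercive_inverse bA m0).
by apply: op_inv_eq; split=> //; exact/sa_bop/bd_sa/bA.
Qed.
(** With u = B^-1 x and v = A^-1 x, Cauchy-Schwarz for the form of A gives
    <x, u>^2 <= <x, v> <A u, u>, and <A u, u> <= <B u, u> = <x, u>. *)
Lemma inv_antitone m M A B x : bd m M A -> bd m M B -> 0 < m -> 0 < M ->
  (forall y, '[A y, y] <= '[B y, y]) -> '[op_inv B x, x] <= '[op_inv A x, x].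
Proof.
move=> bA bB m0 M0 AB; have [bA' [hA _]] := bd_inv bA m0 M0; have [bB' [hB _]] := bd_inv bB m0 M0.
set u := op_inv B x; set v := op_inv A x.
have Av : A v = x by exact: hA.
have Bu : B u = x by exact: hB.
have u0 : 0 <= '[u, x].
  by have [_ /(_ x)/andP[+ _]] := bB'; apply: le_trans; rewrite mulr_ge0 ?dot_ge0 // invr_ge0 ltW.
have := pos_CS v u (bd_pos bA (ltW m0)); rewrite Av.
have : '[A u, u] <= '[u, x] by rewrite -[X in '[u, X]]Bu (dotC u); exact: AB.
have v0 : 0 <= '[v, x].
  by have [_ /(_ x)/andP[+ _]] := bA'; apply: le_trans; rewrite mulr_ge0 ?dot_ge0 // invr_ge0 ltW.
rewrite (dotC x u) (dotC x v) => h1 h2.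
have h3 : '[u, x] * '[u, x] <= '[v, x] * '[u, x].
  by rewrite -expr2; apply: le_trans h2 _; rewrite ler_wpM2l.
have [->|un] := eqVneq '[u, x] 0; first by [].
by move: h3; rewrite ler_pM2r // lt_neqAle eq_sym un.
Qed.

Lemma pos_bounds f m M : (forall t : R, 0 < t -> 0 < f t) -> (forall t : R, 0 < t -> cont_at f t) ->
  0 < m -> exists a b : R, [/\ 0 < a, a < b & forall t, m <= t <= M -> a <= f t <= b].
Proof.
move=> fp fc m0.
have pos t : m <= t <= M -> 0 < t by case/andP=> h _; apply: lt_le_trans h.
have [|b b0 hb] := @interval_bounded _ f m M; first by move=> t /pos; exact: fc.
have [|c c0 hc] := @interval_bounded _ (fun t => (f t)^-1) m M.
  by move=> t /pos t0; apply: cont_inv; [rewrite gt_eqF ?fp|exact: fc].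
exists c^-1, (Num.max b c^-1 + 1); split=> [||t ht]; first by rewrite invr_gt0.
  by apply: le_lt_trans (_ : Num.max b c^-1 < _); rewrite ?le_max ?lexx ?orbT // ltrDl.
have f0 := fp _ (pos _ ht); apply/andP; split.
  rewrite -[f t]invrK lef_pV2 ?posrE ?invr_gt0 //.
  exact: le_trans (ler_norm _) (hc _ ht).
apply: le_trans (ler_norm _) _; apply: le_trans (hb _ ht) _.
by apply: le_trans (_ : Num.max b c^-1 <= _); rewrite ?le_max ?lexx // lerDl.
Qed.
Lemma cfc_spos f A : (forall t : R, 0 < t -> 0 < f t) -> (forall t : R, 0 < t -> cont_at f t) ->
  strictly_positive A -> strictly_positive (cfc f A).
Proof.
move=> fp fc /spos_bd[m [M [m0 mM bA]]].
have [a [b [a0 _ hab]]] := pos_bounds M fp fc m0.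
apply: (@bd_spos a b) => //; apply: (cfc_bd mM bA) => // t /andP[h _].
by apply: fc; apply: lt_le_trans h.
Qed.
Lemma cfc_op_inv m M A : 0 < m -> m < M -> bd m M A -> cfc (fun t => t^-1) A = op_inv A.
Proof.
move=> m0 mM bA; apply: esym; apply: op_inv_eq.
have := @cfc_inverse _ _ m M A mM bA id m M; rewrite (cfc_id mM bA); apply=> // t _.
exact: cont_id.
Qed.
Lemma cfc_at_inv f m M A : (forall t : R, 0 < t -> cont_at f t) -> 0 < m -> m < M -> bd m M A ->
  cfc f (op_inv A) = cfc (fun t => f t^-1) A.
Proof.
move=> fc m0 mM bA; rewrite -(cfc_op_inv m0 mM bA).
have M0 : 0 < M := lt_trans m0 mM.
apply: (cfc_comp mM bA (m' := M^-1) (M' := m^-1)).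
- by rewrite ltf_pV2.
- by move=> t /andP[h _]; apply: cont_inv (cont_id _); rewrite gt_eqF // (lt_le_trans m0).
- by move=> t /andP[h1 h2]; rewrite !lef_pV2 ?posrE // ?(lt_le_trans m0) // h1 h2.
- by move=> t /andP[h _]; apply: fc; apply: lt_le_trans h; rewrite invr_gt0.
Qed.

(** Conjugating f by inversion exchanges arithmetic and harmonic means. *)
Definition inv_dual f : R -> R := fun t => (f t^-1)^-1.
Lemma inv_dual_pos f : (forall t : R, 0 < t -> 0 < f t) -> forall t : R, 0 < t -> 0 < inv_dual f t.
Proof. by move=> fp t t0; rewrite invr_gt0 fp // invr_gt0. Qed.
Lemma cont_at_inv_arg f : (forall t : R, 0 < t -> cont_at f t) -> forall x : R, 0 < x -> cont_at (fun t => f t^-1) x.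
Proof.
move=> fc x x0; apply: (cont_comp (h := fun t => t^-1)); last by apply: fc; rewrite invr_gt0.
by apply: cont_inv (cont_id _); rewrite gt_eqF.
Qed.
Lemma inv_dual_cont f : (forall t : R, 0 < t -> 0 < f t) -> (forall t : R, 0 < t -> cont_at f t) ->
  forall x : R, 0 < x -> cont_at (inv_dual f) x.
Proof.
move=> fp fc x x0; apply: cont_inv; last exact: cont_at_inv_arg.
by rewrite gt_eqF // fp // invr_gt0.
Qed.
Lemma cfc_inv_dual f m M A : (forall t : R, 0 < t -> 0 < f t) -> (forall t : R, 0 < t -> cont_at f t) ->
  0 < m -> m < M -> bd m M A -> cfc (inv_dual f) A = op_inv (cfc f (op_inv A)).
Proof.
move=> fp fc m0 mM bA; rewrite (cfc_at_inv fc m0 mM bA); apply/esym/op_inv_eq.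
have fp' (t : R) : 0 < t -> 0 < f t^-1 by move=> t0; rewrite fp // invr_gt0.
have [a [b [a0 _ hab]]] := pos_bounds M fp' (cont_at_inv_arg fc) m0.
apply: (cfc_inverse mM bA _ a0 hab) => t /andP[h _].
by apply: cont_at_inv_arg => //; apply: lt_le_trans h.
Qed.
Lemma monotone_inv_dual f : (forall t : R, 0 < t -> 0 < f t) -> (forall t : R, 0 < t -> cont_at f t) ->
  monotone_on H f -> monotone_on H (inv_dual f).
Proof.
move=> fp fc hf m M A B m0 mM bA bB AB x.
have M0 := lt_trans m0 mM.
rewrite !(cfc_inv_dual fp fc m0 mM) //.
have [bA' _] := bd_inv bA m0 M0; have [bB' _] := bd_inv bB m0 M0.
have Mi : 0 < M^-1 by rewrite invr_gt0.
have mMi : M^-1 < m^-1 by rewrite ltf_pV2.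
have [a [b [a0 ab hab]]] := pos_bounds m^-1 fp fc Mi.
have hc t : M^-1 <= t <= m^-1 -> cont_at f t by case/andP=> h _; apply: fc; apply: lt_le_trans h.
apply: (@inv_antitone a b _ _ x _ _ a0 (lt_trans a0 ab)); try exact: (cfc_bd mMi).
by apply: (hf _ _ _ _ Mi mMi bB' bA') => z; exact: (inv_antitone z bA bB m0 M0 AB).
Qed.

(** If F is convex at the midpoint A + D of A and A + 2 D and bounded above,
    then iterating F(A + D) <= (F(A) + F(A + 2 D)) / 2 leaves F(A) as the only
    contribution: a bounded convex function on a half-line does not increase. *)
Lemma midpoint_antitone A B (F : (H -> H) -> R) (K : R) : selfadjoint A -> selfadjoint B ->
  (forall x, '[A x, x] <= '[B x, x]) ->
  (forall D, positive D -> F (A + D) <= 2^-1 * (F A + F (A + 2%:C *: D))) ->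
  (forall D, positive D -> F (A + D) <= K) -> F B <= F A.
Proof.
move=> sA sB AB mid hK.
have key n D : positive D -> F (A + D) <= (1 - 2^-1 ^+ n) * F A + 2^-1 ^+ n * K.
  elim: n D => [|n IH] D pD; first by rewrite expr0 subrr mul0r add0r mul1r hK.
  by have := IH _ (positive_scale (ler0n R 2) pD); have := mid _ pD; rewrite exprS; lra.
have BE : B = A + (B - A) by rewrite addrC subrK.
apply: (@le_eps _ _ _ `|K - F A|) => e e0.
have [N hN] := @expr_small R 2^-1 e half_ge0 half_lt1 e0.
have pD : positive (B - A) by apply/(op_leP sA sB).
have := key N _ pD; rewrite -BE.
have w0 : 0 <= 2^-1 ^+ N :> R by rewrite exprn_ge0 // half_ge0.
have := ler_wpM2r (normr_ge0 (K - F A)) (hN N (leqnn _)).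
have := ler_wpM2l w0 (ler_norm (K - F A)); lra.
Qed.

Lemma arith_midpoint A D : arith_mean 2^-1 A (A + 2%:C *: D) = A + D.
Proof.
apply/funext => y; rewrite arith_meanE half_compl.
rewrite [(A + _) y](_ : _ = A y + 2%:C *: D y) // [RHS](_ : _ = A y + D y) //.
by apply: eq_dot => z; dots; lra.
Qed.

Lemma bd_shift m M A D : bd m M A -> positive D -> exists2 M', m < M' & bd m M' (A + D).
Proof.
move=> [sA hA] pD; have sAD := selfadjoint_add sA (pos_sa pD).
have low y : m * '[y, y] <= '[(A + D) y, y].
  rewrite [(A + D) y](_ : _ = A y + D y) // dotDl.
  by have /andP[h _] := hA y; have := pos_ge0 y pD; lra.
have [M' hM' b] := bd_upper sAD low; exists (M' + 1).
  by apply: le_lt_trans (_ : M' < _); [apply: le_trans hM'; rewrite le_max lexx orbT|lra].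
by apply: bd_weaken b _ _ => //; lra.
Qed.

(** Minus a positive function is bounded above by zero. *)
Lemma midconcave_monotone f : (forall t : R, 0 < t -> 0 < f t) -> (forall t : R, 0 < t -> cont_at f t) ->
  (forall A B, strictly_positive A -> strictly_positive B -> forall x,
     '[arith_mean 2^-1 (cfc f A) (cfc f B) x, x] <= '[cfc f (arith_mean 2^-1 A B) x, x]) ->
  monotone_on H f.
Proof.
move=> fp fc hf m M A B m0 mM bA bB AB x.
have spD D (pD : positive D) : strictly_positive (A + D).
  by have [M' _ b] := bd_shift bA pD; exact: bd_spos b.
rewrite -lerN2; apply: (midpoint_antitone (F := fun E => - '[cfc f E x, x]) (K := 0) (bd_sa bA) (bd_sa bB)) => // D pD.
  have := hf A (A + 2%:C *: D) (bd_spos m0 bA) (spD _ (positive_scale (ler0n R 2) pD)) x.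
  by rewrite arith_midpoint arith_form half_compl; lra.
by rewrite oppr_le0; apply: pos_ge0; exact: (cfc_spos fp fc (spD _ pD)).1.
Qed.

Lemma bounded_midconvex_antitone g : (forall t : R, 0 < t -> cont_at g t) ->
  (forall a, 0 < a -> exists C, forall t : R, a <= t -> g t <= C) ->
  (forall A B, strictly_positive A -> strictly_positive B -> forall x,
     '[cfc g (arith_mean 2^-1 A B) x, x] <= '[arith_mean 2^-1 (cfc g A) (cfc g B) x, x]) ->
  forall m M A B, 0 < m -> m < M -> bd m M A -> bd m M B ->
  (forall x, '[A x, x] <= '[B x, x]) -> forall x, '[cfc g B x, x] <= '[cfc g A x, x].
Proof.
move=> gc gb hg m M A B m0 mM bA bB AB x; have [C hC] := gb m m0.
apply: (midpoint_antitone (F := fun E => '[cfc g E x, x]) (K := C * '[x, x]) (bd_sa bA) (bd_sa bB)) => // D pD.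
  have [M' _ b] := bd_shift bA (positive_scale (ler0n R 2) pD).
  have := hg A (A + 2%:C *: D) (bd_spos m0 bA) (bd_spos m0 b) x.
  by rewrite arith_midpoint arith_form half_compl; lra.
have [M' mM' b] := bd_shift bA pD.
rewrite -dotZl -[_%:C *: x]/(scal C x) -(cfc_cst mM' b).
apply: (cfc_le mM' b) => [t /andP[h _]|t _|t /andP[h _]]; last exact: hC.
  by apply: gc; apply: lt_le_trans h.
exact: cont_cst.
Qed.
End OrderLemmas.

(** * Rank-one perturbations of scalars *)

Section RankOne.
Context {R : realType} {H : hilbertType R}.
Implicit Types (A B : H -> H) (x y p q u v : H) (z : R[i]).

Definition sqmod z : R := Re z ^+ 2 + Im z ^+ 2.
Lemma sqmod_ge0 z : 0 <= sqmod z. Proof. by rewrite addr_ge0 ?sqr_ge0. Qed.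
Lemma sqmodC z : sqmod (Num.conj z) = sqmod z.
Proof. by case: z => a b; rewrite /sqmod /= sqrrN. Qed.
Lemma sqmod_real (r : R) : sqmod r%:C = r ^+ 2.
Proof. by rewrite /sqmod /= expr0n addr0. Qed.
Lemma sqmod0 : sqmod 0 = 0. Proof. exact: (etrans (sqmod_real 0) (expr0n _ 2)). Qed.
Lemma sqmod1 : sqmod 1 = 1. Proof. exact: (etrans (sqmod_real 1) (expr1n _ 2)). Qed.
Lemma Re_mul_conj z : Re (z * Num.conj z) = sqmod z.
Proof. by case: z => a b; rewrite /sqmod /=; ring. Qed.
Lemma dot_cscale z x y : '[z *: x, z *: y] = sqmod z * '[x, y].
Proof.
rewrite /dotr innerZl innerZr; case: z => a b; case: (inner H x y) => c d.
by rewrite /sqmod /=; ring.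
Qed.
(** The form inequality bounds only a real part; multiplying x by the conjugate
    of <A x, y> makes that number real. *)
Lemma pos_CSc A x y : positive A -> sqmod (inner H (A x) y) <= '[A x, x] * '[A y, y].
Proof.
move=> pA; set z := inner H (A x) y; set w := sqmod z.
have lA := sa_lin (pos_sa pA).
have := pos_CS (Num.conj z *: x) y pA.
have -> : '[A (Num.conj z *: x), y] = w.
  by rewrite (linA_Z lA) /dotr innerZl mulrC Re_mul_conj.
rewrite (linA_Z lA) dot_cscale sqmodC -/w -mulrA expr2 => h.
have [w0|w0] := eqVneq w 0; first by rewrite w0 mulr_ge0 // pos_ge0.
by move: h; rewrite ler_pM2l // lt_neqAle eq_sym w0 sqmod_ge0.
Qed.
Definition rk v : H -> H := fun x => inner H x v *: v.
Lemma rk_form v x : '[rk v x, x] = sqmod (inner H x v).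
Proof. by rewrite /rk /dotr innerZl (innerC v x) Re_mul_conj. Qed.
Lemma rk_le v x : sqmod (inner H x v) <= '[x, x] * '[v, v].
Proof. exact: (pos_CSc x v pos_id). Qed.
Lemma rk_sa v : selfadjoint (rk v).
Proof.
apply: saP => [|x y]; last first.
  by rewrite /dotr /rk innerZl innerZr -innerC mulrC.
apply/bopP; split=> [c x y|]; first by rewrite /rk innerDl innerZl scalerDl scalerA.
exists '[v, v] => [|x]; first exact: dot_ge0.
rewrite nrm_le ?mulr_ge0 ?dot_ge0 ?nrm_ge0 // /rk dot_cscale exprMn nrm_sqr.
rewrite [leRHS](_ : _ = '[x, x] * '[v, v] * '[v, v]); last by ring.
by rewrite ler_wpM2r ?dot_ge0 // rk_le.
Qed.
Lemma rk_pos v : positive (rk v).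
Proof. by apply/positiveP; split=> [|x]; [exact: rk_sa|rewrite rk_form sqmod_ge0]. Qed.

(** An eigenvector u bounds A below by c times the projection onto u. *)
Lemma eigen_lower A (c : R) u x : positive A -> 0 <= c -> A u = c%:C *: u ->
  c * sqmod (inner H u x) <= '[A x, x] * '[u, u].
Proof.
move=> pA c0 Au; have := pos_CSc u x pA; rewrite Au innerZl dotZl.
have -> : sqmod (c%:C * inner H u x) = c * (c * sqmod (inner H u x)).
  by case: (inner H u x) => a b; rewrite /sqmod /=; ring.
have [->|cn] := eqVneq c 0; first by rewrite !mul0r mulr_ge0 ?dot_ge0 ?pos_ge0.
have cp : 0 < c by rewrite lt_neqAle eq_sym cn.
by move=> h; rewrite -(ler_pM2l cp); apply: le_trans h _; rewrite (mulrC '[A x, x]) mulrA.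
Qed.

(** The operator with eigenvalue G along p and s on the complement of p.
    Functions of it are explicit, and two of them in different directions p and
    q do not commute: this is the test family for all means. *)
Definition spike (s G : R) p : H -> H := scal s + (G - s)%:C *: rk p.
Lemma spikeE s G p x : spike s G p x = s%:C *: x + (G - s)%:C *: (inner H x p *: p).
Proof. by []. Qed.
Lemma spike_form s G p x : '[spike s G p x, x] = s * '[x, x] + (G - s) * sqmod (inner H x p).
Proof. by rewrite spikeE dotDl !dotZl -rk_form. Qed.
Lemma spike_sa s G p : selfadjoint (spike s G p).
Proof. by apply: selfadjoint_add; [exact: selfadjoint_scal|exact/selfadjoint_scale/rk_sa]. Qed.
Lemma spike_bd s G p m M : inner H p p = 1 -> m <= s <= M -> m <= G <= M -> bd m M (spike s G p).
Proof.
move=> p1 /andP[ms sM] /andP[mG GM]; split=> [|x]; first exact: spike_sa.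
have pp : '[p, p] = 1 by rewrite /dotr p1.
have h1 := sqmod_ge0 (inner H x p); have h2 := rk_le p x; rewrite pp mulr1 in h2.
by rewrite spike_form; apply/andP; split; nra.
Qed.
Lemma spike_spos s G p : inner H p p = 1 -> 0 < s -> 0 < G -> strictly_positive (spike s G p).
Proof.
move=> p1 s0 G0; apply: (@bd_spos _ _ (Num.min s G) (Num.max s G)); first by rewrite lt_min s0.
by apply: spike_bd; rewrite // ge_min le_max lexx ?orbT.
Qed.
Lemma spike_at s G p : inner H p p = 1 -> spike s G p p = G%:C *: p.
Proof. by move=> p1; rewrite spikeE p1 scale1r -scalerDl -rmorphD addrC subrK. Qed.
Lemma spike_ortho s G p x : inner H x p = 0 -> spike s G p x = s%:C *: x.
Proof. by move=> h; rewrite spikeE h scale0r scaler0 addr0. Qed.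
Lemma cfc_spike g (s G : R) p : (forall t : R, 0 < t -> cont_at g t) -> inner H p p = 1 ->
  0 < s -> 0 < G -> cfc g (spike s G p) = spike (g s) (g G) p.
Proof.
move=> gc p1 s0 G0; set A := spike s G p.
pose m := Num.min s G; pose M := Num.max s G + 1.
have m0 : 0 < m by rewrite lt_min s0.
have mM : m < M.
  by apply: le_lt_trans (_ : Num.max s G < _); rewrite ?le_max ?ge_min ?lexx // ltrDl.
have bA : bd m M A.
  have h : Num.max s G <= M by rewrite lerDl.
  apply: spike_bd => //; rewrite ge_min lexx ?orbT /=; apply: le_trans h; by rewrite le_max lexx ?orbT.
have hc t : m <= t <= M -> cont_at g t by case/andP=> h _; apply: gc; apply: lt_le_trans h.
have p0 := unit_neq0 p1.
have l := sa_lin (cfc_sa mM bA hc).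
apply/funext => x; pose y := x - inner H x p *: p.
have yp : inner H y p = 0 by rewrite innerBl innerZl p1 mulr1 subrr.
have gy : cfc g A y = (g s)%:C *: y.
  have [->|y0] := eqVneq y 0; first by rewrite (linA_0 l) scaler0.
  by apply: (cfc_eigen mM bA) => //; exact: spike_ortho.
have gp : cfc g A p = (g G)%:C *: p by apply: (cfc_eigen mM bA) => //; exact: spike_at.
have xE : x = y + inner H x p *: p by rewrite subrK.
rewrite {1}xE (linA_D l) (linA_Z l) gy gp spikeE /y.
by rewrite [inner H x p *: (_ *: _)]scalerA mulrC -scalerA; set w := inner H x p *: p; vec.
Qed.
End RankOne.

(** * Mean inequalities force monotonicity *)

Section Growth.
Context {R : realType}.
(** Write 2^-1 = mu^m with m so large that r^m K0 <= 2^-1.  Then m steps of the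
    first inequality, from 2 l down to l, and one doubling give
    h(l) <= r^m h(2 l) + cst <= h(l) / 2 + cst. *)
Lemma growth_bounded (h : R -> R) (r K0 C0 : R) :
  (forall l : R, 0 < l -> 0 <= h l) -> 0 <= r -> r < 1 -> 0 <= K0 ->
  (forall mu : R, 0 < mu -> mu < 1 -> exists C : R, forall l : R, 0 < l -> h (mu * l) <= r * h l + C) ->
  (forall l : R, 0 < l -> h (2 * l) <= K0 * h l + C0) ->
  exists B : R, forall l : R, 0 < l -> h l <= B.
Proof.
move=> h0 r0 r1 K00 hmu h2.
have K1 : 0 < 2 * (K0 + 1) by lra.
have [N hN] := expr_small r0 r1 (ltac:(by rewrite invr_gt0) : 0 < (2 * (K0 + 1))^-1).
pose m := N.+1; have rm : r ^+ m * K0 <= 2^-1.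
  have := hN m (leqnSn N); rewrite -(ler_pM2r K1) mulVf ?gt_eqF // => h3.
  have : 0 <= r ^+ m by rewrite exprn_ge0.
  by lra.
have rm1 : r ^+ m <= 1 by rewrite exprn_ile1 // ltW.
pose mu : R := 2^-1 `^ (m%:R^-1).
have half0 : 0 < 2^-1 :> R by rewrite invr_gt0.
have mum : mu ^+ m = 2^-1.
  by rewrite -powR_mulrn ?powR_ge0 // -powRrM mulVf ?pnatr_eq0 // powRr1 // ltW.
have mu0 : 0 < mu by exact: powR_gt0.
have mu1 : mu < 1.
  rewrite ltNge; apply/negP => mu1; have := exprn_ege1 m mu1; rewrite mum.
  by rewrite leNgt invf_lt1 ?ltr1n.
have [C hC] := hmu mu mu0 mu1.
have it k l : 0 < l -> h (mu ^+ k * l) <= r ^+ k * h l + k%:R * `|C|.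
  move=> l0; elim: k => [|k IH]; first by rewrite !expr0 !mul1r mul0r addr0.
  have lk : 0 < mu ^+ k * l by rewrite mulr_gt0 // exprn_gt0.
  rewrite exprS -mulrA; apply: le_trans (hC _ lk) _.
  have := ler_wpM2l r0 IH; rewrite mulrDr mulrA -exprS => h3.
  apply: le_trans (lerD h3 (ler_norm C)) _; rewrite -addrA lerD2l -natr1 mulrDl mul1r lerD2r.
  by rewrite ler_piMl ?mulr_ge0 // ltW.
exists (2 * (`|C0| + m%:R * `|C|)) => l l0.
have l2 : 0 < 2 * l by rewrite mulr_gt0.
have := it m _ l2; rewrite mum mulrA mulVf ?pnatr_eq0 // mul1r => h3.
have h4 : r ^+ m * h (2 * l) <= r ^+ m * (K0 * h l + C0).
  by rewrite ler_wpM2l ?exprn_ge0 // h2.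
have h5 : r ^+ m * C0 <= `|C0|.
  apply: le_trans (ler_norm _) _; rewrite normrM ger0_norm ?exprn_ge0 // ler_piMl //.
have h6 : r ^+ m * K0 * h l <= 2^-1 * h l by rewrite ler_wpM2r ?h0.
move: h4; rewrite mulrDr mulrA => h4; lra.
Qed.
End Growth.

Section MeanInequality.
Context {R : realType} {H : hilbertType R}.
Implicit Types (tau : (H -> H) -> (H -> H) -> H -> H) (f g : R -> R) (A B : H -> H) (x : H).

(** For two spikes of height G the arithmetic mean has form c^2 G + O(1) at e1.
    A mean is damped if it grows with a slope r < 1 which does not depend on the
    angle between the two directions: as c tends to 1, where the spikes tend to
    be parallel, the arithmetic mean has slopes tending to 1.  It is
    through this property that a mean is told from the arithmetic one. *)
Definition damped tau : Prop := exists r : R, [/\ 0 <= r, r < 1 &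
  forall e1 e2 : H, inner H e1 e1 = 1 -> inner H e2 e2 = 1 -> inner H e1 e2 = 0 ->
  forall c d s : R, 0 < c -> 0 < d -> c ^+ 2 + d ^+ 2 = 1 -> 0 < s ->
  exists C, forall G : R, 0 < G ->
    '[tau (spike s G (c%:C *: e1 + d%:C *: e2)) (spike s G (c%:C *: e1 - d%:C *: e2)) e1, e1]
      <= r * G + C].

Variables (tau : (H -> H) -> (H -> H) -> H -> H) (g : R -> R).
Hypothesis Hinf : infinite_dimensional H.
Hypothesis gp : forall t : R, 0 < t -> 0 < g t.
Hypothesis gc : forall t : R, 0 < t -> cont_at g t.
Hypothesis tau_le : forall A B, strictly_positive A -> strictly_positive B ->
  forall x, '[tau A B x, x] <= '[arith_mean 2^-1 A B x, x].
Hypothesis tau_damped : damped tau.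
Hypothesis hg : forall A B, strictly_positive A -> strictly_positive B ->
  forall x, '[cfc g (arith_mean 2^-1 A B) x, x] <= '[tau (cfc g A) (cfc g B) x, x].

Lemma mean_inequality_convex A B : strictly_positive A -> strictly_positive B ->
  forall x, '[cfc g (arith_mean 2^-1 A B) x, x] <= '[arith_mean 2^-1 (cfc g A) (cfc g B) x, x].
Proof.
by move=> pA pB x; apply: le_trans (hg pA pB x) _; apply: tau_le; exact: cfc_spos.
Qed.

(** Let h(l) = g(a + l).  The average of two spikes of height l, at angle given by
    c^2 = mu, has e1 as eigenvector for the eigenvalue a + mu l, and damping
    gives h(mu l) <= r h(l) + C with one r < 1 for all mu < 1.  As g is also
    convex at midpoints, doubling is controlled, h(2 l) <= K0 h(l) + C0, and
    the two estimates force boundedness. *)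
Lemma mean_inequality_bounded (a : R) : 0 < a -> exists C, forall t, a <= t -> g t <= C.
Proof.
move=> a0; have [e he] := infinite_orthonormal 2 Hinf.
pose e1 := e 0%N; pose e2 := e 1%N.
have e11 : inner H e1 e1 = 1 by exact: he.
have e22 : inner H e2 e2 = 1 by exact: he.
have e12 : inner H e1 e2 = 0 by exact: he.
have e21 : inner H e2 e1 = 0 by exact: he.
have d11 : '[e1, e1] = 1 by rewrite /dotr e11.
pose h (l : R) := g (a + l).
have eig (A : H -> H) (b : R) x : strictly_positive A -> A x = b%:C *: x -> x != 0 ->
    cfc g A x = (g b)%:C *: x.
  move=> /spos_bd[m [M [m0 mM bA]]] Ax x0; apply: (cfc_eigen mM bA) => // t /andP[ht _].
  by apply: gc; apply: lt_le_trans ht.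
have e10 := unit_neq0 e11.
have ns (r : R) : 0 < r -> 0 < a + r by move=> r0; lra.
have [r [r0 r1 hr]] := tau_damped.
(* The constants 25 / 2 and 75 / 2 come from the last step: the average of
   spikes of heights 24 / 7 l along e2 and l along (e1 + e2) / sqrt 2 has the
   eigenvector e1 + 7 e2, of squared norm 50, for the eigenvalue a + 2 l, while
   at e1 the first spike is just a. *)
have [] := @growth_bounded _ h r (25 / 2) (75 / 2 * g a).
- by move=> l l0; apply/ltW/gp/ns.
- by [].
- by [].
- by lra.
- move=> mu mu0 mu1; pose c := Num.sqrt mu; pose d := Num.sqrt (1 - mu).
  have c0 : 0 < c by rewrite sqrtr_gt0.
  have d0 : 0 < d by rewrite sqrtr_gt0; lra.
  have c2 : c ^+ 2 = mu by rewrite sqr_sqrtr ?ltW.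
  have d2 : d ^+ 2 = 1 - mu by rewrite sqr_sqrtr //; lra.
  have cd : c ^+ 2 + d ^+ 2 = 1 by rewrite c2 d2; lra.
  have [C hC] := hr e1 e2 e11 e22 e12 c d (g a) c0 d0 cd (gp a0).
  exists C => l l0; have al := ns _ l0.
  set p := c%:C *: e1 + d%:C *: e2 in hC; set q := c%:C *: e1 - d%:C *: e2 in hC.
  have p1 : inner H p p = 1 by rewrite inner_orthonormal // -!expr2 cd.
  have qE : q = c%:C *: e1 + (- d)%:C *: e2 by rewrite /q rmorphN scaleNr.
  have q1 : inner H q q = 1 by rewrite qE inner_orthonormal // -!expr2 sqrrN cd.
  have ep : inner H e1 p = c%:C.
    by rewrite /p innerDr !innerZr !conj_real e11 e12 mulr0 addr0 mulr1.
  have eq : inner H e1 q = c%:C.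
    by rewrite qE innerDr !innerZr !conj_real e11 e12 mulr0 addr0 mulr1.
  pose A := spike a (a + l) p; pose B := spike a (a + l) q.
  have pA : strictly_positive A by exact: spike_spos.
  have pB : strictly_positive B by exact: spike_spos.
  have AB1 : arith_mean 2^-1 A B e1 = (a + mu * l)%:C *: e1.
    rewrite arith_meanE half_compl /A /B !spikeE ep eq /p /q -c2.
    by apply: eq_dot => z; dots; field.
  have := hg pA pB e1; rewrite (eig _ _ _ (arith_spos half01 pA pB) AB1 e10) dotZl d11 mulr1.
  rewrite !cfc_spike // => /le_trans; apply.
  by apply: hC; apply: gp.
- move=> l l0; pose b := (Num.sqrt 2^-1)%:C *: (e1 + e2).
  have s2 : Num.sqrt 2^-1 ^+ 2 = 2^-1 :> R by rewrite sqr_sqrtr // half_ge0.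
  have b1 : inner H b b = 1.
    rewrite /b !(innerDl, innerDr, innerZl, innerZr, conj_real) e11 e12 e21 e22.
    rewrite addr0 add0r !mulr1 mulrDr -rmorphM -expr2 s2 -rmorphD.
    by rewrite (_ : 2^-1 + 2^-1 = 1) ?rmorph1 //; lra.
  pose A := spike a (a + 24 / 7 * l) e2; pose B := spike a (a + l) b.
  have pA : strictly_positive A by apply: spike_spos => //; apply: ns; lra.
  have pB : strictly_positive B by apply: spike_spos => //; apply: ns; lra.
  pose u := e1 + 7%:C *: e2.
  have uu : '[u, u] = 50.
    rewrite /u; dots; rewrite /dotr e11 e12 e21 e22 /=; lra.
  have u0 : u != 0 by apply/eqP => u0; move: uu; rewrite u0 dot0l => /eqP; rewrite eq_sym pnatr_eq0.
  have ue1 : inner H u e1 = 1 by rewrite /u innerDl innerZl e11 e21 mulr0 addr0.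
  have ue2 : inner H u e2 = 7%:C by rewrite /u innerDl innerZl e12 e22 mulr1 add0r.
  have ub : inner H u b = (Num.sqrt 2^-1 * 8)%:C.
    rewrite /b innerZr conj_real innerDr ue1 ue2 rmorphM; congr (_ * _).
    by rewrite -[1](rmorph1 (real_complex R)) -rmorphD; congr (_%:C); lra.
  have ABu : arith_mean 2^-1 A B u = (a + 2 * l)%:C *: u.
    rewrite arith_meanE half_compl /A /B !spikeE ub ue2 /b [(Num.sqrt 2^-1 * 8)%:C *: _]scalerA -rmorphM.
    rewrite (_ : Num.sqrt 2^-1 * 8 * Num.sqrt 2^-1 = 4); last by rewrite mulrAC -expr2 s2; lra.
    by rewrite /u; apply: eq_dot => z; dots; field.
  have pAB := arith_spos half01 pA pB.
  have gu := eig _ _ _ pAB ABu u0.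
  have gpos := (cfc_spos gp gc pAB).1.
  have := eigen_lower e1 gpos (ltW (gp (ns (2 * l) (ltac:(lra))))) gu.
  rewrite ue1 sqmod1 mulr1 uu => h1.
  have := mean_inequality_convex pA pB e1; rewrite arith_form half_compl.
  rewrite !cfc_spike ?spike_form ?d11 ?mulr1 //; try by apply: ns; lra.
  have -> : inner H e1 b = (Num.sqrt 2^-1)%:C.
    by rewrite /b innerZr conj_real innerDr e11 e12 addr0 mulr1.
  rewrite e12 sqmod0 sqmod_real s2 mulr0 addr0 => h2'.
  rewrite /h; move: h1 h2'; set w := '[_, _]; lra.
move=> B hB; exists (Num.max B (g a)) => t; rewrite le_eqVlt => /orP[/eqP <-|at_].
  by rewrite le_max lexx orbT.
rewrite le_max; apply/orP; left; have := hB (t - a); rewrite /h (addrC a) subrK; apply.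
by rewrite subr_gt0.
Qed.

Lemma mean_inequality_antitone m M A B : 0 < m -> m < M -> bd m M A -> bd m M B ->
  (forall x, '[A x, x] <= '[B x, x]) -> forall x, '[cfc g B x, x] <= '[cfc g A x, x].
Proof.
apply: bounded_midconvex_antitone => //; first exact: mean_inequality_bounded.
exact: mean_inequality_convex.
Qed.
End MeanInequality.

(** * Harmonic and geometric means *)

Section HarmonicGeometric.
Context {R : realType} {H : hilbertType R}.
Implicit Types (A B X Y Z : H -> H) (x y : H) (m M t : R) (f g : R -> R).

Lemma op_inv_spos A : strictly_positive A -> strictly_positive (op_inv A).
Proof.
move=> /spos_bd[m [M [m0 mM bA]]]; have M0 := lt_trans m0 mM.
by have [b _] := bd_inv bA m0 M0; apply: bd_spos b; rewrite invr_gt0.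
Qed.
Lemma spos_op_invK A : strictly_positive A -> op_inv (op_inv A) = A.
Proof. by move=> /spos_bd[m [M [m0 _ bA]]]; exact: op_invK bA m0. Qed.
Lemma spos_inv A : strictly_positive A ->
  (forall x, A (op_inv A x) = x) /\ (forall x, op_inv A (A x) = x).
Proof.
by move=> /spos_bd[m [M [m0 mM bA]]]; have [_] := bd_inv bA m0 (lt_trans m0 mM).
Qed.
Lemma spos_sa A : strictly_positive A -> selfadjoint A.
Proof. by case=> /pos_sa. Qed.
Lemma harm_meanE t A B : harm_mean t A B = op_inv (arith_mean t (op_inv A) (op_inv B)).
Proof. by []. Qed.
Lemma harm_spos t A B : 0 <= t <= 1 -> strictly_positive A -> strictly_positive B ->
  strictly_positive (harm_mean t A B).
Proof. by move=> t01 pA pB; apply/op_inv_spos/arith_spos => //; exact: op_inv_spos. Qed.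

(** In terms of g(r) = f(1 / r) the harmonic mean becomes the arithmetic one, and
    f is monotone when g is antitone. *)
Lemma harm_ineq_monotone (tau : (H -> H) -> (H -> H) -> H -> H) f :
  infinite_dimensional H ->
  (forall r : R, 0 < r -> 0 < f r) -> (forall r : R, 0 < r -> cont_at f r) ->
  (forall A B, strictly_positive A -> strictly_positive B ->
    forall x, '[tau A B x, x] <= '[arith_mean 2^-1 A B x, x]) ->
  damped tau ->
  (forall A B, strictly_positive A -> strictly_positive B ->
    forall x, '[cfc f (harm_mean 2^-1 A B) x, x] <= '[tau (cfc f A) (cfc f B) x, x]) ->
  monotone_on H f.
Proof.
move=> Hinf fp fc tle td hf m M A B m0 mM bA bB AB x.
pose g r := f r^-1.
have gp r : 0 < r -> 0 < g r by move=> r0; rewrite fp // invr_gt0.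
have gc r : 0 < r -> cont_at g r by exact: cont_at_inv_arg.
have gE D : strictly_positive D -> cfc f (op_inv D) = cfc g D.
  by move=> /spos_bd[m' [M' [m0' mM' bD]]]; exact: cfc_at_inv fc m0' mM' bD.
have hg C D : strictly_positive C -> strictly_positive D ->
    forall x, '[cfc g (arith_mean 2^-1 C D) x, x] <= '[tau (cfc g C) (cfc g D) x, x].
  move=> pC pD y; rewrite -!gE //; last exact: arith_spos half01 pC pD.
  have := hf _ _ (op_inv_spos pC) (op_inv_spos pD) y.
  by rewrite harm_meanE !spos_op_invK.
have M0 := lt_trans m0 mM.
have pA := bd_spos m0 bA; have pB := bd_spos m0 bB.
rewrite -(spos_op_invK pA) -(spos_op_invK pB) !gE; try exact: op_inv_spos.
have [bA' _] := bd_inv bA m0 M0; have [bB' _] := bd_inv bB m0 M0.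
apply: (mean_inequality_antitone Hinf gp gc tle td hg _ _ bB' bA').
- by rewrite invr_gt0.
- by rewrite ltf_pV2.
- by move=> y; exact: inv_antitone bA bB m0 M0 AB.
Qed.

Lemma op_pow_spos A (r : R) : strictly_positive A -> strictly_positive (op_pow A r).
Proof.
by apply: cfc_spos => z z0; [exact: powR_gt0|exact: cont_powR].
Qed.
Lemma op_pow_mul A (r s : R) : strictly_positive A ->
  op_pow A r \o op_pow A s = cfc (fun z => z `^ r * z `^ s) A.
Proof.
move=> /spos_bd[m [M [m0 mM bA]]]; rewrite (cfc_mul mM bA) //.
  by move=> z /andP[h _]; apply: cont_powR; apply: lt_le_trans h.
by move=> z /andP[h _]; apply: cont_powR; apply: lt_le_trans h.
Qed.
Lemma op_powK A (r s : R) x : strictly_positive A -> r + s = 0 -> op_pow A r (op_pow A s x) = x.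
Proof.
move=> pA rs; have [m [M [m0 mM bA]]] := spos_bd pA.
rewrite -[op_pow A r _]/((op_pow A r \o op_pow A s) x) op_pow_mul //.
rewrite (@cfc_ext _ _ _ _ _ mM bA _ (fun=> 1)); first by rewrite (cfc_cst mM bA) /scal scale1r.
- by move=> z /andP[h _]; apply: cont_mul; apply: cont_powR; apply: lt_le_trans h.
- move=> z /andP[h _]; have z0 := lt_le_trans m0 h.
  by rewrite -powRD ?rs ?powRr0 ?(gt_eqF z0) ?implybT.
- by move=> z _; exact: cont_cst.
Qed.
Lemma op_pow_half A x : strictly_positive A -> op_pow A 2^-1 (op_pow A 2^-1 x) = A x.
Proof.
move=> pA; have [m [M [m0 mM bA]]] := spos_bd pA.
rewrite -[op_pow A _ _]/((op_pow A 2^-1 \o op_pow A 2^-1) x) op_pow_mul //.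
rewrite (@cfc_ext _ _ _ _ _ mM bA _ id); first by rewrite (cfc_id mM bA).
- by move=> z /andP[h _]; apply: cont_mul; apply: cont_powR; apply: lt_le_trans h.
- move=> z /andP[h _]; have z0 := lt_le_trans m0 h.
  rewrite -powRD ?(gt_eqF z0) ?implybT // (_ : 2^-1 + 2^-1 = 1) ?powRr1 ?ltW //; lra.
- by move=> z _; exact: cont_id.
Qed.

Section Geometric.
Variables (X Y : H -> H).
Hypothesis pX : strictly_positive X.
Hypothesis pY : strictly_positive Y.
Let S := op_pow X 2^-1.
Let Si := op_pow X (- 2^-1).
Let Z := Si \o Y \o Si.
Let pS : strictly_positive S. Proof. exact: op_pow_spos. Qed.
Let pSi : strictly_positive Si. Proof. exact: op_pow_spos. Qed.
Let SSi x : S (Si x) = x. Proof. by apply: op_powK => //; rewrite subrr. Qed.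
Let SiS x : Si (S x) = x. Proof. by apply: op_powK => //; rewrite addNr. Qed.
Let SS x : S (S x) = X x. Proof. exact: op_pow_half. Qed.

Let pZ : strictly_positive Z.
Proof.
have sZ : selfadjoint Z by apply: selfadjoint_conj; apply: spos_sa.
split.
  apply/positiveP; split=> // x; rewrite /Z /= (sa_dot _ _ (spos_sa pSi)).
  exact/pos_ge0/pY.1.
have [hY1 hY2] := spos_inv pY.
exists (S \o op_inv Y \o S); split.
- apply: bop_comp; last exact/sa_bop/spos_sa.
  by apply: bop_comp; [exact/sa_bop/spos_sa|exact/sa_bop/spos_sa/op_inv_spos].
- by apply/funext => x; rewrite /Z /= SiS hY1 SiS.
- by apply/funext => x; rewrite /Z /= SSi hY2 SSi.
Qed.

Lemma geom_meanE t x : geom_mean t X Y x = S (op_pow Z t (S x)). Proof. by []. Qed.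
Lemma geom_form t x : '[geom_mean t X Y x, x] = '[op_pow Z t (S x), S x].
Proof. by rewrite geom_meanE (sa_dot _ _ (spos_sa pS)). Qed.
Lemma geom_positive t : positive (geom_mean t X Y).
Proof.
apply/positiveP; split.
  by apply: selfadjoint_conj; apply: spos_sa => //; exact: op_pow_spos.
by move=> x; rewrite geom_form; apply: pos_ge0; exact: (op_pow_spos t pZ).1.
Qed.
(** X # Y = S Z^t S with S^2 = X and S Z S = Y, so a linear majorant of the power
    function turns into a linear combination of X and Y. *)
Lemma geom_upper t (a b : R) x : (forall z : R, 0 < z -> z `^ t <= a + b * z) ->
  '[geom_mean t X Y x, x] <= a * '[X x, x] + b * '[Y x, x].
Proof.
move=> hab; rewrite geom_form; have [m [M [m0 mM bZ]]] := spos_bd pZ.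
have ht : forall z, m <= z <= M -> cont_at (fun z => z `^ t) z.
  by move=> z /andP[h _]; apply: cont_powR; apply: lt_le_trans h.
have hb : forall z, m <= z <= M -> cont_at (fun z => b * z) z.
  by move=> z _; apply: cont_mul; [exact: cont_cst|exact: cont_id].
have ha : forall z, m <= z <= M -> cont_at (fun=> a) z by move=> z _; exact: cont_cst.
have hl : forall z, m <= z <= M -> cont_at (fun z => a + b * z) z.
  by move=> z hz; apply: cont_add; [exact: ha|exact: hb].
apply: le_trans (cfc_le mM bZ (S x) ht hl _) _.
  by move=> z /andP[h _]; apply: hab; apply: lt_le_trans h.
have hid : forall z, m <= z <= M -> cont_at id z by move=> z _; exact: cont_id.
have hc : forall z, m <= z <= M -> cont_at (fun=> b) z by move=> z _; exact: cont_cst.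
rewrite (cfc_add mM bZ) // (cfc_mul mM bZ hc hid) (cfc_id mM bZ) !(cfc_cst mM bZ).
have sS := spos_sa pS; have sSi := spos_sa pSi.
rewrite [(_ + _) (S x)](_ : _ = a%:C *: S x + b%:C *: Z (S x)) // dotDl !dotZl.
by rewrite (sa_dot x (S x) sS) SS (dotC x) /Z /= SiS (sa_dot _ _ sSi) SiS.
Qed.

(** The inequality 1 + u <= exp u, at the two points whose weighted mean is the
    logarithm of the left-hand side. *)
Lemma amgm t (w : R) : 0 <= t <= 1 -> 0 < w -> w `^ t <= 1 - t + t * w.
Proof.
move=> /andP[t0 t1] w0; pose b := t * ln w.
have -> : w `^ t = expR b by rewrite /powR gt_eqF.
have h1 : expR b * (1 - b) <= 1.
  apply: le_trans (ler_wpM2l (expR_ge0 b) (expR_ge1Dx (- b))) _.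
  by rewrite -expRD subrr expR0.
have h2 : expR b * (1 + (ln w - b)) <= w.
  apply: le_trans (ler_wpM2l (expR_ge0 b) (expR_ge1Dx (ln w - b))) _.
  by rewrite -expRD addrC subrK lnK.
have t1' : 0 <= 1 - t by lra.
have h3 := ler_wpM2l t1' h1; have h4 := ler_wpM2l t0 h2.
have e : (1 - t) * (expR b * (1 - b)) + t * (expR b * (1 + (ln w - b))) = expR b.
  by rewrite {2 4}/b; ring.
lra.
Qed.

(** Both means are S k(Z) S: with k(z) = (1 - t + t / z)^-1 for the harmonic one,
    since arith_mean t (X^-1) (Y^-1) = S^-1 k(Z)^-1 S^-1, and with k(z) = z^t for
    the geometric one.  The scalar functions are ordered by the AM-GM
    inequality at 1 / z. *)
Lemma harm_le_geom t x : 0 <= t <= 1 -> '[harm_mean t X Y x, x] <= '[geom_mean t X Y x, x].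
Proof.
move=> t01; have [t0 t1] := andP t01; have [m [M [m0 mM bZ]]] := spos_bd pZ.
pose h (z : R) := 1 - t + t * z^-1.
have pos z : m <= z <= M -> 0 < z by case/andP=> hz _; apply: lt_le_trans hz.
have hp z : 0 < z -> 0 < h z.
  move=> z0; apply: lt_le_trans (amgm t01 _); rewrite ?invr_gt0 //.
  by rewrite powR_gt0 // invr_gt0.
have ci : forall z, m <= z <= M -> cont_at (fun z => z^-1) z.
  by move=> z /pos z0; apply: cont_inv (cont_id _); rewrite gt_eqF.
have cti : forall z, m <= z <= M -> cont_at (fun z => t * z^-1) z.
  by move=> z hz; apply: cont_mul; [exact: cont_cst|exact: ci].
have c1 : forall z, m <= z <= M -> cont_at (fun=> 1 - t) z by move=> z _; exact: cont_cst.
have ch : forall z, m <= z <= M -> cont_at h z.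
  by move=> z hz; apply: cont_add; [exact: c1|exact: cti].
have chp : forall z : R, 0 < z -> cont_at h z.
  move=> z z0; apply: cont_add; first exact: cont_cst.
  by apply: cont_mul; [exact: cont_cst|apply: cont_inv (cont_id _); rewrite gt_eqF].
have [a [b [a0 _ hab]]] := pos_bounds M hp chp m0.
have [bN hN1 hN2] := cfc_inverse mM bZ ch a0 hab.
have sS := spos_sa pS; have sSi := spos_sa pSi.
have [hY1 hY2] := spos_inv pY; have [hX1 hX2] := spos_inv pX.
have ZiE y : op_inv Z y = S (op_inv Y (S y)).
  have [_ hZ] := spos_inv pZ; rewrite -[RHS]hZ; congr (op_inv Z _).
  by rewrite /Z /= SiS hY1 SiS.
have XiE y : op_inv X y = Si (Si y).
  by rewrite -[RHS]hX2; congr (op_inv X _); rewrite -SS SSi SSi.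
have hE : cfc h Z = scal (1 - t) + t%:C *: op_inv Z.
  rewrite (cfc_add mM bZ) // (cfc_mul mM bZ) // => [|z _]; last exact: cont_cst.
  by rewrite !(cfc_cst mM bZ) (cfc_op_inv m0 mM bZ).
have AE y : arith_mean t (op_inv X) (op_inv Y) y = Si (cfc h Z (Si y)).
  rewrite hE [(_ + _) (Si y)](_ : _ = (1 - t)%:C *: Si y + t%:C *: op_inv Z (Si y)) //.
  by rewrite (linA_D (sa_lin sSi)) !(linA_Z (sa_lin sSi)) ZiE SSi SiS arith_meanE XiE.
have -> : harm_mean t X Y = S \o cfc (fun z => (h z)^-1) Z \o S.
  rewrite harm_meanE; apply: op_inv_eq; split.
  - by apply: bop_comp; [apply: bop_comp => //|]; apply: sa_bop.
  - by apply/funext => y; rewrite /= AE SiS (compK hN1) SiS.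
  - by apply/funext => y; rewrite /= AE SSi (compK hN2) SSi.
rewrite /= (sa_dot _ _ sS) geom_form; apply: (cfc_le mM bZ).
- by move=> z hz; apply: cont_inv; [rewrite gt_eqF // hp // (pos z)|exact: ch].
- by move=> z /pos; exact: cont_powR.
move=> z /pos z0; rewrite -[z `^ t]invrK lef_pV2 ?posrE ?hp ?invr_gt0 ?powR_gt0 //.
have zi : 0 < z^-1 by rewrite invr_gt0.
suff -> : (z `^ t)^-1 = z^-1 `^ t by exact: amgm.
have zt : z `^ t != 0 by rewrite gt_eqF // powR_gt0.
apply: (mulIf zt); rewrite mulVf // -powRM ?ltW // mulVf ?powR1 //.
by rewrite gt_eqF.
Qed.
End Geometric.

Lemma sqrt_linear_bound (e z : R) : 0 < e -> 0 < z -> z `^ 2^-1 <= e + (4 * e)^-1 * z.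
Proof.
move=> e0 z0; rewrite (powR12_sqrt (ltW z0)); set w := Num.sqrt z.
have wz : w ^+ 2 = z by rewrite sqr_sqrtr // ltW.
rewrite -wz -subr_ge0 (_ : _ - _ = (4 * e)^-1 * (w - 2 * e) ^+ 2); last by field; rewrite gt_eqF.
by rewrite mulr_ge0 ?sqr_ge0 // invr_ge0 mulr_ge0 // ltW.
Qed.
Lemma geom_le_arith A B : strictly_positive A -> strictly_positive B ->
  forall x, '[geom_mean 2^-1 A B x, x] <= '[arith_mean 2^-1 A B x, x].
Proof.
move=> pA pB x; rewrite arith_form; apply: geom_upper => // z z0.
exact: amgm half01 z0.
Qed.

(** The vector v is orthogonal to q, so one of the two spikes is bounded at v, and
    a linear majorant of the square root with small weight eta on the other
    makes the geometric mean at v at most eta G + cst; likewise for w, which is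
    orthogonal to p.  Since v + w = 2 d e1, choosing eta as a multiple of d^2
    gives the slope 1 / 2 for every angle. *)
Lemma geom_damped : damped (@geom_mean R H 2^-1).
Proof.
exists 2^-1; split; [exact: half_ge0|exact: half_lt1|].
move=> e1 e2 e11 e22 e12 c d s c0 d0 cd s0.
pose eta := d ^+ 2 / 2; have d2 : 0 < d ^+ 2 by rewrite exprn_gt0.
have eta0 : 0 < eta by rewrite divr_gt0.
exists (d ^- 2 * (eta * s + (4 * eta)^-1 * s)) => G G0.
set p := c%:C *: e1 + d%:C *: e2; set q := c%:C *: e1 - d%:C *: e2.
have qE : q = c%:C *: e1 + (- d)%:C *: e2 by rewrite /q rmorphN scaleNr.
have ipc (a b a' b' : R) : inner H (a%:C *: e1 + b%:C *: e2) (a'%:C *: e1 + b'%:C *: e2) = (a * a' + b * b')%:C.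
  exact: inner_orthonormal.
have p1 : inner H p p = 1 by rewrite ipc -!expr2 cd.
have q1 : inner H q q = 1 by rewrite qE ipc -!expr2 sqrrN cd.
pose v := d%:C *: e1 + c%:C *: e2; pose w := d%:C *: e1 + (- c)%:C *: e2.
have vv : '[v, v] = 1 by rewrite /dotr ipc -!expr2 addrC cd.
have ww : '[w, w] = 1 by rewrite /dotr ipc -!expr2 sqrrN addrC cd.
have vq : inner H v q = 0 by rewrite qE ipc mulrN mulrC subrr.
have wp : inner H w p = 0 by rewrite ipc mulNr mulrC subrr.
have vp := rk_le p v; have wq := rk_le q w.
have pp : '[p, p] = 1 by rewrite /dotr p1.
have qq : '[q, q] = 1 by rewrite /dotr q1.
rewrite vv pp mulr1 in vp; rewrite ww qq mulr1 in wq.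
have pX : strictly_positive (spike s G p) by exact: spike_spos.
have pY : strictly_positive (spike s G q) by exact: spike_spos.
set T := geom_mean 2^-1 (spike s G p) (spike s G q).
have pT : positive T by exact: geom_positive.
have up (r : R) : 0 <= r -> r <= 1 -> s * 1 + (G - s) * r <= G + s by move=> ? ?; nra.
have bv : '[T v, v] <= eta * (G + s) + (4 * eta)^-1 * s.
  apply: le_trans (geom_upper pX pY v (fun z => sqrt_linear_bound eta0)) _.
  rewrite !spike_form vq sqmod0 mulr0 addr0 vv mulr1 lerD2r ler_pM2l //.
  by have := up _ (sqmod_ge0 (inner H v p)) vp; rewrite mulr1.
have bw : '[T w, w] <= eta * (G + s) + (4 * eta)^-1 * s.
  have e4 : 0 < (4 * eta)^-1 by rewrite invr_gt0 mulr_gt0.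
  have sb z : 0 < z -> z `^ 2^-1 <= (4 * eta)^-1 + eta * z.
    move=> z0; have := sqrt_linear_bound e4 z0.
    by rewrite (_ : (4 * (4 * eta)^-1)^-1 = eta) // invfM invrK mulrA mulVf ?mul1r.
  apply: le_trans (geom_upper pX pY w sb) _.
  rewrite !spike_form wp sqmod0 mulr0 addr0 ww mulr1 addrC lerD2r ler_pM2l //.
  by have := up _ (sqmod_ge0 (inner H w q)) wq; rewrite mulr1.
have lT := sa_lin (pos_sa pT).
have e1E : (2 * d)%:C *: e1 = v + w by rewrite /v /w; vec.
clearbody v w T.
have : '[T (v + w), v + w] <= 2 * '[T v, v] + 2 * '[T w, w].
  have := pos_ge0 (v - w) pT; rewrite (linA_B lT) (linA_D lT); dots; lra.
rewrite -e1E (linA_Z lT) dotZl dotZr => h.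
have d4 : 0 < 4 * d ^+ 2 by rewrite mulr_gt0.
rewrite -(ler_pM2l d4) [leRHS](_ : _ = 4 * (eta * (G + s) + (4 * eta)^-1 * s)); last first.
  by rewrite /eta; field; rewrite gt_eqF.
have -> : 4 * d ^+ 2 * '[T e1, e1] = 2 * d * (2 * d * '[T e1, e1]) by ring.
by apply: le_trans h _; lra.
Qed.
End HarmonicGeometric.

(** * Symmetric means through their axioms *)

Lemma harm_of_inverses (R : realFieldType) (n a b : R) : 0 < n -> 0 < a -> 0 < b ->
  2 * (a^-1 * n) * (b^-1 * n) / (a^-1 * n + b^-1 * n) = n / (2^-1 * (a + b)).
Proof.
move=> n0 a0 b0; field.
by rewrite !gt_eqF // ?addr_gt0 ?mulr_gt0.
Qed.

Section SymmetricMean.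
Context {R : realType} {H : hilbertType R}.
Implicit Types (A B X Y : H -> H) (x y u v w p q : H).

Lemma positive_spike (s G : R) p : inner H p p = 1 -> 0 <= s -> 0 <= G -> positive (spike s G p).
Proof.
move=> p1 s0 G0; apply: (@bd_pos _ _ 0 (Num.max s G)) => //.
by apply: spike_bd; rewrite // ?s0 ?G0 le_max lexx ?orbT.
Qed.
Lemma two_eigen_lower T (a b : R) f f' y : positive T -> 0 <= a -> 0 <= b ->
  inner H f f = 1 -> inner H f' f' = 1 -> inner H f f' = 0 ->
  T f = a%:C *: f -> T f' = b%:C *: f' ->
  a * sqmod (inner H y f) + b * sqmod (inner H y f') <= '[T y, y].
Proof.
move=> pT a0 b0 f1 f1' ff' Tf Tf'; have sT := pos_sa pT; have lT := sa_lin sT.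
have f'f : inner H f' f = 0 by rewrite innerC ff' rmorph0.
set c := inner H y f; set c' := inner H y f'.
pose w := y - c *: f - c' *: f'.
have yE : y = c *: f + c' *: f' + w by rewrite /w; set F := c *: f; set F' := c' *: f'; vec.
have wf : inner H w f = 0 by rewrite /w !innerBl !innerZl f1 f'f mulr0 subr0 mulr1 subrr.
have wf' : inner H w f' = 0.
  by rewrite /w !innerBl !innerZl f1' ff' mulr0 subr0 mulr1 subrr.
have Ty : T y = a%:C *: (c *: f) + b%:C *: (c' *: f') + T w.
  rewrite {1}yE !(linA_D lT) !(linA_Z lT) Tf Tf'.
  by congr (_ + _ + _); rewrite !scalerA mulrC.
have dwf (z : R[i]) g : inner H w g = 0 -> '[w, z *: g] = 0.
  by move=> h; rewrite /dotr innerZr h mulr0.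
have dff' (z z' : R[i]) : '[z *: f, z' *: f'] = 0.
  by rewrite /dotr innerZl innerZr ff' !mulr0.
have dff (z : R[i]) g : inner H g g = 1 -> '[z *: g, z *: g] = sqmod z.
  by move=> h; rewrite dot_cscale inner_unit ?mulr1.
have TwE (z : R[i]) g (k : R) : inner H w g = 0 -> T g = k%:C *: g -> '[T w, z *: g] = 0.
  move=> h e; rewrite (sa_dot _ _ sT) (linA_Z lT) e /dotr !innerZr h !mulr0 //.
rewrite Ty [X in '[_, X]]yE; set F := c *: f; set F' := c' *: f'.
have e1 : '[F, F'] = 0 by exact: dff'.
have e2 : '[w, F] = 0 by exact: dwf.
have e3 : '[w, F'] = 0 by exact: dwf.
have e4 : '[T w, F] = 0 by exact: TwE Tf.
have e5 : '[T w, F'] = 0 by exact: TwE Tf'.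
have e6 : '[F, F] = sqmod c by exact: dff.
have e7 : '[F', F'] = sqmod c' by exact: dff.
have h0 := pos_ge0 w pT.
clearbody F F' w; dots; rewrite (dotC F' F) (dotC F w) (dotC F' w) e1 e2 e3 e4 e5 e6 e7.
lra.
Qed.

Variable sigma : (H -> H) -> (H -> H) -> H -> H.
Hypothesis Hinf : infinite_dimensional H.
Hypothesis sym : symmetric_mean sigma.
Let spos A B : positive A -> positive B -> positive (sigma A B).
Proof. exact: (connection_pos sym.1.1). Qed.
Let smono A B C D : positive A -> positive B -> positive C -> positive D ->
  (forall x, '[A x, x] <= '[C x, x]) -> (forall x, '[B x, x] <= '[D x, x]) ->
  forall x, '[sigma A B x, x] <= '[sigma C D x, x].
Proof.
move=> pA pB pC pD AC BD x; apply: op_le_form.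
apply: (connection_mono sym.1.1) => //; apply/op_leP => //; exact: pos_sa.
Qed.
Let strans A B C x : positive A -> positive B -> positive C ->
  '[sigma A B (C x), C x] <= '[sigma (C \o A \o C) (C \o B \o C) x, x].
Proof.
move=> pA pB pC; have := op_le_form x (connection_transformer sym.1.1 pA pB pC).
by rewrite /= (sa_dot _ _ (pos_sa pC)).
Qed.
Let sid A : positive A -> sigma A A = A.
Proof. exact: sym.1.2. Qed.
Let scomm A B : positive A -> positive B -> sigma A B = sigma B A.
Proof. exact: sym.2. Qed.

(** The transformer inequality with a rank-one projection reduces a mean to
    numbers; they depend neither on v nor on the operators, as shown below. *)
Definition mval v (a b : R) : R := '[sigma (a%:C *: rk v) (b%:C *: rk v) v, v].

Let prk (a : R) v : 0 <= a -> positive (a%:C *: rk v).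
Proof. by move=> a0; exact/(positive_scale a0)/rk_pos. Qed.

Lemma rk_compress A v : selfadjoint A -> inner H v v = 1 ->
  rk v \o A \o rk v = ('[A v, v])%:C *: rk v.
Proof.
move=> sA v1; apply/funext => x; rewrite /= {1 3}/rk [RHS](_ : _ = ('[A v, v])%:C *: (inner H x v *: v)) //.
rewrite (linA_Z (sa_lin sA)) innerZl.
by rewrite inner_form // scalerA mulrC.
Qed.
Let rk_at v : inner H v v = 1 -> rk v v = v.
Proof. by move=> v1; rewrite /rk v1 scale1r. Qed.

Lemma mean_le_mval X Y x : positive X -> positive Y -> inner H x x = 1 ->
  '[sigma X Y x, x] <= mval x '[X x, x] '[Y x, x].
Proof.
move=> pX pY x1; have := strans x pX pY (rk_pos x).
by rewrite rk_at // !rk_compress //; exact: pos_sa.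
Qed.

(** Monotonicity bounds the mean of A and B below by the mean of a (rk v) and
    b (rk v), and the transformer inequality by rk v bounds its form at v above by the
    same number; so the difference is a positive operator whose form vanishes at
    v. *)
Lemma mean_eigen_unit A B v (a b : R) : positive A -> positive B -> 0 <= a -> 0 <= b ->
  inner H v v = 1 -> A v = a%:C *: v -> B v = b%:C *: v ->
  sigma A B v = (mval v a b)%:C *: v.
Proof.
move=> pA pB a0 b0 v1 Av Bv; set T := sigma A B; have pT : positive T by exact: spos.
have vv := inner_unit v1.
have eva : '[A v, v] = a by rewrite Av dotZl vv mulr1.
have evb : '[B v, v] = b by rewrite Bv dotZl vv mulr1.
have low D (d : R) : positive D -> 0 <= d -> D v = d%:C *: v -> forall x, '[(d%:C *: rk v) x, x] <= '[D x, x].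
  move=> pD d0 Dv x; have := eigen_lower x pD d0 Dv; rewrite vv mulr1.
  by rewrite [(_ *: rk v) x](_ : _ = d%:C *: rk v x) // dotZl rk_form innerC sqmodC.
have lowT x : mval v a b * sqmod (inner H x v) <= '[T x, x].
  have p1 : positive (sigma (a%:C *: rk v) (b%:C *: rk v)) by apply: spos; exact: prk.
  apply: le_trans (smono (prk v a0) (prk v b0) pA pB (low _ _ pA a0 Av) (low _ _ pB b0 Bv) x).
  have [c1|c0] := eqVneq (inner H x v) 0; first by rewrite c1 sqmod0 mulr0 pos_ge0.
  have := strans x (prk v a0) (prk v b0) (rk_pos v).
  have e (d : R) : rk v \o (d%:C *: rk v) \o rk v = d%:C *: rk v.
    rewrite rk_compress //; last exact/selfadjoint_scale/rk_sa.
    by rewrite [(_ *: rk v) v](_ : _ = d%:C *: rk v v) // rk_at // dotZl vv mulr1.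
  rewrite !e {1 2}/rk (linA_Z (sa_lin (pos_sa p1))) dot_cscale mulrC //.
have up : '[T v, v] <= mval v a b by have := mean_le_mval pA pB v1; rewrite eva evb.
have Tvv : '[T v, v] = mval v a b.
  by apply/eqP; rewrite eq_le up /=; have := lowT v; rewrite v1 sqmod1 mulr1.
pose D := T - (mval v a b)%:C *: rk v.
have sD : selfadjoint D by apply: selfadjoint_sub; [exact: pos_sa|exact/selfadjoint_scale/rk_sa].
have DE x : D x = T x - (mval v a b)%:C *: rk v x by [].
have pD : positive D.
  apply/positiveP; split=> // x; rewrite DE dotBl dotZl rk_form subr_ge0; exact: lowT.
have := pos_kernel (x := v) pD; rewrite DE dotBl dotZl rk_at // vv Tvv mulr1 subrr.
by move=> /(_ erefl)/eqP; rewrite subr_eq0 => /eqP.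
Qed.

(** The mean of the two scalar operators has every vector as eigenvector, so it is
    a scalar. *)
Lemma mval_indep u v (a b : R) : 0 <= a -> 0 <= b -> inner H u u = 1 -> inner H v v = 1 ->
  mval u a b = mval v a b.
Proof.
move=> a0 b0 u1 v1; pose T := sigma (scal a) (scal b).
have pa := positive_scal a0; have pb := positive_scal b0.
have lT : linear T by exact/sa_lin/pos_sa/spos.
have ev x : inner H x x = 1 -> T x = (mval x a b)%:C *: x.
  by move=> x1; apply: mean_eigen_unit.
have evn x : exists c : R, T x = c%:C *: x.
  have [->|x0] := eqVneq x 0; first by exists 0; rewrite (linA_0 lT) scaler0.
  have [y y1 ->] := normalize x0; exists (mval y a b).
  by rewrite (linA_Z lT) ev // !scalerA mulrC.
have vn := unit_neq0 v1; have un := unit_neq0 u1.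
have [c hc] := evn (u + v); move: hc; rewrite (linA_D lT) !ev // => hc.
set cu := mval u a b in hc *; set cv := mval v a b in hc *.
have e : (cu - c)%:C *: u = (c - cv)%:C *: v.
  apply: eq_dot => z; have := congr1 (fun t => '[t, z]) hc; dots; lra.
have [e1|n1] := eqVneq cu c.
  move: e; rewrite e1 subrr scale0r => /esym/eqP; rewrite scaler_eq0 (negbTE vn) orbF.
  by rewrite (_ : 0 = 0%:C) // => /eqP/complexI/eqP; rewrite subr_eq0 => /eqP.
have nz : cu - c != 0 by rewrite subr_eq0.
have uE : u = ((c - cv) / (cu - c))%:C *: v.
  by rewrite mulrC rmorphM -scalerA -e scalerA -rmorphM mulVf // scale1r.
have := ev u u1; rewrite {1}uE (linA_Z lT) ev // -/cu -/cv scalerA mulrC -scalerA -uE.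
move/eqP; rewrite -subr_eq0 -scalerBl -rmorphB scaler_eq0 (negbTE un) orbF.
by rewrite (_ : 0 = 0%:C) // => /eqP/complexI/eqP; rewrite subr_eq0 => /eqP.
Qed.

Variables (e1 e2 : H).
Hypotheses (e11 : inner H e1 e1 = 1) (e22 : inner H e2 e2 = 1) (e12 : inner H e1 e2 = 0).
Let e21 : inner H e2 e1 = 0. Proof. by rewrite innerC e12 rmorph0. Qed.
(** The mean as an operation on nonnegative numbers. *)
Definition smean (a b : R) := mval e1 a b.

Lemma mean_eigen A B v (a b : R) : positive A -> positive B -> 0 <= a -> 0 <= b ->
  A v = a%:C *: v -> B v = b%:C *: v -> sigma A B v = (smean a b)%:C *: v.
Proof.
move=> pA pB a0 b0 Av Bv; have lT := sa_lin (pos_sa (spos pA pB)).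
have [v0|v0] := eqVneq v 0; first by rewrite v0 (linA_0 lT) scaler0.
have [u u1 vE] := normalize v0.
have n0 := nrmC_neq0 v0.
have uE : u = (nrm v)%:C^-1 *: v by rewrite {2}vE scalerA mulVf // scale1r.
have Eu C (c : R) : positive C -> C v = c%:C *: v -> C u = c%:C *: u.
  by move=> pC Cv; rewrite uE (linA_Z (sa_lin (pos_sa pC))) Cv !scalerA mulrC.
have e := mean_eigen_unit pA pB a0 b0 u1 (Eu _ _ pA Av) (Eu _ _ pB Bv).
rewrite vE (linA_Z lT) e (mval_indep a0 b0 u1 e11).
by rewrite !scalerA mulrC.
Qed.
Lemma mean_le_smean X Y x : positive X -> positive Y -> inner H x x = 1 ->
  '[sigma X Y x, x] <= smean '[X x, x] '[Y x, x].
Proof.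
move=> pX pY x1; rewrite /smean -(mval_indep _ _ x1 e11) ?pos_ge0 //.
exact: mean_le_mval.
Qed.
Lemma smean_ge0 a b : 0 <= a -> 0 <= b -> 0 <= smean a b.
Proof. by move=> a0 b0; apply: pos_ge0; apply: spos; exact: prk. Qed.
Lemma smean_sym a b : 0 <= a -> 0 <= b -> smean a b = smean b a.
Proof. by move=> a0 b0; rewrite /smean /mval scomm //; exact: prk. Qed.
Lemma smean_id a : 0 <= a -> smean a a = a.
Proof.
move=> a0; rewrite /smean /mval sid; last exact: prk.
by rewrite [(_ *: rk e1) e1](_ : _ = a%:C *: rk e1 e1) // rk_at // dotZl inner_unit ?mulr1.
Qed.
Lemma smean_mono a b c d : 0 <= a -> 0 <= b -> a <= c -> b <= d -> smean a b <= smean c d.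
Proof.
move=> a0 b0 ac bd; have c0 := le_trans a0 ac; have d0 := le_trans b0 bd.
have h (r s : R) x : r <= s -> '[(r%:C *: rk e1) x, x] <= '[(s%:C *: rk e1) x, x].
  move=> rs; have e (k : R) : (k%:C *: rk e1) x = k%:C *: rk e1 x by [].
  by rewrite !e !dotZl rk_form ler_wpM2r ?sqmod_ge0.
by apply: smono; try exact: prk; move=> x; exact: h.
Qed.
Lemma smean_scale (t a b : R) : 0 < t -> 0 <= a -> 0 <= b -> smean (t * a) (t * b) = t * smean a b.
Proof.
have le (r c d : R) : 0 < r -> 0 <= c -> 0 <= d -> r * smean c d <= smean (r * c) (r * d).
  move=> r0 c0 d0; have := strans e1 (prk e1 c0) (prk e1 d0) (positive_scal (sqrtr_ge0 r)).
  have e (k : R) : scal (Num.sqrt r) \o (k%:C *: rk e1) \o scal (Num.sqrt r) = (r * k)%:C *: rk e1.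
    apply/funext => x; rewrite /= /scal.
    rewrite [LHS](_ : _ = (Num.sqrt r)%:C *: (k%:C *: rk e1 ((Num.sqrt r)%:C *: x))) //.
    rewrite (linA_Z (sa_lin (rk_sa e1))) [RHS](_ : _ = (r * k)%:C *: rk e1 x) //.
    move: (rk e1 x) => y; rewrite !scalerA -!rmorphM; congr (_%:C *: _).
    by rewrite ?mulrA mulrAC -expr2 sqr_sqrtr // ltW.
  rewrite !e /scal (linA_Z (sa_lin (pos_sa (spos (prk e1 c0) (prk e1 d0))))) dot_cscale sqmod_real.
  by rewrite sqr_sqrtr // ltW.
move=> t0 a0 b0; apply/eqP; rewrite eq_le le // andbT.
have ti : 0 < t^-1 by rewrite invr_gt0.
have := le _ _ _ ti (mulr_ge0 (ltW t0) a0) (mulr_ge0 (ltW t0) b0).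
by rewrite !mulrA mulVf ?gt_eqF // !mul1r ler_pdivrMl.
Qed.

(* By symmetry the mean of diag(a, b) and diag(b, a) has the same eigenvalue at e1
   and e2, hence at u, whereas both diagonal operators have the form
   (a + b) / 2 at u: that compares the mean with the arithmetic one. *)
Let u := (Num.sqrt 2^-1)%:C *: (e1 + e2).
Let s2 : Num.sqrt 2^-1 ^+ 2 = 2^-1 :> R. Proof. by rewrite sqr_sqrtr // half_ge0. Qed.
Let u1 : inner H u u = 1.
Proof.
rewrite /u !(innerDl, innerDr, innerZl, innerZr, conj_real) e11 e12 e21 e22.
rewrite addr0 add0r !mulr1 mulrDr -rmorphM -expr2 s2 -rmorphD.
by rewrite (_ : 2^-1 + 2^-1 = 1) ?rmorph1 //; lra.
Qed.
Let diag (a b : R) : H -> H := (a%:C *: rk e1) + (b%:C *: rk e2).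
Let diagE a b x : diag a b x = a%:C *: (inner H x e1 *: e1) + b%:C *: (inner H x e2 *: e2).
Proof. by []. Qed.
Let pdiag a b : 0 <= a -> 0 <= b -> positive (diag a b).
Proof. by move=> a0 b0; apply: positive_add; exact: prk. Qed.
Let diag_form a b x : '[diag a b x, x] = a * sqmod (inner H x e1) + b * sqmod (inner H x e2).
Proof. by rewrite diagE dotDl !dotZl -!rk_form. Qed.
Let swap_mean a b : 0 <= a -> 0 <= b -> sigma (diag a b) (diag b a) u = (smean a b)%:C *: u.
Proof.
move=> a0 b0; have pab := pdiag a0 b0; have pba := pdiag b0 a0.
have lT := sa_lin (pos_sa (spos pab pba)).
have d1 c d : diag c d e1 = c%:C *: e1 by rewrite diagE e11 e12 scale1r scale0r scaler0 addr0.
have d2 c d : diag c d e2 = d%:C *: e2 by rewrite diagE e22 e21 scale1r scale0r scaler0 add0r.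
rewrite /u (linA_Z lT) (linA_D lT) (mean_eigen pab pba a0 b0) ?d1 //.
rewrite (mean_eigen pab pba b0 a0) ?d2 // (smean_sym b0 a0) -scalerDr !scalerA mulrC //.
Qed.
Let iu x : inner H x u = (Num.sqrt 2^-1)%:C * (inner H x e1 + inner H x e2).
Proof. by rewrite /u innerZr conj_real innerDr. Qed.
Let ue1 : inner H u e1 = (Num.sqrt 2^-1)%:C.
Proof. by rewrite /u innerZl innerDl e11 e21 addr0 mulr1. Qed.
Let ue2 : inner H u e2 = (Num.sqrt 2^-1)%:C.
Proof. by rewrite /u innerZl innerDl e12 e22 add0r mulr1. Qed.

Lemma smean_le_arith a b : 0 <= a -> 0 <= b -> smean a b <= 2^-1 * (a + b).
Proof.
move=> a0 b0; have := mean_le_smean (pdiag a0 b0) (pdiag b0 a0) u1.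
rewrite swap_mean // dotZl inner_unit // mulr1 !diag_form ue1 ue2 sqmod_real s2.
rewrite (_ : b * _ + _ = a * 2^-1 + b * 2^-1); last by rewrite addrC.
by rewrite smean_id ?addr_ge0 ?mulr_ge0 ?half_ge0 // -mulrDl mulrC.
Qed.
(** The harmonic mean h of a and b is the largest number such that h times the
    projection onto u = (e1 + e2) / sqrt 2 is below diag(a, b), hence also below
    diag(b, a); the mean of the last two is at least the mean of h (rk u) with
    itself. *)
Lemma harm_le_smean a b : 0 < a -> 0 < b -> 2 * a * b / (a + b) <= smean a b.
Proof.
move=> a0 b0; have ab : 0 < a + b by lra.
set h := _ / _; have h0 : 0 <= h by rewrite divr_ge0 ?mulr_ge0 // ltW.
have low c d x : 0 < c -> 0 < d -> 2 * c * d / (c + d) = h -> '[(h%:C *: rk u) x, x] <= '[diag c d x, x].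
  move=> c0 d0 hE; rewrite diag_form [(_ *: rk u) x](_ : _ = h%:C *: rk u x) // dotZl rk_form iu.
  case: (inner H x e1) => x1 y1; case: (inner H x e2) => x2 y2.
  have -> : sqmod ((Num.sqrt 2^-1)%:C * ((x1 +i* y1) + (x2 +i* y2))) =
     Num.sqrt 2^-1 ^+ 2 * ((x1 + x2) ^+ 2 + (y1 + y2) ^+ 2) by rewrite /sqmod /=; ring.
  rewrite s2 /sqmod /= -hE; have cd : 0 < c + d by lra.
  rewrite -(ler_pM2l cd).
  rewrite [leLHS](_ : _ = c * d * ((x1 + x2) ^+ 2 + (y1 + y2) ^+ 2)); last by field; lra.
  have := sqr_ge0 (c * x1 - d * x2); have := sqr_ge0 (c * y1 - d * y2); lra.
have pu := prk u h0.
have low2 x : '[(h%:C *: rk u) x, x] <= '[diag b a x, x].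
  by apply: low => //; rewrite /h (addrC b) (mulrAC 2 b).
have := smono pu pu (pdiag (ltW a0) (ltW b0)) (pdiag (ltW b0) (ltW a0)) (fun x => low a b x a0 b0 erefl) low2 u.
rewrite swap_mean ?(ltW a0) ?(ltW b0) // dotZl inner_unit // mulr1 sid //.
by rewrite [(_ *: rk u) u](_ : _ = h%:C *: rk u u) // rk_at // dotZl inner_unit // mulr1.
Qed.

Lemma mean_le_arith X Y x : positive X -> positive Y ->
  '[sigma X Y x, x] <= '[arith_mean 2^-1 X Y x, x].
Proof.
move=> pX pY; rewrite arith_form half_compl; have pT := spos pX pY.
have [->|x0] := eqVneq x 0; first by rewrite !dot0r !mulr0 addr0.
have [y y1 ->] := normalize x0; set n := (nrm x)%:C.
have sc A : positive A -> '[A (n *: y), n *: y] = nrm x ^+ 2 * '[A y, y].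
  by move=> pA; rewrite (linA_Z (sa_lin (pos_sa pA))) dot_cscale sqmod_real.
rewrite !sc // mulrCA (mulrCA _ (nrm x ^+ 2)) -mulrDr ler_wpM2l ?sqr_ge0 // -mulrDr.
apply: le_trans (mean_le_smean pX pY y1) _; apply: smean_le_arith; exact: pos_ge0.
Qed.

(** With w the harmonic mean applied to x, the operators X and Y dominate the
    largest possible multiples of rk w, and their harmonic mean has the
    same form at x as the harmonic mean of X and Y; so the scalar inequality
    is enough. *)
Lemma harm_le_mean X Y x : strictly_positive X -> strictly_positive Y ->
  '[harm_mean 2^-1 X Y x, x] <= '[sigma X Y x, x].
Proof.
move=> pX pY; set T := harm_mean 2^-1 X Y; pose w := T x.
have pXi := op_inv_spos pX; have pYi := op_inv_spos pY.
have pD := arith_spos half01 pXi pYi; set D := arith_mean _ _ _ in pD.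
have [hD1 _] := spos_inv pD; have Dw : D w = x by exact: hD1.
have pTs : positive (sigma X Y) by exact: spos pX.1 pY.1.
have [w0|w0] := eqVneq w 0; first by rewrite -/w w0 dot0l pos_ge0.
have posi A : strictly_positive A -> 0 < '[A w, w].
  move=> /spos_bd[m [M [m0 _ [_ /(_ w)/andP[h _]]]]]; apply: lt_le_trans h.
  by rewrite mulr_gt0 // dot_gt0.
set a := '[op_inv X w, w]; set b := '[op_inv Y w, w].
have a0 : 0 < a by exact: posi.
have b0 : 0 < b by exact: posi.
pose h := '[w, x]; have hE : h = 2^-1 * (a + b).
  by rewrite /h dotC -{1}Dw arith_form half_compl mulrDr.
have h0 : 0 < h by rewrite hE mulr_gt0 ?invr_gt0 //; lra.
have low A y : strictly_positive A ->
    '[(('[op_inv A w, w])^-1%:C *: rk w) y, y] <= '[A y, y].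
  move=> pA; have [hA1 _] := spos_inv pA; have c0 := posi _ (op_inv_spos pA).
  rewrite [(_ *: rk w) y](_ : _ = ('[op_inv A w, w])^-1%:C *: rk w y) // dotZl rk_form.
  rewrite ler_pdivrMl //; have := pos_CSc (op_inv A w) y pA.1.
  by rewrite hA1 innerC sqmodC (dotC w).
have a1 : 0 <= a^-1 by rewrite invr_ge0 ltW.
have b1 : 0 <= b^-1 by rewrite invr_ge0 ltW.
apply: le_trans (smono (prk w a1) (prk w b1) pX.1 pY.1 (fun y => low _ y pX) (fun y => low _ y pY) x).
have ww : 0 < '[w, w] by rewrite dot_gt0.
have ev (c : R) : (c%:C *: rk w) w = (c * '[w, w])%:C *: w.
  rewrite [LHS](_ : _ = c%:C *: (inner H w w *: w)) // inner_dotr scalerA -rmorphM //.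
have am : 0 < a^-1 * '[w, w] by rewrite mulr_gt0 ?invr_gt0.
have bm : 0 < b^-1 * '[w, w] by rewrite mulr_gt0 ?invr_gt0.
have pT' := spos (prk w a1) (prk w b1).
have Tw := mean_eigen (prk w a1) (prk w b1) (ltW am) (ltW bm) (ev _) (ev _).
have mm := harm_le_smean am bm.
have := eigen_lower x pT' (smean_ge0 (ltW am) (ltW bm)) Tw.
have -> : inner H w x = h%:C.
  by rewrite inner_form //; exact/spos_sa/(harm_spos half01 pX pY).
rewrite sqmod_real -/w -/h => hh.
have mh : '[w, w] / h <= smean (a^-1 * '[w, w]) (b^-1 * '[w, w]).
  by apply: le_trans mm; rewrite hE harm_of_inverses.
rewrite -(ler_pM2r ww); apply: le_trans hh.
apply: le_trans (ler_wpM2r (sqr_ge0 h) mh).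
by rewrite expr2 mulrA -(mulrA _ h^-1) mulVf ?gt_eqF // mulr1 mulrC.
Qed.

(** The number 1 sigma 0 is the asymptotic slope of the scalar mean.  It is at most
    1 / 2 and it will be shown that 1 / 2 is reached by the arithmetic mean
    only. *)
Definition phi0 := smean 1 0.
Lemma phi0_ge0 : 0 <= phi0. Proof. exact: smean_ge0. Qed.
Lemma smean_a0 a : 0 <= a -> smean a 0 = a * phi0.
Proof.
rewrite le_eqVlt => /orP[/eqP <-|a0]; first by rewrite smean_id ?mul0r.
by have := smean_scale a0 ler01 (lexx 0); rewrite mulr1 mulr0.
Qed.

(** This is where continuity along decreasing sequences is used. *)
Lemma smean_near0 (eta : R) : 0 < eta -> exists2 z : R, 0 < z & smean 1 z <= phi0 + eta.
Proof.
move=> eta0; pose Y (n : nat) := (n.+1%:R^-1 : R)%:C *: rk e1.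
have YE n x : Y n x = (n.+1%:R^-1)%:C *: rk e1 x by [].
have n1 (n : nat) : 0 < n.+1%:R^-1 :> R by rewrite invr_gt0.
have pY n : positive (Y n) by apply: prk; exact: ltW.
have p1 := prk e1 (ler01 : 0 <= 1 :> R); have p0 := prk e1 (lexx (0 : R)).
have dX : op_decreases_to (fun=> 1%:C *: rk e1) (1%:C *: rk e1).
  split=> [n|x]; last exact: cvg_cst.
  by apply/op_leP => //; exact: pos_sa.
have dY : op_decreases_to Y (0%:C *: rk e1).
  split=> [n|x].
    apply/op_leP => [||x]; try exact: pos_sa.
    by rewrite !YE !dotZl rk_form ler_wpM2r ?sqmod_ge0 // lef_pV2 ?posrE // ler_nat.
  apply/hilbert_cvgP => e e0; have [N hN] := inv_small (nrm (rk e1 x)) e0.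
  exists N => n /hN hn.
  rewrite YE [(0%:C *: rk e1) x](_ : _ = 0%:C *: rk e1 x) // scale0r subr0 nrmZ // ltW.
have [_ /(_ e1) /hilbert_cvgP /(_ _ eta0) [N hN]] :=
  connection_cont sym.1.1 (fun=> p1) pY p1 p0 dX dY.
exists N.+1%:R^-1 => //; have := hN N (leqnn N); rewrite /phi0 /smean /mval => h.
rewrite -lerBlDl; apply: le_trans (ler_norm _) _; rewrite -dotBl.
apply: le_trans (dot_CSn _ _) _; have -> : nrm e1 = 1 by rewrite /nrm inner_unit // sqrtr1.
by rewrite mulr1.
Qed.
(** Below the ray b = z a use monotonicity and homogeneity, above it the
    arithmetic mean. *)
Lemma smean_upper (eta : R) : 0 < eta -> exists2 K : R, 0 <= K &
  forall a b : R, 0 < a -> 0 < b -> smean a b <= (phi0 + eta) * a + K * b.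
Proof.
move=> eta0; have [z z0 hz] := smean_near0 eta0.
have z1 : 0 < z^-1 by rewrite invr_gt0.
exists (2^-1 * (z^-1 + 1)) => [|a b a0 b0]; first by rewrite mulr_ge0 ?half_ge0 //; lra.
have pe : 0 <= phi0 + eta by have := phi0_ge0; lra.
have [le|gt] := leP b (z * a).
  apply: le_trans (_ : (phi0 + eta) * a <= _); last first.
    by rewrite lerDl mulr_ge0 ?(ltW b0) // mulr_ge0 ?half_ge0 //; lra.
  apply: le_trans (smean_mono (ltW a0) (ltW b0) (lexx a) le) _.
  have := smean_scale a0 ler01 (ltW z0); rewrite mulr1 (mulrC a z) => ->.
  by rewrite mulrC ler_pM2r.
apply: le_trans (smean_le_arith (ltW a0) (ltW b0)) _.
have ab : a <= z^-1 * b by rewrite ler_pdivlMl // ltW.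
have := mulr_ge0 pe (ltW a0); rewrite -(mulrA 2^-1) (mulrDl z^-1) mul1r; lra.
Qed.

Lemma rk_scale (z : R[i]) v : rk (z *: v) = (sqmod z)%:C *: rk v.
Proof.
apply/funext => x; rewrite [RHS](_ : _ = (sqmod z)%:C *: (inner H x v *: v)) // /rk innerZr !scalerA.
congr (_ *: _); rewrite mulrAC; congr (_ * _).
by case: (z) => a b; apply/eqP; rewrite eq_complex /sqmod /=; apply/andP; split; apply/eqP; ring.
Qed.
Lemma unit_dir p : exists2 v, inner H v v = 1 & p = (nrm p)%:C *: v.
Proof.
have [->|p0] := eqVneq p 0; last exact: normalize.
by exists e1 => //; rewrite nrm0 scale0r.
Qed.
Lemma unit_ortho v : inner H v v = 1 -> exists2 w, inner H w w = 1 & inner H v w = 0.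
Proof.
move=> v1.
have [x hx] : exists x, x - inner H x v *: v != 0.
  apply: contrapT => hn; apply: Hinf; exists 1%N, (fun=> v) => x; exists (fun=> inner H x v).
  rewrite big_ord1; apply/eqP; rewrite -subr_eq0; apply: contrapT => h; apply: hn.
  by exists x; apply/negP.
have [w w1 wE] := normalize hx; exists w => //.
apply: (mulfI (nrmC_neq0 hx)); rewrite mulr0 -conj_real -innerZr -wE.
by rewrite innerC innerBl innerZl v1 mulr1 subrr rmorph0.
Qed.
Lemma phase (z : R[i]) : exists w : R[i], sqmod w = 1 /\ exists2 r : R, 0 <= r & Num.conj w * z = r%:C.
Proof.
have [->|z0] := eqVneq z 0; first by exists 1; rewrite sqmod1; split=> //; exists 0; rewrite ?mulr0.
have s0 : 0 < sqmod z.
  rewrite lt_neqAle sqmod_ge0 andbT eq_sym; apply: contra z0.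
  rewrite /sqmod paddr_eq0 ?sqr_ge0 // !sqrf_eq0 => /andP[/eqP a0 /eqP b0].
  by apply/eqP; case: (z) a0 b0 => a b /= -> ->.
have q0 : 0 < Num.sqrt (sqmod z) by rewrite sqrtr_gt0.
have zz : z * Num.conj z = (sqmod z)%:C.
  case: (z) => a b; apply/eqP; rewrite eq_complex /sqmod /=; apply/andP; split; apply/eqP; ring.
exists ((Num.sqrt (sqmod z))^-1%:C * z); split.
  have -> : sqmod ((Num.sqrt (sqmod z))^-1%:C * z) = (Num.sqrt (sqmod z))^-1 ^+ 2 * sqmod z.
    by case: (z) => a b; rewrite /sqmod /=; ring.
  by rewrite exprVn sqr_sqrtr ?ltW // mulVf // gt_eqF.
exists (Num.sqrt (sqmod z)); first exact: ltW.
have -> : Num.conj ((Num.sqrt (sqmod z))^-1%:C * z) * z = ((Num.sqrt (sqmod z))^-1 * sqmod z)%:C.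
  rewrite rmorphM -mulrA (mulrC _ z) zz rmorphM; congr (_ * _); exact: conj_real.
congr (_%:C).
by rewrite -{2}(sqr_sqrtr (ltW s0)) expr2 mulrA mulVf ?mul1r // gt_eqF.
Qed.

(** For orthonormal f, f' the mean of a (rk f) and b (rk f') is known on their
    span.  A positive operator C carries such a pair to p and q: in the
    basis g1, g2 of the diagonals p + q and p - q it is diagonal, because p and
    q have equal norms and a real inner product.  The transformer inequality by C
    then gives the lower bound for rk p and rk q. *)
Lemma rank_one_lower_real p q (rho a b : R) x : inner H p p = 1 -> inner H q q = 1 ->
  inner H p q = rho%:C -> 0 <= rho -> 0 <= a -> 0 <= b ->
  phi0 * (a * sqmod (inner H x p) + b * sqmod (inner H x q)) <=
  '[sigma (a%:C *: rk p) (b%:C *: rk q) x, x].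
Proof.
move=> p1 q1 pq r0 a0 b0.
have qp : inner H q p = rho%:C by rewrite innerC pq conj_real.
have dpp := inner_unit p1; have dqq := inner_unit q1.
have dpq : '[p, q] = rho by rewrite /dotr pq.
have spq0 : p + q != 0.
  apply/eqP => h; have : '[p + q, p + q] = 0 by rewrite h dot0l.
  by dots; rewrite (dotC q p) dpp dqq dpq; lra.
have [g1 g11 g1E] := normalize spq0; set n1 := nrm (p + q) in g1E.
have n10 : n1%:C != 0 :> R[i] := nrmC_neq0 spq0.
have orth : inner H (p + q) (p - q) = 0.
  have -> : p - q = p + (-1) *: q by rewrite scaleN1r.
  by rewrite innerDl !innerDr !innerZr p1 q1 pq qp rmorphN rmorph1; ring.
have [g2 [n2 [g22 g2E g12 n20]]] : exists g2 (n2 : R), [/\ inner H g2 g2 = 1, p - q = n2%:C *: g2, inner H g1 g2 = 0 & 0 <= n2].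
  have [e|d0] := eqVneq (p - q) 0.
    have [w w1 g1w] := unit_ortho g11; exists w, 0; split=> //.
    by rewrite e scale0r.
  have [w w1 wE] := normalize d0; exists w, (nrm (p - q)); split=> //; last exact: nrm_ge0.
  apply: (mulfI (nrmC_neq0 d0)); rewrite mulr0 -[X in X * _]conj_real -innerZr -wE.
  by apply: (mulfI n10); rewrite mulr0 -innerZl -g1E.
have g21 : inner H g2 g1 = 0 by rewrite innerC g12 rmorph0.
set h := Num.sqrt 2^-1 : R.
have hh : h * h = 2^-1 by rewrite -expr2 s2.
have h0 : 0 <= h by exact: sqrtr_ge0.
pose C := ((h * n1)%:C *: rk g1) + ((h * n2)%:C *: rk g2).
have CE y : C y = (h * n1)%:C *: (inner H y g1 *: g1) + (h * n2)%:C *: (inner H y g2 *: g2) by [].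
have pC : positive C.
  by apply: positive_add; apply: prk; rewrite mulr_ge0 ?nrm_ge0.
pose f := h%:C *: (g1 + g2); pose f' := h%:C *: (g1 - g2).
have f'E : f' = h%:C *: (g1 + (-1) *: g2) by rewrite scaleN1r.
have two : h%:C * (h%:C * 2) = 1 :> R[i].
  by rewrite mulrA -rmorphM hh -(rmorph_nat (real_complex R)) -rmorphM mulVf ?rmorph1 // pnatr_eq0.
have f1 : inner H f f = 1.
  rewrite /f innerZl innerZr conj_real innerDl !innerDr g11 g12 g21 g22 addr0 add0r.
  exact: two.
have f1' : inner H f' f' = 1.
  rewrite f'E innerZl innerZr conj_real innerDl !innerDr !innerZl !innerZr g11 g12 g21 g22.
  by rewrite rmorphN rmorph1 -[RHS]two; ring.
have ff' : inner H f f' = 0.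
  rewrite f'E /f innerZl innerZr innerDl !innerDr !innerZr g11 g12 g21 g22.
  by rewrite rmorphN rmorph1; ring.
have f'f : inner H f' f = 0 by rewrite innerC ff' rmorph0.
have Cg1 : C g1 = (h * n1)%:C *: g1 by rewrite CE g11 g12 scale1r scale0r scaler0 addr0.
have Cg2 : C g2 = (h * n2)%:C *: g2 by rewrite CE g22 g21 scale1r scale0r scaler0 add0r.
have lC := sa_lin (pos_sa pC).
have hh2 : h%:C *: ((h * n1)%:C *: g1 + (h * n2)%:C *: g2) = 2^-1%:C *: (n1%:C *: g1 + n2%:C *: g2).
  by rewrite !scalerDr !scalerA -!rmorphM !mulrA hh.
have Cf : C f = p.
  rewrite /f (linA_Z lC) (linA_D lC) Cg1 Cg2 hh2 -g1E -g2E.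
  by apply: eq_dot => z; dots; lra.
have Cf' : C f' = q.
  rewrite /f' (linA_Z lC) (linA_B lC) Cg1 Cg2.
  rewrite (_ : _ *: (_ - _) = 2^-1%:C *: (n1%:C *: g1 - n2%:C *: g2)); last first.
    by rewrite !scalerBr !scalerA -!rmorphM !mulrA hh.
  by rewrite -g1E -g2E; apply: eq_dot => z; dots; lra.
have cong (r : R) g : C \o (r%:C *: rk g) \o C = r%:C *: rk (C g).
  apply/funext => y; rewrite [RHS](_ : _ = r%:C *: (inner H y (C g) *: C g)) //.
  rewrite [LHS](_ : _ = C (r%:C *: (inner H (C y) g *: g))) // !(linA_Z lC).
  by rewrite ((pos_sa pC).2 y g).
have pF := prk f a0; have pF' := prk f' b0.
have ev (r : R) g k : inner H k g = 0 -> (r%:C *: rk g) k = 0%:C *: k.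
  by move=> e; rewrite [LHS](_ : _ = r%:C *: (inner H k g *: g)) // e !scale0r scaler0.
have ev1 (r : R) g : inner H g g = 1 -> (r%:C *: rk g) g = r%:C *: g.
  by move=> e; rewrite [LHS](_ : _ = r%:C *: (inner H g g *: g)) // e scale1r.
have T1 := mean_eigen pF pF' a0 (lexx 0) (ev1 a f f1) (ev b f' f ff').
have T2 := mean_eigen pF pF' (lexx 0) b0 (ev a f f' f'f) (ev1 b f' f1').
have := strans x pF pF' pC; rewrite !cong Cf Cf'; apply: le_trans.
have := two_eigen_lower (C x) (spos pF pF') (smean_ge0 a0 (lexx 0)) (smean_ge0 (lexx 0) b0) f1 f1' ff' T1 T2.
rewrite (smean_sym (lexx 0) b0) !smean_a0 // !((pos_sa pC).2 x) Cf Cf'.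
by apply: le_trans; rewrite le_eqVlt; apply/orP; left; apply/eqP; ring.
Qed.
Lemma rank_one_lower p q x :
  phi0 * (sqmod (inner H x p) + sqmod (inner H x q)) <= '[sigma (rk p) (rk q) x, x].
Proof.
have [p0 p01 pE] := unit_dir p; have [q0 q01 qE] := unit_dir q.
have [w [w1 [r r0 wr]]] := phase (inner H p0 q0).
have w1c : w * Num.conj w = 1.
  case: (w) w1 => a b; rewrite /sqmod /= => h; apply/eqP; rewrite eq_complex /=.
  by apply/andP; split; apply/eqP; [rewrite -h; ring|ring].
pose q1 := w *: q0.
have q11 : inner H q1 q1 = 1 by rewrite /q1 innerZl innerZr mulrA w1c mul1r.
have pq : inner H p0 q1 = r%:C by rewrite /q1 innerZr wr.
have rkp : rk p = (nrm p ^+ 2)%:C *: rk p0 by rewrite {1}pE rk_scale sqmod_real.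
have rkq : rk q = (nrm q ^+ 2)%:C *: rk q1.
  rewrite {1}qE rk_scale sqmod_real /q1 rk_scale w1 scale1r //.
have sE v (k : R) u' : rk v = k%:C *: rk u' -> sqmod (inner H x v) = k * sqmod (inner H x u').
  move=> e; rewrite -!rk_form e [(_ *: rk u') x](_ : _ = k%:C *: rk u' x) // dotZl.
  by [].
have := rank_one_lower_real x p01 q11 pq r0 (sqr_ge0 (nrm p)) (sqr_ge0 (nrm q)).
by rewrite (sE _ _ _ rkp) (sE _ _ _ rkq) rkp rkq.
Qed.

(** At a given x the operator A dominates the rank-one operator along
    A x / sqrt <A x, x>, and has the same form as it at x. *)
Lemma mean_lower A B x : positive A -> positive B ->
  phi0 * ('[A x, x] + '[B x, x]) <= '[sigma A B x, x].
Proof.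
move=> pA pB; pose dir D := ((Num.sqrt '[D x, x])^-1)%:C *: D x.
have low D y : positive D -> '[rk (dir D) y, y] <= '[D y, y].
  move=> pD; rewrite rk_form /dir innerZr conj_real.
  have -> (r : R) z : sqmod (r%:C * z) = r ^+ 2 * sqmod z.
    by case: z => c d; rewrite /sqmod /=; ring.
  have d0 := pos_ge0 x pD; rewrite exprVn sqr_sqrtr //.
  have [e|n] := eqVneq '[D x, x] 0; first by rewrite e invr0 mul0r pos_ge0.
  have dp : 0 < '[D x, x] by rewrite lt_neqAle eq_sym n.
  by rewrite ler_pdivrMl // innerC sqmodC; exact: pos_CSc.
have val D : positive D -> sqmod (inner H x (dir D)) = '[D x, x].
  move=> pD; rewrite /dir innerZr conj_real innerC inner_form; last exact: pos_sa.
  rewrite conj_real -rmorphM sqmod_real.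
  have d0 := pos_ge0 x pD; have [e|n] := eqVneq '[D x, x] 0; first by rewrite e mulr0 expr0n.
  by rewrite exprMn exprVn sqr_sqrtr // expr2 mulrA mulVf ?mul1r.
rewrite -{1}(val A pA) -{1}(val B pB); apply: le_trans (rank_one_lower _ _ _) _.
by apply: smono => //; try exact: rk_pos; move=> y; exact: low.
Qed.

(** If phi0 were 1 / 2, the lower bound would be the arithmetic mean. *)
Lemma phi0_lt_half : differs_from_arith sigma -> phi0 < 2^-1.
Proof.
move=> [A [B [pA pB hne]]]; rewrite ltNge; apply/negP => h; apply: hne.
apply: sa_eq => [||x]; first exact/pos_sa/spos.
  by apply: selfadjoint_arith; exact: pos_sa.
apply/eqP; rewrite eq_le mean_le_arith //= arith_form half_compl -mulrDr.
by apply: le_trans (mean_lower x pA pB); rewrite ler_wpM2r // addr_ge0 ?pos_ge0.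
Qed.

(** Rescaling g1 by kap = d / c makes the two directions p and q orthogonal: the
    congruence by C carries them to multiples of f = g1 + g2 and f' = g1 - g2.
    After it the mean is at most smean (2 G d^2 + O(1)) O(1) at g1, of slope at
    most phi0 + eta in 2 G d^2, and undoing the rescaling multiplies by
    (c / d)^2; the resulting slope 2 c^2 (phi0 + eta) is at most phi0 + 1 / 2 < 1
    for the chosen eta. *)
Lemma mean_damped : differs_from_arith sigma -> damped sigma.
Proof.
move=> hd; have ph := phi0_lt_half hd; have p0 := phi0_ge0.
exists (phi0 + 2^-1); split; [by lra|by lra|].
move=> g1 g2 g11 g22 g12 c d s c0 d0 cd s0.
have g21 : inner H g2 g1 = 0 by rewrite innerC g12 rmorph0.
pose eta := (2^-1 - phi0) / 2; have eta0 : 0 < eta by rewrite divr_gt0 // subr_gt0.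
have [K K0 hK] := smean_upper eta0.
pose kap := d / c; have kap0 : 0 < kap by rewrite divr_gt0.
pose k := 1 + kap ^+ 2; pose sk := s * k.
have k1 : 1 <= k by rewrite lerDl sqr_ge0.
have sk0 : 0 < sk by rewrite mulr_gt0 //; lra.
exists ((c / d) ^+ 2 * ((phi0 + eta) * sk + K * sk)) => G G0.
set p := c%:C *: g1 + d%:C *: g2; set q := c%:C *: g1 - d%:C *: g2.
pose C := spike 1 kap g1.
have pC : positive C by apply: positive_spike => //; exact: ltW.
have lC := sa_lin (pos_sa pC).
have Cg1 : C g1 = kap%:C *: g1 by exact: spike_at.
have Cg2 : C g2 = g2 by rewrite /C spike_ortho // scale1r.
have kc : kap * c = d by rewrite /kap divfK // gt_eqF.
pose f := g1 + g2; pose f' := g1 + (-1)%:C *: g2.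
have f'E : f' = g1 - g2 by rewrite /f' rmorphN rmorph1 scaleN1r.
have Cp : C p = d%:C *: f.
  by rewrite /p (linA_D lC) !(linA_Z lC) Cg1 Cg2 scalerA -rmorphM mulrC kc -scalerDr.
have Cq : C q = d%:C *: f'.
  by rewrite /q (linA_B lC) !(linA_Z lC) Cg1 Cg2 scalerA -rmorphM mulrC kc -scalerBr f'E.
have qE : q = c%:C *: g1 + (- d)%:C *: g2 by rewrite /q rmorphN scaleNr.
have ipc (x y x' y' : R) : inner H (x%:C *: g1 + y%:C *: g2) (x'%:C *: g1 + y'%:C *: g2) = (x * x' + y * y')%:C.
  exact: inner_orthonormal.
have p1 : inner H p p = 1 by rewrite ipc -!expr2 cd.
have q1 : inner H q q = 1 by rewrite qE ipc -!expr2 sqrrN cd.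
have fE1 : f = 1%:C *: g1 + 1%:C *: g2 by rewrite !scale1r.
have f'E1 : f' = 1%:C *: g1 + (-1)%:C *: g2 by rewrite scale1r.
have ff : inner H f f = 2%:C by rewrite fE1 ipc; congr (_%:C); lra.
have f'f' : inner H f' f' = 2%:C by rewrite f'E1 ipc; congr (_%:C); lra.
have ff' : inner H f f' = 0 by rewrite fE1 f'E1 ipc (_ : _ + _ = 0) //; lra.
have f'f : inner H f' f = 0 by rewrite innerC ff' rmorph0.
have Gd : 0 <= G * d ^+ 2 by rewrite mulr_ge0 ?sqr_ge0 // ltW.
pose M g : H -> H := scal sk + ((G * d ^+ 2)%:C *: rk g).
have ME g y : M g y = sk%:C *: y + (G * d ^+ 2)%:C *: (inner H y g *: g) by [].
have pM g : positive (M g) by apply: positive_add; [exact/positive_scal/ltW|exact: prk].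
have pX g : inner H g g = 1 -> positive (spike s G g) by move=> h; apply: positive_spike => //; exact: ltW.
have up g g' y : inner H g g = 1 -> C g = d%:C *: g' ->
    '[(C \o spike s G g \o C) y, y] <= '[M g' y, y].
  move=> gg Cg; rewrite [(C \o _ \o _) y](_ : _ = C (spike s G g (C y))) //.
  rewrite (sa_dot _ _ (pos_sa pC)) [X in X <= _](spike_form s G g (C y)).
  rewrite (ME g' y) -[inner H y g' *: g']/(rk g' y) (dotDl (sk%:C *: y)) (dotZl sk) (dotZl (G * d ^+ 2)).
  have -> : sqmod (inner H (C y) g) = d ^+ 2 * '[rk g' y, y].
    rewrite rk_form ((pos_sa pC).2 y g) Cg innerZr conj_real.
    by case: (inner H y g') => x1 y1; rewrite /sqmod /=; ring.
  have h1 : 0 <= '[rk g' y, y] by rewrite rk_form sqmod_ge0.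
  have h2 : '[C y, C y] <= k * '[y, y].
    have bC : bd 0 (Num.max 1 kap) C.
      by apply: spike_bd => //; rewrite ?ler01 ?(ltW kap0) le_max lexx ?orbT.
    have m1 : 0 <= Num.max 1 kap by rewrite le_max ler01.
    apply: le_trans (bd_sqr y bC m1) _; rewrite ler_wpM2r ?dot_ge0 //.
    by case: (leP 1 kap) => hk; rewrite /k ?expr1n; have := sqr_ge0 kap; lra.
  have h3 : s * '[C y, C y] <= sk * '[y, y] by rewrite /sk -mulrA ler_pM2l.
  have h4 : 0 <= s * (d ^+ 2 * '[rk g' y, y]) by rewrite mulr_ge0 ?(ltW s0) // mulr_ge0 ?sqr_ge0.
  by rewrite mulrBl; move: h3; rewrite (mulrA G); lra.
pose w := smean (sk + 2 * (G * d ^+ 2)) sk.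
have a0 : 0 < sk + 2 * (G * d ^+ 2) by lra.
have Mff g : inner H g g = 2%:C -> M g g = (sk + 2 * (G * d ^+ 2))%:C *: g.
  by move=> h; rewrite ME h scalerA -rmorphM -scalerDl -rmorphD (mulrC 2).
have Mfo g g' : inner H g g' = 0 -> M g' g = sk%:C *: g.
  by move=> h; rewrite ME h scale0r scaler0 addr0.
have T1 := mean_eigen (pM f) (pM f') (ltW a0) (ltW sk0) (Mff _ ff) (Mfo _ _ ff').
have T2 := mean_eigen (pM f) (pM f') (ltW sk0) (ltW a0) (Mfo _ _ f'f) (Mff _ f'f').
rewrite (smean_sym (ltW sk0) (ltW a0)) -/w in T2; rewrite -/w in T1.
have pT := spos (pM f) (pM f'); have lT := sa_lin (pos_sa pT).
have g1E : 2%:C *: g1 = f + f' by rewrite f'E /f; vec.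
have Tg1 : '[sigma (M f) (M f') g1, g1] = w.
  have h : sigma (M f) (M f') (2%:C *: g1) = w%:C *: (2%:C *: g1).
    rewrite g1E (linA_D lT) T1 (scalerDr _ f f'); congr (_ + _); exact: T2.
  have := congr1 (fun v => '[v, g1]) h; rewrite (linA_Z lT) !dotZl inner_unit // mulr1.
  by move=> h2; lra.
pose y := (kap^-1)%:C *: g1.
have Cy : C y = g1 by rewrite /y (linA_Z lC) Cg1 scalerA -rmorphM mulVf ?gt_eqF // scale1r.
have := strans y (pX p p1) (pX q q1) pC; rewrite Cy => /le_trans; apply.
have pcc g : inner H g g = 1 -> positive (C \o spike s G g \o C).
  by move=> h; apply: positive_conj; [exact: pX|exact: pos_sa].
apply: le_trans (smono (pcc p p1) (pcc q q1) (pM f) (pM f') (fun y => up p f y p1 Cp) (fun y => up q f' y q1 Cq) y) _.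
rewrite /y (linA_Z lT) dotZl dotZr Tg1 mulrA -expr2.
have -> : kap^-1 ^+ 2 = (c / d) ^+ 2 by rewrite /kap invf_div.
have hw := hK _ _ a0 sk0; rewrite -/w in hw.
apply: le_trans (ler_wpM2l (sqr_ge0 (c / d)) hw) _.
have cd2 : (c / d) ^+ 2 * d ^+ 2 = c ^+ 2 by rewrite -exprMn divfK // gt_eqF.
have -> : (c / d) ^+ 2 * ((phi0 + eta) * (sk + 2 * (G * d ^+ 2)) + K * sk) =
   2 * (phi0 + eta) * G * ((c / d) ^+ 2 * d ^+ 2) + (c / d) ^+ 2 * ((phi0 + eta) * sk + K * sk) by ring.
rewrite lerD2r cd2.
have -> : 2 * (phi0 + eta) = phi0 + 2^-1 by rewrite /eta; lra.
have c1 : c ^+ 2 <= 1 by have := sqr_ge0 d; lra.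
by rewrite ler_piMr // mulr_ge0 ?(ltW G0) //; lra.
Qed.
End SymmetricMean.

(** * The harmonic mean as a mean on all positive operators *)

Section MonotoneLimits.
Context {R : realType} {H : hilbertType R}.
Implicit Types (A B T : H -> H) (X Y : nat -> H -> H) (x y : H).

Lemma gap_sqr (K : R) A B x : positive A -> positive B ->
  (forall y, '[B y, y] <= '[A y, y]) -> (forall y, '[A y, y] <= K * '[y, y]) ->
  '[A x - B x, A x - B x] <= K * ('[A x, x] - '[B x, x]).
Proof.
move=> pA pB BA hK; have sA := pos_sa pA; have sB := pos_sa pB.
have pD : positive (A - B) by apply/(op_leP sB sA).
rewrite -dotBl; apply: (pos_sqr_le x pD) => y.
rewrite [(A - B) y](_ : _ = A y - B y) // dotBl.
by have := hK y; have := pos_ge0 y pB; lra.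
Qed.

Lemma antitone_cauchy (u : nat -> R) : (forall n, u n.+1 <= u n) -> (forall n, 0 <= u n) ->
  forall e : R, 0 < e -> exists N, forall n, (N <= n)%N -> u N - u n <= e.
Proof.
move=> dec u0 e e0.
have hi : has_inf (range u) by split; [exists (u 0%N), 0%N|exists 0 => _ [n _ <-]].
have [_ [N _ <-] hN] := inf_adherent e0 hi; exists N => n _.
have : inf (range u) <= u n by apply: ge_inf; [exact: hi.2|exists n].
by lra.
Qed.

Lemma antitone_forms X x n m : (forall n x, '[X n.+1 x, x] <= '[X n x, x]) -> (n <= m)%N ->
  '[X m x, x] <= '[X n x, x].
Proof.
move=> dec nm; rewrite -(subnK nm); elim: (m - n)%N => [|k IH]; first by [].
by apply: le_trans (dec _ _) IH.
Qed.

(** A decreasing sequence of positive operators converges strongly: the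
    forms converge, and the squared norm of a difference is controlled by
    the difference of the forms. *)
Lemma vigier X : (forall n, positive (X n)) -> (forall n x, '[X n.+1 x, x] <= '[X n x, x]) ->
  exists2 T, positive T & forall x, (fun n => X n x) @ \oo --> T x.
Proof.
move=> pX dec.
have [K K0 hK] := sa_bounds (pos_sa (pX 0%N)).
have hK0 n y : '[X n y, y] <= K * '[y, y].
  by apply: le_trans (antitone_forms y dec (leq0n n)) _; have /andP[] := hK y.
have cau x : exists l, forall e : R, 0 < e -> exists N, forall n, (N <= n)%N -> nrm (X n x - l) <= e.
  apply: hilbert_complete => e e0.
  have d0 : 0 < (e / 2) ^+ 2 / K by rewrite divr_gt0 // exprn_gt0 // divr_gt0.
  have [N hN] := antitone_cauchy (u := fun n => '[X n x, x]) (fun n => dec n x)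
    (fun n => pos_ge0 x (pX n)) d0.
  have near n : (N <= n)%N -> nrm (X N x - X n x) <= e / 2.
    move=> Nn; rewrite nrm_le ?divr_ge0 ?(ltW e0) //.
    apply: le_trans (gap_sqr x (pX N) (pX n) (fun y => antitone_forms y dec Nn) (hK0 N)) _.
    by rewrite mulrC -ler_pdivlMr // hN.
  exists N => n m Nn Nm; rewrite (_ : X n x - X m x = (X N x - X m x) - (X N x - X n x)); last by vec.
  by apply: le_trans (nrmD _ _) _; rewrite nrmN; have := near n Nn; have := near m Nm; lra.
have [T hT] := choice cau.
have lim x : (fun n => X n x) @ \oo --> T x by apply/hilbert_cvgP; exact: hT.
exists T => //; apply/positiveP; split.
  apply: (selfadjoint_limit (ltW K0) (fun n => pos_sa (pX n)) _ lim) => n x.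
  rewrite nrm_le ?mulr_ge0 ?nrm_ge0 ?(ltW K0) // exprMn nrm_sqr expr2 -mulrA.
  by apply: le_trans (pos_sqr_le x (pX n) (hK0 n)) _; rewrite ler_pM2l.
move=> x; apply: cvgr_to_ge (dot_limit x (lim x)) _.
by apply: nearW => n; exact: pos_ge0.
Qed.

Lemma decreases_le X T n x : (forall n, positive (X n)) -> op_decreases_to X T ->
  '[T x, x] <= '[X n x, x].
Proof.
move=> pX [dec lim]; apply: cvgr_to_le (dot_limit x (lim x)) _; exists n => // m /= nm.
by apply: antitone_forms nm => k y; exact: op_le_form.
Qed.

Lemma decreases_form X T x (e : R) : op_decreases_to X T -> 0 < e ->
  exists N, forall n, (N <= n)%N -> '[X n x, x] <= '[T x, x] + e.
Proof.
move=> [_ lim] e0; have /cvgrPdist_le/(_ _ e0)[N _ hN] := dot_limit x (lim x).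
by exists N => n /hN /= h; have := ler_norm (- ('[T x, x] - '[X n x, x])); rewrite normrN; lra.
Qed.

Lemma decreases_of_forms X T : (forall n, positive (X n)) -> positive T ->
  (forall n x, '[X n.+1 x, x] <= '[X n x, x]) -> (forall n x, '[T x, x] <= '[X n x, x]) ->
  (forall x (e : R), 0 < e -> exists n, '[X n x, x] <= '[T x, x] + e) -> op_decreases_to X T.
Proof.
move=> pX pT dec TX near; split=> [n|x].
  by apply/(op_leP (pos_sa (pX _)) (pos_sa (pX _))).
have [K K0 hK] := sa_bounds (pos_sa (pX 0%N)).
apply/hilbert_cvgP => e e0.
have d0 : 0 < e ^+ 2 / K by rewrite divr_gt0 // exprn_gt0.
have [N hN] := near x _ d0; exists N => n Nn; rewrite nrm_le; last exact: ltW.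
have hKn y : '[X n y, y] <= K * '[y, y].
  by apply: le_trans (antitone_forms y dec (leq0n n)) _; have /andP[] := hK y.
apply: le_trans (gap_sqr x (pX n) pT (TX n) hKn) _.
by rewrite mulrC -ler_pdivlMr //; have := antitone_forms x dec Nn; lra.
Qed.
End MonotoneLimits.

Section ParallelSum.
Context {R : realType} {H : hilbertType R}.
Implicit Types (A B C D T S : H -> H) (x y : H).

(** The parallel sum, half the harmonic mean, through its variational
    characterization, which makes sense for operators without inverse. *)
Definition is_parallel_sum A B T := [/\ positive T,
  forall x y, '[T x, x] <= '[A y, y] + '[B (x - y), x - y] &
  forall x (e : R), 0 < e -> exists y, '[A y, y] + '[B (x - y), x - y] <= '[T x, x] + e].

Lemma parallel_sum_mono A B C D T S : is_parallel_sum A B T -> is_parallel_sum C D S ->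
  (forall x, '[A x, x] <= '[C x, x]) -> (forall x, '[B x, x] <= '[D x, x]) ->
  forall x, '[T x, x] <= '[S x, x].
Proof.
move=> [_ low _] [_ _ up] AC BD x; apply: (@le_eps _ _ _ 1) => e e0; rewrite mul1r.
have [y hy] := up x e e0; apply: le_trans hy; apply: le_trans (low x y) _.
exact: lerD.
Qed.

Lemma parallel_sum_unique A B T S : is_parallel_sum A B T -> is_parallel_sum A B S -> T = S.
Proof.
move=> hT hS; apply: sa_eq => [||x]; [by case: hT => /pos_sa|by case: hS => /pos_sa|].
by apply/eqP; rewrite eq_le (parallel_sum_mono hT hS) ?(parallel_sum_mono hS hT).
Qed.

Lemma parallel_sum_sym A B T : is_parallel_sum A B T -> is_parallel_sum B A T.
Proof.
move=> [pT low up]; split=> // x y; last first.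
  move=> /(up x)[z hz]; exists (x - z).
  by rewrite (_ : x - (x - z) = z) ?(addrC '[B _, _]) //; vec.
by have := low x (x - y); rewrite (_ : x - (x - y) = y) ?(addrC '[A _, _]) //; vec.
Qed.

(** With w = T x the infimum is reached at y = A^-1 w, x - y = B^-1 w, and the
    rest of the quadratic function is a square. *)
Lemma parallel_sum_spos A B : strictly_positive A -> strictly_positive B ->
  is_parallel_sum A B (op_inv (op_inv A + op_inv B)).
Proof.
move=> sA sB; set S := op_inv A + op_inv B.
have iA := op_inv_spos sA; have iB := op_inv_spos sB.
have sS : strictly_positive S.
  have [m [M [m0 _ [sA' hA] [sB' hB]]]] := spos_bd2 iA iB.
  apply: (@bd_spos _ _ m (M + M)) => //; split=> [|x]; first exact: selfadjoint_add.
  rewrite [S x](_ : _ = op_inv A x + op_inv B x) // dotDl mulrDl.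
  have /andP[a1 a2] := hA x; have /andP[b1 b2] := hB x.
  have := mulr_ge0 (ltW m0) (dot_ge0 x); lra.
set T := op_inv S.
have eq x y : '[A y, y] + '[B (x - y), x - y] =
    '[T x, x] + ('[A (y - op_inv A (T x)), y - op_inv A (T x)] + '[B (y - op_inv A (T x)), y - op_inv A (T x)]).
  set w := T x; set u := op_inv A w; set v := op_inv B w.
  have xE : x = u + v by rewrite -[x](spos_inv sS).1.
  set d := y - u; have -> : y = u + d by rewrite /d; vec.
  have -> : x - (u + d) = v - d by rewrite xE; vec.
  have Au : A u = w by exact: (spos_inv sA).1.
  have Bv : B v = w by exact: (spos_inv sB).1.
  have lA := sa_lin (spos_sa sA); have lB := sa_lin (spos_sa sB).
  clearbody d u v; rewrite xE (linA_D lA) (linA_B lB) Au Bv; clearbody w; dots.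
  rewrite (sa_dot d u (spos_sa sA)) (sa_dot d v (spos_sa sB)) Au Bv (dotC d w); ring.
have sT := op_inv_spos sS; split; first exact: sT.1.
  by move=> x y; rewrite eq lerDl addr_ge0 ?pos_ge0 //; [exact: sA.1|exact: sB.1].
move=> x e e0; exists (op_inv A (T x)); rewrite eq subrr.
by rewrite (linA_0 (sa_lin (spos_sa sA))) (linA_0 (sa_lin (spos_sa sB))) !dot0l !addr0 lerDl ltW.
Qed.

(** Regularize by A + 1 / (n + 1) and B + 1 / (n + 1): the parallel sums decrease, and
    the variational inequalities pass to the strong limit. *)
Lemma parallel_sum_exists A B : positive A -> positive B -> exists T, is_parallel_sum A B T.
Proof.
move=> pA pB; pose r (n : nat) : R := n.+1%:R^-1.
have r0 n : 0 < r n by rewrite invr_gt0.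
have rdec n : r n.+1 <= r n by rewrite lef_pV2 ?posrE // ler_nat.
pose reg D n := D + scal (r n) : H -> H.
have regE D n x : '[reg D n x, x] = '[D x, x] + r n * '[x, x].
  by rewrite [reg D n x](_ : _ = D x + (r n)%:C *: x) // dotDl dotZl.
have sreg D n : positive D -> strictly_positive (reg D n).
  move=> pD; have [K K0 hK] := sa_bounds (pos_sa pD).
  apply: (@bd_spos _ _ (r n) (K + r n)) => //; split.
    by apply: selfadjoint_add; [exact: pos_sa|exact: selfadjoint_scal].
  move=> x; rewrite regE; have /andP[_ h] := hK x; have := pos_ge0 x pD; lra.
pose X n := op_inv (op_inv (reg A n) + op_inv (reg B n)).
have hX n : is_parallel_sum (reg A n) (reg B n) (X n) by apply: parallel_sum_spos; exact: sreg.
have pX n : positive (X n) by case: (hX n).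
have rmono D n x : '[reg D n.+1 x, x] <= '[reg D n x, x].
  by rewrite !regE lerD2l ler_wpM2r ?dot_ge0.
have dec n x : '[X n.+1 x, x] <= '[X n x, x] by apply: parallel_sum_mono (hX _) (hX _) _ _ x.
have [T pT lim] := vigier pX dec.
have dX : op_decreases_to X T.
  by split=> // n; apply/(op_leP (pos_sa (pX _)) (pos_sa (pX _))).
exists T; split=> // x.
  move=> y; apply: (@le_eps _ _ _ 1) => e e0; rewrite mul1r.
  have [n /(_ n (leqnn n))] := inv_small ('[y, y] + '[x - y, x - y]) e0; rewrite -/(r n) => hn.
  apply: le_trans (decreases_le n x pX dX) _; have [_ low _] := hX n.
  by apply: le_trans (low x y) _; rewrite !regE; lra.
move=> e e0; have e2 : 0 < e / 2 by rewrite divr_gt0.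
have [N hN] := decreases_form x dX e2; have [_ _ /(_ x _ e2)[y hy]] := hX N.
exists y; have := hN N (leqnn N); move: hy; rewrite !regE.
have := mulr_ge0 (ltW (r0 N)) (dot_ge0 y); have := mulr_ge0 (ltW (r0 N)) (dot_ge0 (x - y)); lra.
Qed.

Definition parallel_sum A B : H -> H := xget 0 [set T | is_parallel_sum A B T].
Lemma parallel_sumP A B : positive A -> positive B -> is_parallel_sum A B (parallel_sum A B).
Proof. by move=> pA pB; have [T hT] := parallel_sum_exists pA pB; exact: (@xgetPex _ 0 _ (ex_intro _ T hT)). Qed.

Definition harmonic_mean A B : H -> H := 2%:C *: parallel_sum A B.
Lemma harmonic_mean_form A B x : '[harmonic_mean A B x, x] = 2 * '[parallel_sum A B x, x].
Proof. by rewrite -dotZl. Qed.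
Lemma harmonic_mean_positive A B : positive A -> positive B -> positive (harmonic_mean A B).
Proof. by move=> pA pB; apply: positive_scale => //; case: (parallel_sumP pA pB). Qed.

Lemma parallel_sum_diag A : positive A -> parallel_sum A A = 2^-1%:C *: A.
Proof.
move=> pA; apply: parallel_sum_unique (parallel_sumP pA pA) _.
have qE x : '[(2^-1%:C *: A) x, x] = 2^-1 * '[A x, x] by rewrite -dotZl.
have lA := sa_lin (pos_sa pA).
have eq x y : '[A y, y] + '[A (x - y), x - y] = 2^-1 * '[A x, x] +
    2 * '[A (y - 2^-1%:C *: x), y - 2^-1%:C *: x].
  rewrite !(linA_B lA) (linA_Z lA) !(dotBl, dotBr, dotZl, dotZr) (sa_dot x y (pos_sa pA)) (dotC x).
  by field.
split=> [|x y|x e e0]; first by apply: positive_scale; rewrite ?half_ge0.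
  by rewrite eq qE lerDl mulr_ge0 // pos_ge0.
by exists (2^-1%:C *: x); rewrite eq qE subrr (linA_0 lA) dot0l mulr0 addr0 lerDl ltW.
Qed.

(** Near a nearly optimal y for A and B, the forms of X n and Y n are close to their
    limits, so the forms of the parallel sums converge. *)
Lemma parallel_sum_cont X Y A B : (forall n, positive (X n)) -> (forall n, positive (Y n)) ->
  positive A -> positive B -> op_decreases_to X A -> op_decreases_to Y B ->
  op_decreases_to (fun n => parallel_sum (X n) (Y n)) (parallel_sum A B).
Proof.
move=> pX pY pA pB dX dY; have pT n := parallel_sumP (pX n) (pY n); have pS := parallel_sumP pA pB.
apply: decreases_of_forms => [n||n x|n x|x e e0]; first by case: (pT n).
- by case: pS.
- by apply: parallel_sum_mono (pT _) (pT _) _ _ x => z; apply: op_le_form; [exact: dX.1|exact: dY.1].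
- apply: parallel_sum_mono pS (pT n) _ _ x => z; [exact: decreases_le dX|exact: decreases_le dY].
have e3 : 0 < e / 3 by rewrite divr_gt0.
have [_ _ /(_ x _ e3)[y hy]] := pS.
have [N hN] := decreases_form y dX e3; have [M hM] := decreases_form (x - y) dY e3.
exists (maxn N M); have [_ low _] := pT (maxn N M); apply: le_trans (low x y) _.
have := hN _ (leq_maxl N M); have := hM _ (leq_maxr N M); lra.
Qed.

Lemma harmonic_mean_symmetric : symmetric_mean harmonic_mean.
Proof.
have sab A B (pA : positive A) (pB : positive B) := pos_sa (harmonic_mean_positive pA pB).
split; last first.
  move=> A B pA pB; congr (_ *: _).
  exact: parallel_sum_unique (parallel_sumP pA pB) (parallel_sum_sym (parallel_sumP pB pA)).
split; last first.
  by move=> A pA; rewrite /harmonic_mean parallel_sum_diag // scalerA -rmorphM mulfV // scale1r.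
split=> [A B|A B C D pA pB pC pD AC BD|A B C pA pB pC|X Y A B pX pY pA pB dX dY].
- exact: harmonic_mean_positive.
- apply/(op_leP (sab _ _ pA pB) (sab _ _ pC pD)) => x.
  rewrite !harmonic_mean_form ler_pM2l //.
  by apply: parallel_sum_mono (parallel_sumP pA pB) (parallel_sumP pC pD) _ _ x => y; exact: op_le_form.
- have sC := pos_sa pC; have pA' := positive_conj pA sC; have pB' := positive_conj pB sC.
  apply/(op_leP (selfadjoint_conj (sab _ _ pA pB) sC) (sab _ _ pA' pB')) => x.
  rewrite /= (sa_dot _ _ sC) !harmonic_mean_form ler_pM2l //.
  have [_ low _] := parallel_sumP pA pB; have [_ _ up] := parallel_sumP pA' pB'.
  apply: (@le_eps _ _ _ 1) => e e0; rewrite mul1r; have [y hy] := up x e e0.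
  apply: le_trans hy; apply: le_trans (low (C x) (C y)) _.
  by rewrite -(linA_B (sa_lin sC)) /= !(sa_dot _ _ sC).
have [dec lim] := parallel_sum_cont pX pY pA pB dX dY; split=> [n|x].
  apply/(op_leP (sab _ _ (pX _) (pY _)) (sab _ _ (pX _) (pY _))) => x.
  by rewrite !harmonic_mean_form ler_pM2l //; exact: op_le_form.
exact: cvgZr (lim x).
Qed.

Lemma harmonic_mean_differs : (exists x : H, x != 0) -> differs_from_arith harmonic_mean.
Proof.
move=> [x x0]; have p1 : positive (@scal R H 1) by exact: positive_scal.
have p0 : positive (@scal R H 0) by exact: positive_scal.
exists (scal 1), (scal 0); split=> // h.
have := congr1 (fun T : H -> H => '[T x, x]) h.
rewrite harmonic_mean_form arith_form !dotZl mul0r mulr0 addr0 mul1r half_compl.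
have [_ low _] := parallel_sumP p1 p0; have := low x 0.
rewrite !dotZl !mul1r mul0r dot0l addr0 => h1 h2; have := dot_gt0 x0; lra.
Qed.
End ParallelSum.

(** * The equivalences *)

Section Main.
Context {R : realType} {H : hilbertType R}.
Implicit Types (A B C D : H -> H) (f : R -> R).

Lemma spectrum_pos A : selfadjoint A -> (exists x : H, x != 0) ->
  spectrum A `<=` (fun t : R => t%:C) @` `]0, +oo[ -> strictly_positive A.
Proof.
move=> sA hx hs; have [c [/hs[t t0 /complexI e] hc]] := inf_spectrum sA hx.
have c0 : 0 < c by move: t0; rewrite e /= in_itv /= andbT.
by have [M _ bA] := bd_upper sA hc; exact: bd_spos bA.
Qed.

Lemma bd_spectrum m M A : 0 < m -> bd m M A -> spectrum A `<=` (fun t : R => t%:C) @` `]0, +oo[.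
Proof.
move=> m0 bA z hz; have zE : z = (Re z)%:C.
  by apply/eqP; rewrite eq_complex /= eqxx (spectrum_real (bd_sa bA) hz) eqxx.
exists (Re z) => //; rewrite /= in_itv /= andbT; rewrite zE in hz.
by have /andP[h _] := spectrum_bd bA hz; exact: lt_le_trans h.
Qed.

Lemma spos_form_le f A B : (forall t : R, 0 < t -> cont_at f t) -> monotone_on H f ->
  strictly_positive A -> strictly_positive B -> op_le A B -> op_le (cfc f A) (cfc f B).
Proof.
move=> fc mon sA sB AB; have [m [M [m0 mM bA bB]]] := spos_bd2 sA sB.
have hc t : m <= t <= M -> cont_at f t by case/andP=> h _; apply: fc; apply: lt_le_trans h.
apply/(op_leP (cfc_sa mM bA hc) (cfc_sa mM bB hc)); apply: (mon m M) => // x.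
exact: op_le_form.
Qed.
End Main.

(** Quantifying over all Hilbert spaces costs nothing, as monotonicity transfers from
    an infinite-dimensional space to every other; on the zero space there is
    nothing to order. *)
Lemma operator_monotoneP (R : realType) (H : hilbertType R) (f : R -> R) :
  infinite_dimensional H -> (forall t : R, 0 < t -> cont_at f t) ->
  operator_monotone `]0, +oo[ f <-> monotone_on H f.
Proof.
move=> Hinf fc; split=> [mon m M A B m0 mM bA bB AB x|mon K A B sA sB hA hB AB].
  apply: op_le_form; apply: mon (bd_sa bA) (bd_sa bB) (bd_spectrum m0 bA) (bd_spectrum m0 bB) _.
  exact/(op_leP (bd_sa bA) (bd_sa bB)).
have [hx|hx] := pselect (exists x : K, x != 0).
  apply: spos_form_le => //; [exact: monotone_transfer mon|exact: spectrum_pos..].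
have z (x : K) : x = 0 by apply: contrapT => /eqP h; apply: hx; exists x.
have zT (T : K -> K) : positive T.
  split=> [|x]; last by rewrite (z (T x)) -(scale0r (0 : K)) innerZl mul0r.
  split=> [c x y|]; first by rewrite (z (T _)) (z (_ + _)).
  by exists 0 => x; rewrite (z (T x)) normr0 mul0r.
exact: zT.
Qed.

Theorem theorem3p4 (R : realType) (H : hilbertType R)
    (Hinf : infinite_dimensional H) (f : R -> R)
    (fpos : forall x : R, 0 < x -> 0 < f x)
    (fcont : {within `]0, +oo[, continuous f}) :
  [<->
    (* I1 *)
    operator_monotone `]0, +oo[ f;
    (* I2 *)
    forall A B : H -> H, strictly_positive A -> strictly_positive B ->
      op_le (arith_mean 2^-1 (cfc f A) (cfc f B)) (cfc f (arith_mean 2^-1 A B));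
    (* I3 *)
    forall A B : H -> H, strictly_positive A -> strictly_positive B ->
      forall t : R, 0 <= t <= 1 ->
      op_le (arith_mean t (cfc f A) (cfc f B)) (cfc f (arith_mean t A B));
    (* I4 *)
    forall A B : H -> H, strictly_positive A -> strictly_positive B ->
      op_le (cfc f (harm_mean 2^-1 A B)) (geom_mean 2^-1 (cfc f A) (cfc f B));
    (* I5 *)
    forall A B : H -> H, strictly_positive A -> strictly_positive B ->
      forall t : R, 0 <= t <= 1 ->
      op_le (cfc f (harm_mean t A B)) (geom_mean t (cfc f A) (cfc f B));
    (* I6 *)
    forall A B : H -> H, strictly_positive A -> strictly_positive B ->
      op_le (cfc f (harm_mean 2^-1 A B)) (harm_mean 2^-1 (cfc f A) (cfc f B));
    (* I7 *)
    forall A B : H -> H, strictly_positive A -> strictly_positive B ->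
      forall t : R, 0 <= t <= 1 ->
      op_le (cfc f (harm_mean t A B)) (harm_mean t (cfc f A) (cfc f B));
    (* I8 *)
    forall A B : H -> H, strictly_positive A -> strictly_positive B ->
      forall sigma, symmetric_mean sigma ->
      op_le (cfc f (harm_mean 2^-1 A B)) (sigma (cfc f A) (cfc f B));
    (* I9 *)
    exists sigma, [/\ symmetric_mean sigma, differs_from_arith sigma &
      forall A B : H -> H, strictly_positive A -> strictly_positive B ->
      op_le (cfc f (harm_mean 2^-1 A B)) (sigma (cfc f A) (cfc f B))]
  ].
Proof.
have fc : forall t : R, 0 < t -> cont_at f t := cont_within fcont.
have h01 : 0 <= (2^-1 : R) <= 1 := half01.
have sf (A : H -> H) : strictly_positive A -> strictly_positive (cfc f A) by exact: cfc_spos.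
have [u hu] := infinite_orthonormal 2 Hinf.
have u11 : inner H (u 0%N) (u 0%N) = 1 by rewrite hu.
have u22 : inner H (u 1%N) (u 1%N) = 1 by rewrite hu.
have u12 : inner H (u 0%N) (u 1%N) = 0 by rewrite hu.
have monP := operator_monotoneP Hinf fc.
have sh t (A B : H -> H) : 0 <= t <= 1 -> strictly_positive A -> strictly_positive B ->
    selfadjoint (cfc f (harm_mean t A B)).
  by move=> t01 sA sB; apply/spos_sa/sf/harm_spos.
have concave : monotone_on H f -> forall A B : H -> H, strictly_positive A -> strictly_positive B ->
    forall t : R, 0 <= t <= 1 -> op_le (arith_mean t (cfc f A) (cfc f B)) (cfc f (arith_mean t A B)).
  move=> mon A B sA sB t t01; have [m [M [m0 mM bA bB]]] := spos_bd2 sA sB.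
  apply/op_leP => [||x]; [exact/spos_sa/arith_spos/sf/sB/sf|exact/spos_sa/sf/arith_spos|].
  by rewrite arith_form; exact: (monotone_concave x Hinf fc mon m0 mM bA bB).
have monotone_of_concave : (forall A B : H -> H, strictly_positive A -> strictly_positive B ->
    op_le (arith_mean 2^-1 (cfc f A) (cfc f B)) (cfc f (arith_mean 2^-1 A B))) -> monotone_on H f.
  move=> h; apply: midconcave_monotone => // A B sA sB x; exact/op_le_form/h.
have harm_ineq : monotone_on H f -> forall A B : H -> H, strictly_positive A -> strictly_positive B ->
    forall t : R, 0 <= t <= 1 -> op_le (cfc f (harm_mean t A B)) (harm_mean t (cfc f A) (cfc f B)).
  move=> mon A B sA sB t t01.
  (* f of a harmonic mean is the inverse of g of an arithmetic mean, for the
     conjugate g of f by inversion, which is concave. *)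
  have monG := monotone_inv_dual fpos fc mon; set g := inv_dual f in monG.
  have gc : forall t : R, 0 < t -> cont_at g t := inv_dual_cont fpos fc.
  have gp : forall t : R, 0 < t -> 0 < g t := inv_dual_pos fpos.
  have gE (C : H -> H) : strictly_positive C -> cfc g C = op_inv (cfc f (op_inv C)).
    by move=> /spos_bd[m [M [m0 mM bC]]]; exact: cfc_inv_dual bC.
  have sg (C : H -> H) : strictly_positive C -> strictly_positive (cfc g C) by exact: cfc_spos.
  have iA := op_inv_spos sA; have iB := op_inv_spos sB.
  have sE := arith_spos t01 iA iB; set E := arith_mean t _ _ in sE.
  have sF := arith_spos t01 (sg _ iA) (sg _ iB).
  have [m [M [m0 mM bF bE]]] := spos_bd2 sF (sg _ sE).
  apply/op_leP => [||x]; [exact: sh|exact/spos_sa/harm_spos/sf/sB/sf|].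
  have inv_le := inv_antitone x bF bE m0 (lt_trans m0 mM).
  have fE : cfc f (op_inv E) = op_inv (cfc g E) by rewrite gE // spos_op_invK //; exact/sf/op_inv_spos.
  rewrite !harm_meanE -/E fE -{1}(spos_op_invK sA) -{1}(spos_op_invK sB) -!gE //.
  apply: inv_le => y; rewrite arith_form.
  have [m' [M' [m0' mM' bC bD]]] := spos_bd2 iA iB.
  exact: (monotone_concave y Hinf gc monG m0' mM' bC bD).
have geom_ineq : monotone_on H f -> forall A B : H -> H, strictly_positive A -> strictly_positive B ->
    forall t : R, 0 <= t <= 1 -> op_le (cfc f (harm_mean t A B)) (geom_mean t (cfc f A) (cfc f B)).
  move=> mon A B sA sB t t01; have pG := geom_positive (sf _ sA) (sf _ sB) t.
  apply/op_leP => [||x]; [exact: sh|exact: pos_sa|].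
  apply: le_trans (op_le_form x (harm_ineq mon _ _ sA sB t t01)) _.
  by apply: harm_le_geom => //; exact: sf.
have monotone_of_geom : (forall A B : H -> H, strictly_positive A -> strictly_positive B ->
    op_le (cfc f (harm_mean 2^-1 A B)) (geom_mean 2^-1 (cfc f A) (cfc f B))) -> monotone_on H f.
  move=> h; apply: (harm_ineq_monotone Hinf fpos fc geom_le_arith geom_damped) => A B sA sB x.
  exact/op_le_form/h.
have monotone_of_harm : (forall A B : H -> H, strictly_positive A -> strictly_positive B ->
    op_le (cfc f (harm_mean 2^-1 A B)) (harm_mean 2^-1 (cfc f A) (cfc f B))) -> monotone_on H f.
  move=> h; apply: monotone_of_geom => A B sA sB; have pG := geom_positive (sf _ sA) (sf _ sB) 2^-1.
  apply/op_leP => [||x]; [exact: sh|exact: pos_sa|].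
  apply: le_trans (op_le_form x (h _ _ sA sB)) _.
  by apply: harm_le_geom => //; exact: sf.
have sym_ineq : monotone_on H f -> forall A B : H -> H, strictly_positive A -> strictly_positive B ->
    forall sigma, symmetric_mean sigma -> op_le (cfc f (harm_mean 2^-1 A B)) (sigma (cfc f A) (cfc f B)).
  move=> mon A B sA sB sigma hs.
  have pS := connection_pos hs.1.1 (sf _ sA).1 (sf _ sB).1.
  apply/op_leP => [||x]; [exact: sh|exact: pos_sa|].
  apply: le_trans (op_le_form x (harm_ineq mon _ _ sA sB _ h01)) _.
  by apply: (harm_le_mean hs u11 u22 u12); exact: sf.
have hx : exists x : H, x != 0 by exists (u 0%N); exact: unit_neq0.
have monotone_of_sym : (exists sigma : (H -> H) -> (H -> H) -> H -> H, [/\ symmetric_mean sigma, differs_from_arith sigma &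
      forall A B : H -> H, strictly_positive A -> strictly_positive B ->
      op_le (cfc f (harm_mean 2^-1 A B)) (sigma (cfc f A) (cfc f B))]) -> monotone_on H f.
  move=> [sigma [hs hd h]].
  apply: (harm_ineq_monotone Hinf fpos fc (tau := sigma)) => [A B sA sB x||A B sA sB x].
  - exact: (mean_le_arith hs u11 u22 u12 x sA.1 sB.1).
  - exact: (mean_damped Hinf hs u11 u22 u12 hd).
  exact/op_le_form/h.
tfae.
- by move=> /monP/concave h A B sA sB; exact: h.
- by move=> /monotone_of_concave/concave.
- by move=> h; have mon := monotone_of_concave (fun A B sA sB => h A B sA sB _ h01) => A B sA sB; exact: geom_ineq.
- by move=> /monotone_of_geom/geom_ineq.
- by move=> h; have mon := monotone_of_geom (fun A B sA sB => h A B sA sB _ h01) => A B sA sB; exact: harm_ineq.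
- by move=> /monotone_of_harm/harm_ineq.
- by move=> h; exact: sym_ineq (monotone_of_harm (fun A B sA sB => h A B sA sB _ h01)).
- by move=> h; exists harmonic_mean; split; [exact: harmonic_mean_symmetric|exact: harmonic_mean_differs|
    move=> A B sA sB; apply: h => //; exact: harmonic_mean_symmetric].
- by move=> /monotone_of_sym/monP.
Qed.
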